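(* There is a fibered golden polyhedron exchange map $\widehat\Psi:\widehat\Sigma\to\widehat\Sigma$ on the flat $3$-torus $\widehat\Sigma=(\mathbb{R}/2\mathbb{Z})^3$ such that the map $\Theta:\Sigma\to\widehat\Sigma$ given by $$\Theta(x,y)=\Big(1,\tfrac12,0\Big)+\Big(\frac{x}{\phi},\frac{x-y}{2},y\Big)\quad\text{(coordinates taken mod }2\mathbb{Z})$$ is an injective embedding which is a semi-conjugacy between $\Psi$ and $\widehat\Psi$; that is, $\widehat\Psi\circ\Theta=\Theta\circ\Psi$ wherever all maps are defined.
   Context: Let $\phi=(1+\sqrt5)/2$ and $\mathbb{Z}[\phi]=\{m+n\phi: m,n\in\mathbb{Z}\}$. The Penrose kite $K$ is the convex (solid) quadrilateral with vertices $(-1,0),(0,1),(0,-1),(\phi^{-3},0)$. The outer billiards map on $\mathbb{R}^2-K$ sends $x_0$ to the point $x_1$ such that the segment $\overline{x_0x_1}$ is tangent to $K$ at its midpoint and $K$ lies to the right of the ray from $x_0$ through $x_1$ ($x_1=2v-x_0$ with $v$ a vertex of $K$; undefined when $v$ is not unique). Let $\psi$ be the square of the outer billiards map. Return map $\Psi$: Let $\Sigma=\mathbb{R}\times(-2,2]$. Let $B$ be the set of points of $\Sigma$ in the two triangles with vertices $(0,1),(-\phi^{-3},2),(1,2)$ and $(0,-1),(-\phi^{-3},-2),(1,-2)$ (bounded by extensions of the sides of $K$). Let $\Sigma_-$ and $\Sigma_+$ be the two components (left and right) of $\Sigma-K-B$. Let $\Psi_\pm:\Sigma_\pm\to\Sigma_\pm$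 be the first return map of $\psi$ to $\Sigma_\pm$. Then $\Psi:\Sigma\to\Sigma$ is $\Psi_+$ on $\Sigma_+$, $\Psi_-$ on $\Sigma_-$, and the identity on $K\cup B$. Polyhedron exchange maps: a polytope exchange map on a compact flat manifold $M$ consists of two finite partitions $X_1,X_2$ of $M$ into convex polytopes (meeting only along boundaries) and a piecewise isometric bijection $f$ which, on (the interior of) each polytope $P$ of $X_1$, is a translation with $f(P)$ a polytope of $X_2$; technically $f$ is not defined on the boundaries of the polytopes of $X_1$. For $M=\mathbb{R}^n/\Lambda$ with $\Lambda\subset\mathbb{Z}^n$ a discrete group of translations, a polytope in $M$ is golden if any lift to $\mathbb{R}^n$ has all vertices with coordinates in $\mathbb{Z}[\phi]$; the exchange map is golden if all the polytopes are golden and all translations are by vectors in $\mathbb{Z}[\phi]^n$. A golden polyhedron exchange map on $\widehat\Sigma$ is fibered if it preserves each horizontal $2$-torus (third coordinate constant) and its restriction to each horizontal $2$-torus whose height lies in $\mathbb{Z}[\phi]$ is a golden polygon exchange map. *)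

(* Defs.v *)
From HB Require Import structures.
From mathcomp Require Import all_boot all_order all_algebra.
From mathcomp Require Import generic_quotient.
From mathcomp Require Import all_classical all_reals all_analysis.

Set Implicit Arguments.
Unset Strict Implicit.
Unset Printing Implicit Defensive.

Import Order.TTheory GRing.Theory Num.Theory.
Import numFieldNormedType.Exports.

Local Open Scope classical_set_scope.
Local Open Scope ring_scope.
Local Open Scope quotient_scope.

(* A partial map from T to U is represented by its graph. *)
Definition pfun_graph (T U : Type) : Type := T -> U -> Prop.

Definition pfun_comp (T U V : Type) (g : pfun_graph U V) (f : pfun_graph T U) : pfun_graph T V :=
  fun p r => exists q, f p q /\ g q r.

(* [first_return f S p q]: starting at p in S, the f-orbit of p is defined up
   to its first return to S in positive time, and q is the return point. *)
Definition first_return (T : Type) (f : pfun_graph T T) (S : set T) : pfun_graph T T :=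
  fun p q => exists (n : nat) (u : nat -> T),
    [/\ S p /\ u 0%N = p,
        forall i, (i <= n)%N -> f (u i) (u i.+1),
        forall i, (0 < i <= n)%N -> ~ S (u i),
        S q & u n.+1 = q].

Section Embedding.
Variables (X Y : topologicalType).

Definition embedding_on (A : set X) (f : X -> Y) : Prop :=
  [/\ set_inj A f,
      {within A, continuous f} &
      forall U : set X, open U ->
        exists2 V : set Y, open V & A `&` U = A `&` f @^-1` V].

Definition local_embedding_on (A : set X) (f : X -> Y) : Prop :=
  forall p, A p -> exists2 U : set X, nbhs p U & embedding_on (A `&` U) f.

(* Injective, continuous, and an embedding near each point. A homeomorphism
   onto the image for the induced topology cannot be asked for in general: an
   injectively immersed line of irrational slope in a torus is dense. *)
Definition injective_embedding_on (A : set X) (f : X -> Y) : Prop :=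
  [/\ set_inj A f, {within A, continuous f} & local_embedding_on A f].

End Embedding.

Section Polytopes.
Variables (R : realType) (n : nat).

Definition convex_hull (A : set 'rV[R]_n) : set 'rV[R]_n :=
  smallest (@convex_set R 'rV[R]_n) A.

Definition polytope (P : set 'rV[R]_n) : Prop :=
  (exists2 V : set 'rV[R]_n, finite_set V & P = convex_hull V)
  /\ P° !=set0.

Definition vertex (P : set 'rV[R]_n) (v : 'rV[R]_n) : Prop :=
  P v /\ forall (x y : 'rV[R]_n) (t : R), P x -> P y -> 0 < t < 1 ->
    v = t *: x + (1 - t) *: y -> x = v /\ y = v.

End Polytopes.

Section Golden.
Variable R : realType.

Definition phi : R := (1 + Num.sqrt 5) / 2.

Definition golden (x : R) : Prop :=
  exists m k : int, x = m%:~R + k%:~R * phi.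

Definition golden_vector (n : nat) (v : 'rV[R]_n) : Prop :=
  forall j, golden (v 0 j).

(* To be applied to a lift of a polytope of the torus R^n/(2Z)^n. The lifts of
   a polytope differ by vectors of (2Z)^n, which is contained in Z[phi]^n, so
   the choice of the lift does not matter. *)
Definition golden_polytope (n : nat) (P : set 'rV[R]_n) : Prop :=
  forall v, vertex P v -> golden_vector v.

End Golden.

Section Torus.
Variables (R : realType) (n : nat).

Definition congr2 (u v : 'rV[R]_n) : bool :=
  `[< exists k : 'rV[int]_n, v = u + 2 *: map_mx intr k >].

Lemma congr2_refl : reflexive congr2.
Proof.
move=> u; apply/asboolP; exists 0.
by rewrite map_mx0 scaler0 addr0.
Qed.

Lemma congr2_sym : symmetric congr2.
Proof.
move=> u v; apply/idP/idP => /asboolP[k ->]; apply/asboolP; exists (- k);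
  by rewrite map_mxN scalerN addrK.
Qed.

Lemma congr2_trans : transitive congr2.
Proof.
move=> v u w /asboolP[k ->] /asboolP[l ->]; apply/asboolP; exists (k + l).
by rewrite map_mxD scalerDr addrA.
Qed.

Definition congr2_equiv := EquivRel congr2 congr2_refl congr2_sym congr2_trans.

(* The flat torus R^n/(2Z)^n with its quotient topology. *)
Definition torus := {eq_quot congr2_equiv}.

HB.instance Definition _ := Topological.copy torus (quotient_topology torus).
HB.instance Definition _ := Quotient.on torus.

Definition torus_pi (u : 'rV[R]_n) : torus := \pi_torus u.

End Torus.

Arguments torus_pi {R n} u.

Section Exchange.
Variables (R : realType) (n : nat).

(* A partition of the torus into convex polytopes, given by a lift X i of each
   of them: the polytope torus_pi @` X i has interior torus_pi @` (X i)°. *)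
Definition polytope_partition (k : nat) (X : 'I_k -> set 'rV[R]_n) : Prop :=
  [/\ forall i, polytope (X i),
      forall i, set_inj (X i)° torus_pi,
      forall i j, i != j ->
        torus_pi @` (X i)° `&` torus_pi @` X j = set0 &
      \bigcup_i (torus_pi @` X i) = [set: torus R n]].

(* The i-th polytope of the first partition X1 is translated by t i onto the
   i-th polytope of the second partition X2 (the lifts being chosen
   accordingly), and f is defined exactly on the interiors of the polytopes of
   X1; it is then a bijection onto the union of the interiors of the polytopes
   of X2. *)
Definition polytope_exchange (f : pfun_graph (torus R n) (torus R n))
    (k : nat) (X1 X2 : 'I_k -> set 'rV[R]_n) (t : 'I_k -> 'rV[R]_n) : Prop :=
  [/\ polytope_partition X1,
      polytope_partition X2,
      forall i, X2 i = [set u + t i | u in X1 i] &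
      forall p q, f p q <->
        exists i, exists2 u, (X1 i)° u & p = torus_pi u /\ q = torus_pi (u + t i)].

Definition golden_polytope_exchange (f : pfun_graph (torus R n) (torus R n)) : Prop :=
  exists (k : nat) (X1 X2 : 'I_k -> set 'rV[R]_n) (t : 'I_k -> 'rV[R]_n),
    polytope_exchange f X1 X2 t /\
    forall i, [/\ golden_polytope (X1 i), golden_polytope (X2 i)
                & golden_vector (t i)].

End Exchange.

Section Fibered.
Variable R : realType.

Definition vec2 (x y : R) : 'rV[R]_2 := \row_j [:: x; y]`_j.
Definition vec3 (x y z : R) : 'rV[R]_3 := \row_j [:: x; y; z]`_j.

(* The identification of R^2/(2Z)^2 with the horizontal 2-torus of height h. *)
Definition at_height (h : R) (p : torus R 2) : torus R 3 :=
  torus_pi (vec3 (repr p 0 0) (repr p 0 1) h).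

Definition horizontal_torus (h : R) : set (torus R 3) := range (at_height h).

Definition restrict_to_height (f : pfun_graph (torus R 3) (torus R 3)) (h : R) :
    pfun_graph (torus R 2) (torus R 2) :=
  fun p q => f (at_height h p) (at_height h q).

Definition fibered (f : pfun_graph (torus R 3) (torus R 3)) : Prop :=
  (forall h p q, f p q -> horizontal_torus h p -> horizontal_torus h q) /\
  (forall h, golden h -> golden_polytope_exchange (restrict_to_height f h)).

End Fibered.

Section PenroseKite.
Variable R : realType.
Local Notation plane := 'rV[R]_2.
Local Notation phi := (phi R).

Definition kite_vertices : set plane :=
  [set vec2 (-1) 0; vec2 0 1; vec2 0 (-1); vec2 (phi ^- 3) 0].

Definition kite : set plane := convex_hull kite_vertices.

(* k lies on the line x0x1 or to the right of the ray from x0 through x1. *)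
Definition on_right (x0 x1 k : plane) : Prop :=
  (x1 0 0 - x0 0 0) * (k 0 1 - x0 0 1)
    - (x1 0 1 - x0 0 1) * (k 0 0 - x0 0 0) <= 0.

Definition tangent_at (x0 v : plane) : Prop :=
  kite_vertices v /\ forall k, kite k -> on_right x0 (2 *: v - x0) k.

Definition outer_billiards : pfun_graph plane plane := fun x0 x1 =>
  ~ kite x0 /\ exists2 v, unique (tangent_at x0) v & x1 = 2 *: v - x0.

Definition psi : pfun_graph plane plane :=
  pfun_comp outer_billiards outer_billiards.

Definition strip : set plane := [set p | -2 < p 0 1 <= 2].

Definition triangles : set plane :=
  strip `&`
  (convex_hull [set vec2 0 1; vec2 (- phi ^- 3) 2; vec2 1 2] `|`
   convex_hull [set vec2 0 (-1); vec2 (- phi ^- 3) (-2); vec2 1 (-2)]).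

(* The left and right components of the strip minus K and B, each picked out
   by one of its points. *)
Definition strip_minus : set plane :=
  connected_component (strip `\` (kite `|` triangles)) (vec2 (-2) 0).
Definition strip_plus : set plane :=
  connected_component (strip `\` (kite `|` triangles)) (vec2 2 0).

Definition Psi : pfun_graph plane plane := fun p q =>
  [\/ (kite `|` triangles) p /\ q = p,
      first_return psi strip_minus p q |
      first_return psi strip_plus p q].

Definition Theta (p : plane) : torus R 3 :=
  let x := p 0 0 in let y := p 0 1 in
  torus_pi (vec3 1 (1 / 2) 0 + vec3 (x / phi) ((x - y) / 2) y).

(* h o f = g o h wherever all maps are defined. *)
Definition semi_conjugacy (T U : Type) (A : set T) (h : T -> U)
    (f : pfun_graph T T) (g : pfun_graph U U) : Prop :=
  forall p q r, A p -> f p q -> g (h p) r -> r = h q.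

End PenroseKite.

(* Main.v *)
From Stdlib Require Import ZArith.
Require Import Defs.
From mathcomp Require Import all_boot all_order all_algebra.
From mathcomp Require Import all_classical all_reals all_analysis.
From mathcomp Require Import ring lra zify ssrZ.
Import numFieldNormedType.Exports.
Set Implicit Arguments.
Unset Strict Implicit.
Unset Printing Implicit Defensive.
Import Order.TTheory GRing.Theory Num.Theory.
Local Open Scope classical_set_scope.
Local Open Scope ring_scope.
Delimit Scope Z_scope with ZZ.

(** Write f for the golden ratio. In suitable coordinates an orbit of psi that
starts on one side of the kite is predictable up to the moment when it has gone
half way around: the points that it visits are the intermediate points of a
pinwheel. There are five vectors V1 = (0,4), V2 = (-2,2), V3 = (4 - 4f, 0),
V4 = (-2,-2), V5 = V1, all of them twice a difference of two vertices, and four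
closed strips, each bounded by the extension of a side of the kite and by a
parallel line, such that the first point of the orbit on the other side is
obtained by adding a multiple of V1 that leads into the first strip, then a
multiple of V2 that leads into the second strip, and so on, and at last a
multiple of V5 ([orbit_step], [first_return_crosses]). The second half of the orbit does the same
again, so the return map is the pinwheel applied twice. On the kite and the
triangles, where the return map is the identity, the pinwheel also fixes every
point ([Pin_identity]), and all cases of the definition of Psi get the same
description ([PsiP]).

Each strip is a fundamental domain, up to its boundary, of the translation group
generated by the vector that leads into it. A multiple of the vector is
therefore chosen by reducing one linear form modulo a period. On the torus only
that reduction is left: the lift of Theta (x, y) has the coordinates
U = x / f, V = (x - y - 1) / 2, S = (x + y - 1) / 2 modulo 2, and half a turn is
a map of the cube |U|, |V|, |S| < 1 whose translation depends on five
integers, each determined by a window in which a linear form of (U, V, S) has to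
lie ([half_turn], [strip_chain]). Two half turns make the map [Psihat] on the
torus, and the semi-conjugacy follows.

That [Psihat] is an exchange of polyhedra is now a statement about the cells
cut out by the windows. The cells are disjoint because windows of the length of
the period determine the integers; their images are disjoint because the
reflection exchanging V and S conjugates a half turn to an inverse half turn
([half_turn_rev]). The cells and their images cover a dense set of the torus,
since every point off countably many walls lies in one, and a line transversal
to the walls meets a countable set of them ([generic_dense]); only finitely many
integers occur, so the closed cells cover everything ([cell_exchange]). The
normals of the walls belong to a list of nine vectors over Z[f] whose 3 x 3
minors vanish or are units, so Cramer's rule gives vertices in Z[f]^3
([golden_closed_cell], [minors_normal3]). The translations change the height
S - V by even integers, so the horizontal tori are preserved; the 2 x 2 minors of
the horizontal parts of the normals are again zero or units, and the same
argument one dimension lower applies to the slices ([slice_exchange]).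

The finitely many planar inclusions behind [orbit_step] are decided by
Fourier--Motzkin elimination over Z[f], run inside the kernel. *)

(** * Exact arithmetic in Z[phi] *)

Section GoldenRatio.
Variable R : realType.
Local Notation phi := (phi R).

Lemma phi_sqr : phi * phi = phi + 1.
Proof.
have h5 : Num.sqrt (5 : R) * Num.sqrt 5 = 5 by rewrite -expr2 sqr_sqrtr.
rewrite /Defs.phi; lra.
Qed.

Lemma phi_bounds : 8 / 5 < phi < 13 / 8.
Proof.
have h5 : Num.sqrt (5 : R) * Num.sqrt 5 = 5 by rewrite -expr2 sqr_sqrtr.
have h0 : 0 <= Num.sqrt (5 : R) by rewrite sqrtr_ge0.
rewrite /Defs.phi; apply/andP; split; nra.
Qed.

Lemma phi_gt0 : 0 < phi.
Proof. by have /andP[h _] := phi_bounds; apply: lt_trans h; lra. Qed.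

End GoldenRatio.

(** The pair (a, b) stands for a + b phi. *)
Definition gnum : Type := Z * Z.
Definition gadd (g h : gnum) : gnum := (g.1 + h.1, g.2 + h.2)%ZZ.
Definition gopp (g : gnum) : gnum := (- g.1, - g.2)%ZZ.
Definition gmul (g h : gnum) : gnum :=
  (g.1 * h.1 + g.2 * h.2, g.1 * h.2 + g.2 * h.1 + g.2 * h.2)%ZZ.
Definition gint (n : Z) : gnum := (n, 0%ZZ).

(* The sign of a + b phi is that of p + b sqrt 5, where p = 2 a + b. *)
Definition gpos (g : gnum) : bool :=
  let p := (2 * g.1 + g.2)%ZZ in let q := g.2 in
  if (0 <=? p)%ZZ then
    if (0 <=? q)%ZZ then (0 <? p + q)%ZZ else (5 * (q * q) <? p * p)%ZZ
  else (0 <? q)%ZZ && (p * p <? 5 * (q * q))%ZZ.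

Section GoldenValue.
Variable R : realType.
Local Notation phi := (phi R).

Definition zval (n : Z) : R := (int_of_Z n)%:~R.

Lemma zvalD m n : zval (m + n)%ZZ = zval m + zval n.
Proof. by rewrite /zval (raddfD int_of_Z m n) intrD. Qed.

Lemma zvalN m : zval (- m)%ZZ = - zval m.
Proof. by rewrite /zval (raddfN int_of_Z m) intrN. Qed.

Lemma zvalM m n : zval (m * n)%ZZ = zval m * zval n.
Proof. by rewrite /zval (rmorphM int_of_Z m n) intrM. Qed.

Lemma zval_ge0 n : (0 <= n)%ZZ -> 0 <= zval n.
Proof. by move=> h; rewrite ler0z; lia. Qed.

Lemma zval_gt0 n : (0 < n)%ZZ -> 0 < zval n.
Proof. by move=> h; rewrite ltr0z; lia. Qed.

Definition gval (g : gnum) : R := zval g.1 + zval g.2 * phi.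

Lemma gvalD g h : gval (gadd g h) = gval g + gval h.
Proof. by rewrite /gval /gadd /= !zvalD mulrDl addrACA. Qed.

Lemma gvalN g : gval (gopp g) = - gval g.
Proof. by rewrite /gval /gopp /= !zvalN mulNr opprD. Qed.

Lemma gvalM g h : gval (gmul g h) = gval g * gval h.
Proof.
have key (a b c d f : R) : f * f = f + 1 ->
    a * c + b * d + (a * d + b * c + b * d) * f = (a + b * f) * (c + d * f).
  move=> e; transitivity (a * c + (a * d + b * c) * f + b * d * (f * f)); last by ring.
  by rewrite e; ring.
by rewrite -key ?phi_sqr // /gval /gmul /= !zvalD !zvalM.
Qed.

Lemma gval_int n : gval (gint n) = zval n.
Proof. by rewrite /gval /= mul0r addr0. Qed.

Lemma gval0 : gval (gint 0) = 0. Proof. exact: gval_int. Qed.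

(** Comparing squares decides the sign of p + b sqrt 5 when p and b have
opposite signs. *)
Lemma gpos_gt0 g : gpos g -> 0 < gval g.
Proof.
case: g => a b; rewrite /gpos /gval /fst /snd.
have s2 : Num.sqrt (5 : R) * Num.sqrt 5 = 5 by rewrite -expr2 sqr_sqrtr.
have s0 : 0 < Num.sqrt (5 : R) by rewrite sqrtr_gt0.
have -> : zval a + zval b * phi = (zval (2 * a + b) + zval b * Num.sqrt 5) / 2.
  by rewrite zvalD zvalM /Defs.phi (_ : zval 2 = 2) //; field.
move: (2 * a + b)%ZZ => p h; apply: divr_gt0 => //; move: h.
have sq (m n : Z) : (5 * (m * m) < n * n)%ZZ ->
    0 < zval n * zval n - 5 * (zval m * zval m).
  move=> h; have : (0 < n * n + - (5 * (m * m)))%ZZ by lia.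
  by move=> /zval_gt0; rewrite zvalD zvalN !zvalM.
move: (Num.sqrt 5) s2 s0 => s s2 s0.
case: (Z.leb_spec 0 p) => hp; first case: (Z.leb_spec 0 b) => hq.
- move=> /Z.ltb_lt h; have hP := zval_ge0 hp; have hQ := zval_ge0 hq.
  have : 0 < zval p + zval b by rewrite -zvalD zval_gt0.
  have s1 : 2 < s by nra.
  by move: (zval p) (zval b) hP hQ => P Q *; nra.
- move=> /Z.ltb_lt /sq hh.
  have hP := zval_ge0 hp; have hQ : 0 < - zval b by rewrite -zvalN zval_gt0; lia.
  move: (zval p) (zval b) hP hQ hh => P Q *.
  have : 0 < (P - (- Q) * s) * (P + (- Q) * s) by nra.
  have : 0 < P + (- Q) * s by rewrite ltr_wpDl ?mulr_gt0.
  by move=> h1 h2; move: h2; rewrite pmulr_lgt0 //; lra.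
- move=> /andP[/Z.ltb_lt hq /Z.ltb_lt hb].
  have hQ := zval_gt0 hq.
  have hP : 0 < - zval p by rewrite -zvalN zval_gt0; lia.
  have hh : 0 < 5 * (zval b * zval b) - zval p * zval p.
    have : (0 < 5 * (b * b) + - (p * p))%ZZ by lia.
    by move=> /zval_gt0; rewrite zvalD zvalN !zvalM.
  move: (zval p) (zval b) hP hQ hh => P Q *.
  have : 0 < (Q * s - (- P)) * (Q * s + (- P)) by nra.
  have : 0 < Q * s + (- P) by rewrite addr_gt0 ?mulr_gt0.
  by move=> h1 h2; move: h2; rewrite pmulr_lgt0 //; lra.
Qed.

End GoldenValue.

(** * Linear constraints in the plane *)

(** A flag that is true for a strict inequality, and the coefficients of x, of y
and of 1 of the form that is to be positive, or nonnegative. *)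
Definition con : Type := bool * (gnum * gnum * gnum).
Definition cx (k : con) : gnum := k.2.1.1.
Definition cy (k : con) : gnum := k.2.1.2.
Definition cc (k : con) : gnum := k.2.2.

Definition neg (k : con) : con :=
  (~~ k.1, (gopp (cx k), gopp (cy k), gopp (cc k))).
(** [shift] and [reflect_pt] read a constraint at the image of (x, y) under a
translation and under a point reflection, the two moves of outer billiards. *)
Definition shift (d : gnum * gnum) (k : con) : con :=
  (k.1, (cx k, cy k, gadd (cc k) (gadd (gmul (cx k) d.1) (gmul (cy k) d.2)))).
Definition reflect_pt (v : gnum * gnum) (k : con) : con :=
  (k.1, (gopp (cx k), gopp (cy k),
         gadd (cc k) (gmul (gint 2) (gadd (gmul (cx k) v.1) (gmul (cy k) v.2))))).

Definition combine (a b : gnum) (k l : con) : con :=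
  (k.1 || l.1, (gadd (gmul a (cx k)) (gmul b (cx l)),
                gadd (gmul a (cy k)) (gmul b (cy l)),
                gadd (gmul a (cc k)) (gmul b (cc l)))).
(** Fourier--Motzkin: each pair of constraints in which the variable has
opposite signs is combined so as to cancel it. *)
Definition eliminate (coef : con -> gnum) (s : seq con) : seq con :=
  [seq k <- s | coef k == gint 0] ++
  [seq combine (gopp (coef l)) (coef k) k l |
     k <- [seq k <- s | gpos (coef k)], l <- [seq l <- s | gpos (gopp (coef l))]].
Definition absurd_con (k : con) : bool :=
  [&& cx k == gint 0, cy k == gint 0 &
      gpos (gopp (cc k)) || (k.1 && (cc k == gint 0))].
Definition infeasible (s : seq con) : bool :=
  has absurd_con (eliminate cy (eliminate cx s)).
Definition implies (s : seq con) (k : con) : bool := infeasible (neg k :: s).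

Section Constraints.
Variable R : realType.
Implicit Types x y : R.

Definition lhs (k : con) x y : R := gval R (cx k) * x + gval R (cy k) * y + gval R (cc k).
Definition holds (k : con) x y : bool :=
  if k.1 then 0 < lhs k x y else 0 <= lhs k x y.
Definition sat (s : seq con) x y : bool := all (fun k => holds k x y) s.

Lemma holds_ge0 k x y : holds k x y -> 0 <= lhs k x y.
Proof. by rewrite /holds; case: k.1 => // /ltW. Qed.

Lemma lhs_combine a b k l x y :
  lhs (combine a b k l) x y = gval R a * lhs k x y + gval R b * lhs l x y.
Proof. by rewrite /lhs /combine /cx /cy /cc /= !gvalD !gvalM; ring. Qed.

Lemma holds_combine a b k l x y : 0 < gval R a -> 0 < gval R b ->
  holds k x y -> holds l x y -> holds (combine a b k l) x y.
Proof.
move=> a0 b0 hk hl; rewrite /holds lhs_combine /combine /=.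
have := holds_ge0 hk; have := holds_ge0 hl; move: hk hl; rewrite /holds.
case: k.1; case: l.1 => /= hk hl hl' hk'.
- by rewrite addr_gt0 ?mulr_gt0.
- by rewrite ltr_wpDr ?mulr_gt0 ?mulr_ge0 // ltW.
- by rewrite ltr_wpDl ?mulr_gt0 ?mulr_ge0 // ltW.
- by rewrite addr_ge0 ?mulr_ge0 // ltW.
Qed.

Lemma sat_eliminate coef s x y : sat s x y -> sat (eliminate coef s) x y.
Proof.
move=> /allP hs; rewrite /sat /eliminate all_cat; apply/andP; split; apply/allP => k.
  by rewrite mem_filter => /andP[_ /hs].
move=> /allpairsP[[k1 k2] /= []]; rewrite !mem_filter => /andP[p1 s1] /andP[p2 s2] ->.
by apply: holds_combine; [exact: gpos_gt0 | exact: gpos_gt0 | exact: hs | exact: hs].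
Qed.

(** Fourier--Motzkin elimination only adds consequences, so an absurd constant
constraint among them refutes the system. *)
Lemma infeasibleP s x y : infeasible s -> sat s x y -> False.
Proof.
move=> /hasP[k kin /and3P[/eqP k1 /eqP k2 k3]] hs.
have /allP/(_ k kin) := sat_eliminate cy (sat_eliminate cx hs).
rewrite /holds /lhs k1 k2 !gval0 !mul0r !add0r.
case/orP: k3 => [/(@gpos_gt0 R)|/andP[-> /eqP ->]]; last by rewrite gval0 ltxx.
rewrite gvalN oppr_gt0 => h; case: ifP => _ h'.
  by have := lt_trans h h'; rewrite ltxx.
by have := le_lt_trans h' h; rewrite ltxx.
Qed.

Lemma holds_neg k x y : holds (neg k) x y = ~~ holds k x y.
Proof.
rewrite /holds /neg /= /lhs /cx /cy /cc /= !gvalN !mulNr -!opprD.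
by case: k.1 => /=; rewrite ?oppr_ge0 ?oppr_gt0 -?leNgt -?ltNge.
Qed.

Lemma impliesP s k x y : implies s k -> sat s x y -> holds k x y.
Proof.
move=> h hs; apply: contraT => nk; exfalso.
by apply: (infeasibleP (x := x) (y := y) h); rewrite /sat /= holds_neg nk.
Qed.

Lemma holds_shift d k x y :
  holds (shift d k) x y = holds k (x + gval R d.1) (y + gval R d.2).
Proof.
have e : lhs (shift d k) x y = lhs k (x + gval R d.1) (y + gval R d.2).
  by rewrite /lhs /shift /cx /cy /cc /= !gvalD !gvalM; ring.
by rewrite /holds e.
Qed.

Lemma sat_shift d s x y :
  sat (map (shift d) s) x y = sat s (x + gval R d.1) (y + gval R d.2).
Proof. by rewrite /sat all_map; apply: eq_all => k /=; rewrite holds_shift. Qed.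

Lemma holds_reflect v k x y :
  holds (reflect_pt v k) x y = holds k (2 * gval R v.1 - x) (2 * gval R v.2 - y).
Proof.
have e : lhs (reflect_pt v k) x y = lhs k (2 * gval R v.1 - x) (2 * gval R v.2 - y).
  rewrite /lhs /reflect_pt /cx /cy /cc /= !(gvalD, gvalM, gvalN) gval_int.
  by rewrite (_ : zval R 2 = 2) //; ring.
by rewrite /holds e.
Qed.

Lemma sat_reflect v s x y :
  sat (map (reflect_pt v) s) x y = sat s (2 * gval R v.1 - x) (2 * gval R v.2 - y).
Proof. by rewrite /sat all_map; apply: eq_all => k /=; rewrite holds_reflect. Qed.

Lemma sat_cat s1 s2 x y : sat (s1 ++ s2) x y = sat s1 x y && sat s2 x y.
Proof. exact: all_cat. Qed.

End Constraints.

(** * The combinatorics of half a turn *)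

Definition gpt : Type := gnum * gnum.
Definition ptadd (p q : gpt) : gpt := (gadd p.1 q.1, gadd p.2 q.2).
Definition ptscale (n : Z) (p : gpt) : gpt := (gmul (gint n) p.1, gmul (gint n) p.2).

(** The vertices of the kite, named after the points of the compass. *)
Inductive vert := W | N | E | S.
Definition verts := [:: W; N; E; S].
Lemma all_verts (f : vert -> bool) v : all f verts -> f v.
Proof. by case: v => /and5P[]. Qed.
Definition pos (v : vert) : gpt :=
  match v with
  | W => (gint (-1), gint 0) | N => (gint 0, gint 1)
  | E => ((-3, 2)%ZZ, gint 0) | S => (gint 0, gint (-1))
  end.

Definition ge (l : gnum * gnum * gnum) : con := (false, l).
Definition gt (l : gnum * gnum * gnum) : con := (true, l).
Definition opl (l : gnum * gnum * gnum) := (gopp l.1.1, gopp l.1.2, gopp l.2).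

(** Each form vanishes on the side that joins the two vertices of its name. *)
Definition lineSW := (gint 1, gint 1, gint 1).
Definition lineWN := (gint 1, gint (-1), gint 1).
Definition lineES : gnum * gnum * gnum := ((1, 2)%ZZ, gint (-1), gint (-1)).
Definition lineNE : gnum * gnum * gnum := ((1, 2)%ZZ, gint 1, gint (-1)).
Definition yplus (c : Z) := (gint 0, gint 1, gint c).
Definition yminus (c : Z) := (gint 0, gint (-1), gint c).

(** The outer billiards map reflects in the vertex v exactly on this cone, which
is bounded by extensions of the two sides at v. *)
Definition cone (v : vert) : seq con :=
  match v with
  | W => [:: gt (opl lineSW); gt lineWN]
  | N => [:: gt (opl lineWN); gt (opl lineNE)]
  | E => [:: gt lineNE; gt (opl lineES)]
  | S => [:: gt lineES; gt lineSW]
  end.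
Definition jump (X Y : vert) : gpt := ptscale 2 (ptadd (pos Y) (ptscale (-1) (pos X))).
Definition dom (X Y : vert) : seq con := cone X ++ map (reflect_pt (pos X)) (cone Y).

Definition kite_cons : seq con :=
  [:: ge lineSW; ge lineWN; ge (opl lineES); ge (opl lineNE)].
Definition tri_up : seq con := [:: ge (yminus 2); ge (opl lineWN); ge lineNE].
Definition tri_low : seq con := [:: gt (yplus 2); ge (opl lineSW); ge lineES].
(** The two sides of the strip, and the places outside the strip or in the
triangles that an orbit visits on its way. Each is a union of convex pieces. *)
Definition right_cons : seq (seq con) :=
  [:: [:: ge (yplus 0); ge (yminus 2); gt lineWN; gt lineNE];
      [:: gt (yplus 2); gt (yminus 0); gt lineSW; gt lineES]].
Definition left_cons : seq (seq con) :=
  [:: [:: ge (yplus 0); ge (yminus 2); gt (opl lineWN); gt (opl lineNE)];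
      [:: gt (yplus 2); gt (yminus 0); gt (opl lineSW); gt (opl lineES)]].
Definition above_cons : seq (seq con) := [:: [:: gt (yplus (-2))]; tri_up].
Definition below_cons : seq (seq con) := [:: [:: ge (yminus (-2))]; tri_low].

(** The vectors of the pinwheel, numbered from 1. *)
Definition trans (j : nat) : gpt :=
  nth (gint 0, gint 4)
   [:: (gint 0, gint 0); (gint 0, gint 4); (gint (-2), gint 2); ((4, -4)%ZZ, gint 0);
       (gint (-2), gint (-2)); (gint 0, gint 4)] j.
(** The strip that the j-th multiple leads into, for j = 1, .., 4. Its translates by
multiples of the j-th vector tile the plane. *)
Definition strip_cons (j : nat) : seq con :=
  nth [::] [:: [::];
    [:: ge (gint (-1), gint 1, gint 3); ge (gint 1, gint (-1), gint 1)];
    [:: ge ((1, 2)%ZZ, gint (-1), (3, 4)%ZZ); ge (opl lineES)];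
    [:: ge ((1, 2)%ZZ, gint 1, (3, 4)%ZZ); ge (opl lineNE)];
    [:: ge (gint 1, gint 1, gint 1); ge (gint (-1), gint (-1), gint 3)]] j.

(** While an orbit makes half a turn, its steps X Y follow the directions of the
successive pinwheel vectors. The phase is that of the pinwheel when the next step
is X Y; [up] tells the half turn above the kite, which leads from the right to the
left, from the one below. *)
Definition phase (up : bool) (X Y : vert) : nat :=
  if up then
    match X, Y with S, N => 1 | S, W => 2 | E, W => 3 | E, S => 3 | N, W => 4 | N, S => 5 | _, _ => 0 end
  else
    match X, Y with N, S => 1 | W, S => 2 | W, E => 3 | N, E => 1 | W, N => 4 | S, N => 5 | _, _ => 0 end.
(** The step X Y as a combination of the pinwheel vectors; most steps are a single
vector up to sign. *)
Definition moves (X Y : vert) : seq Z :=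
  (match X, Y with
  | S, N => [:: 1; 0; 0; 0; 1] | N, S => [:: -1; 0; 0; 0; -1]
  | S, W => [:: 0; 1; 0; 0; 0] | W, S => [:: 0; -1; 0; 0; 0]
  | E, W => [:: 0; 0; 1; 0; 0] | W, E => [:: 0; 0; -1; 0; 0]
  | N, W => [:: 0; 0; 0; 1; 0] | W, N => [:: 0; 0; 0; -1; 0]
  | E, S => [:: 0; 0; 1; -1; -1] | N, E => [:: -1; 1; -1; 0; 0]
  | _, _ => [::]
  end)%ZZ.

(** Checks, under the hypothesis hyp on a point z, that a pinwheel which is in
phase j at z + d can run on for n phases with the multiples mv and end at
z + tot. *)
Fixpoint route (hyp : seq con) (mv : seq Z) (tot : gpt) (j n : nat) (d : gpt) : bool :=
  let d' := ptadd d (ptscale (nth 0%ZZ mv j.-1) (trans j)) in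
  if n is n'.+1 then
    all (implies hyp) (map (shift d') (strip_cons j)) && route hyp mv tot j.+1 n' d'
  else d' == tot.

Definition route_ok hyp mv tot j j' :=
  [&& (0 < j)%N, (j <= j')%N & route hyp mv tot j (j' - j) (gint 0, gint 0)].

(** Every step from a source region, or from a point in the course of a half turn,
ends either on the opposite side, with the pinwheel able to complete its five
phases there, or again in the course of the same half turn, with the pinwheel
able to reach the phase of the step after. Empty cases are recognized as
infeasible. *)
Definition check_step (up : bool) (X Y : vert) : bool :=
  let sgm := if up then left_cons else right_cons in
  let sgp := if up then right_cons else left_cons in
  let good := if up then above_cons else below_cons in
  let bad := sgp ++ (if up then below_cons else above_cons) in
  let sh := map (shift (jump X Y)) in
  all (fun sj : seq con * nat =>
    let hyp := sj.1 ++ dom X Y in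
    if infeasible hyp then true else
    [&& all (fun t => infeasible (hyp ++ sh t)) bad,
        all (fun t => let h := hyp ++ sh t in if infeasible h then true else route_ok h (moves X Y) (jump X Y) sj.2 5) sgm &
        all (fun t => let h := hyp ++ sh t in if infeasible h then true else
           all (fun X' => all (fun Y' =>
             let h' := sh (dom X' Y') ++ h in if infeasible h' then true else
             route_ok h' (moves X Y) (jump X Y) sj.2 (phase up X' Y')) verts) verts) good])
   ([seq (s, 1%N) | s <- sgp] ++ [seq (s, phase up X Y) | s <- good]).

Lemma check_steps : all (fun up => all (fun X => all (check_step up X) verts) verts) [:: true; false].
Proof. by vm_cast_no_check (erefl true). Qed.

(** Case distinction on the signs of the tests, until one region is seen to
contain the case at hand. *)
Fixpoint covered (regions : seq (seq con)) (tests hyp : seq con) : bool :=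
  if infeasible hyp then true else
  if tests is k :: tests' then
    if covered regions tests' (k :: hyp) then covered regions tests' (neg k :: hyp) else false
  else has (fun r => all (implies hyp) r) regions.

Definition tests : seq con :=
  [:: ge (yplus 0); ge (yminus 2); gt (yplus 2)] ++
  flatten [seq [:: gt l; ge l] | l <- [:: lineSW; lineWN; lineES; lineNE]].

Lemma plane_covered :
  covered (kite_cons :: right_cons ++ left_cons ++ above_cons ++ below_cons) tests [::].
Proof. by vm_cast_no_check (erefl true). Qed.

Arguments jump : simpl never.

Section Orbits.
Variable R : realType.
Implicit Types x y p q : R.

Definition sat_any (r : seq (seq con)) x y : bool := has (fun s => sat s x y) r.

Lemma coveredP r t hyp x y : covered r t hyp -> sat hyp x y -> sat_any r x y.
Proof.
elim: t hyp => [|k t IH] hyp /=; case: ifP => [h _ hs|_]; try by case: (infeasibleP h hs).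
  move=> /hasP[s sin /allP hs] hh; apply/hasP; exists s => //; apply/allP => k /hs.
  by move=> h; exact: impliesP h hh.
case: ifP => // h1 h2 hs; case: (boolP (holds k x y)) => hk.
  by apply: (IH _ h1); rewrite /sat /= hk.
by apply: (IH _ h2); rewrite /sat /= holds_neg hk.
Qed.

Lemma classify x y : ~~ sat kite_cons x y ->
  [|| sat_any right_cons x y, sat_any left_cons x y, sat_any above_cons x y | sat_any below_cons x y].
Proof.
move=> nk; have := coveredP (x := x) (y := y) plane_covered isT.
by rewrite /sat_any -[_ :: _]cat1s !has_cat has_seq1 (negbTE nk).
Qed.

(** [Pin j p q x y]: a pinwheel started at (p, q) can be at (x, y) in phase j, when
the multiple of the j-th vector has been added and the j-th strip has not been
tested yet. The strips are closed, so a multiple may be ambiguous, but only at the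
boundary of its strip. *)
Fixpoint Pin (j : nat) p q x y : Prop :=
  if j is i.+1 then
    exists x1 y1 (n : Z), [/\ Pin i p q x1 y1, sat (strip_cons i) x1 y1,
      x = x1 + zval R n * gval R (trans j).1 & y = y1 + zval R n * gval R (trans j).2]
  else x = p /\ y = q.

Lemma Pin_move j p q x y n : (0 < j)%N -> Pin j p q x y ->
  Pin j p q (x + zval R n * gval R (trans j).1) (y + zval R n * gval R (trans j).2).
Proof.
case: j => // j _ [x1 [y1 [m [h1 h2 -> ->]]]]; exists x1, y1, (m + n)%ZZ; split => //;
  by rewrite zvalD mulrDl addrA.
Qed.

Lemma Pin_next j p q x y : Pin j p q x y -> sat (strip_cons j) x y -> Pin j.+1 p q x y.
Proof.
by move=> h1 h2; exists x, y, 0%ZZ; split => //; rewrite (_ : zval R 0 = 0) // mul0r addr0.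
Qed.

Lemma Pin_route hyp mv tot j n d p q x y :
  route hyp mv tot j n d -> sat hyp x y -> (0 < j)%N ->
  Pin j p q (x + gval R d.1) (y + gval R d.2) ->
  Pin (j + n) p q (x + gval R tot.1) (y + gval R tot.2).
Proof.
have mvP i e : (0 < i)%N -> let e' := ptadd e (ptscale (nth 0%ZZ mv i.-1) (trans i)) in
    Pin i p q (x + gval R e.1) (y + gval R e.2) ->
    Pin i p q (x + gval R e'.1) (y + gval R e'.2).
  move=> i0 e' /(Pin_move (nth 0%ZZ mv i.-1) i0).
  by rewrite /e' /ptadd !gvalD !gvalM !gval_int !addrA.
elim: n j d => [|n IH] j d; first by move=> /eqP <- _ j0 /mvP; rewrite addn0; apply.
move=> /andP[/allP hr1 hr2] hs j0 hp; rewrite addnS -addSn; apply: (IH _ _ hr2 hs) => //.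
apply: Pin_next; first exact: mvP.
by rewrite -sat_shift; apply/allP => k /hr1 hk; exact: impliesP hk hs.
Qed.

Lemma Pin_route_ok hyp mv tot j j' p q x y : route_ok hyp mv tot j j' -> sat hyp x y ->
  Pin j p q x y -> Pin j' p q (x + gval R tot.1) (y + gval R tot.2).
Proof.
move=> /and3P[j0 jj' hr] hs hp; rewrite -(subnKC jj').
by apply: Pin_route hr hs j0 _; rewrite /= gval0 !addr0.
Qed.

Lemma Pin_start p q : Pin 1 p q p q.
Proof.
by exists p, q, 0%ZZ; split=> //; rewrite (_ : zval R 0 = 0) // mul0r addr0.
Qed.

(** The invariant of an orbit in the course of half a turn. It quantifies over all
steps because the phase reached depends on the step that comes next. *)
Definition enroute (up : bool) p q x y : Prop :=
  sat_any (if up then above_cons else below_cons) x y /\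
  forall X Y, sat (dom X Y) x y -> Pin (phase up X Y) p q x y.

(** One step preserves the invariant of the half turn or completes it. The proof
only interprets the finite check [check_steps]. *)
Lemma orbit_step up X Y p q x y (x' := x + gval R (jump X Y).1) (y' := y + gval R (jump X Y).2) :
  (sat_any (if up then right_cons else left_cons) x y /\ Pin 1 p q x y) \/
    enroute up p q x y ->
  sat (dom X Y) x y -> ~~ sat kite_cons x' y' ->
  (sat_any (if up then left_cons else right_cons) x' y' /\ Pin 5 p q x' y') \/
    enroute up p q x' y'.
Proof.
move=> src hd nk.
have [sj sjin [ss sp]] : exists2 sj : seq con * nat,
    sj \in [seq (s, 1%N) | s <- if up then right_cons else left_cons] ++
           [seq (s, phase up X Y) | s <- if up then above_cons else below_cons] &
    sat sj.1 x y /\ Pin sj.2 p q x y.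
  case: src => [[/hasP[s sin ss] h]|[/hasP[s sin ss] h]].
    by exists (s, 1%N); rewrite ?mem_cat ?(map_f (fun s => (s, 1%N))).
  exists (s, phase up X Y); last by split => //; exact: h.
  by rewrite mem_cat (map_f (fun s => (s, phase up X Y))) ?orbT.
have : check_step up X Y.
  have /and3P[h1 h2 _] := check_steps.
  have h : all (fun X => all (check_step up X) verts) verts by case: (up).
  exact: all_verts (all_verts X h).
move=> /allP/(_ sj sjin); case: sj {sjin} ss sp => s j; rewrite /fst /snd => ss sp.
have hs : sat (s ++ dom X Y) x y by rewrite sat_cat ss.
case: ifP => [h|_]; first by case: (infeasibleP h hs).
have shE t : sat (map (shift (jump X Y)) t) x y = sat t x' y' by exact: sat_shift.
have go hyp j' : sat hyp x y -> route_ok hyp (moves X Y) (jump X Y) j j' -> Pin j' p q x' y'.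
  by move=> hh hr; exact: Pin_route_ok hr hh sp.
move=> /and3P[/allP hbad /allP hsig /allP hgood].
have nbad t : t \in (if up then right_cons else left_cons) ++
    (if up then below_cons else above_cons) -> ~~ sat t x' y'.
  move=> /hbad h; apply/negP => st; apply: (infeasibleP (x := x) (y := y) h).
  by rewrite sat_cat hs shE.
have sig : sat_any (if up then left_cons else right_cons) x' y' -> Pin 5 p q x' y'.
  move=> /hasP[t tin st]; have hh : sat ((s ++ dom X Y) ++ map (shift (jump X Y)) t) x y.
    by rewrite sat_cat hs shE.
  have := hsig t tin; case: ifP => [h|_]; first by case: (infeasibleP h hh).
  exact: go.
have gd : sat_any (if up then above_cons else below_cons) x' y' -> enroute up p q x' y'.
  move=> hg; split=> // X' Y' hd'; case/hasP: hg => t tin st.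
  have hh : sat ((s ++ dom X Y) ++ map (shift (jump X Y)) t) x y by rewrite sat_cat hs shE.
  have := hgood t tin; case: ifP => [h|_]; first by case: (infeasibleP h hh).
  move=> hv; have h1 := all_verts X' hv; cbv beta in h1.
  have h2 := all_verts Y' h1; cbv beta zeta in h2; move: h2 => {hv h1}.
  have hh' : sat (map (shift (jump X Y)) (dom X' Y') ++
      ((s ++ dom X Y) ++ map (shift (jump X Y)) t)) x y by rewrite sat_cat shE hd' hh.
  by case: ifP => [h|_]; [case: (infeasibleP h hh') | exact: go].
have nb1 : ~~ sat_any (if up then right_cons else left_cons) x' y'.
  by apply/hasPn => t tin; apply: nbad; rewrite mem_cat tin.
have nb2 : ~~ sat_any (if up then below_cons else above_cons) x' y'.
  by apply/hasPn => t tin; apply: nbad; rewrite mem_cat tin orbT.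
clear src hbad hsig hgood nbad go.
case/or4P: (classify nk) => h; case: up nb1 nb2 sig gd => nb1 nb2 sig gd.
all: first [by rewrite h in nb1 | by rewrite h in nb2 | by right; exact: gd |
  by left; split => //; exact: sig].
Qed.

Lemma identity_routes : [&& route_ok kite_cons [::] (gint 0, gint 0) 1 5,
  route_ok tri_up [:: -1; 1; 0; -1; 0]%ZZ (gint 0, gint 0) 1 5 &
  route_ok tri_low [:: 0; 1; 0; -1; -1]%ZZ (gint 0, gint 0) 1 5].
Proof. by vm_cast_no_check (erefl true). Qed.

(** The kite lies in all four strips. From the upper triangle the pinwheel makes the
closed circuit - V1 + V2 - V4 = 0, from the lower one V2 - V4 - V5 = 0. *)
Lemma Pin_identity x y : [|| sat kite_cons x y, sat tri_up x y | sat tri_low x y] -> Pin 5 x y x y.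
Proof.
have /and3P[r1 r2 r3] := identity_routes; have h0 := Pin_start x y.
rewrite -[x in X in _ -> X]addr0 -[y in X in _ -> X]addr0 -!gval0.
by case/or3P=> h; [move: (Pin_route_ok r1 h h0)|move: (Pin_route_ok r2 h h0)|move: (Pin_route_ok r3 h h0)];
  rewrite /= gval0 !addr0.
Qed.

End Orbits.

(** * Polyhedra given by affine forms *)

Section Polyhedra.
Variables (R : realType) (n : nat).
Local Notation V := 'rV[R]_n.
Implicit Types (x y d : V) (t : R).

Lemma convex_setP (A : set V) : @convex_set R V A <->
  forall x y t, A x -> A y -> 0 <= t <= 1 -> A (t *: x + (1 - t) *: y).
Proof.
split=> [cA x y t xA yA /andP[t0 t1]|cA x y t].
  have := cA x y (Itv01 t0 t1); rewrite !inE /=; exact.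
rewrite !inE => xA yA; apply: cA => //.
by rewrite ge0 le1.
Qed.

Lemma convex_hull_convex (A : set V) x y t :
  convex_hull A x -> convex_hull A y -> 0 <= t <= 1 ->
  convex_hull A (t *: x + (1 - t) *: y).
Proof.
by move=> hx hy ht B [cB AB]; apply: (convex_setP _).1 => //; [exact: hx|exact: hy].
Qed.

Lemma sub_convex_hull (A : set V) : A `<=` convex_hull A.
Proof. exact: sub_gen_smallest. Qed.

Lemma convex_hull_sub (A B : set V) :
  (forall x y t, B x -> B y -> 0 <= t <= 1 -> B (t *: x + (1 - t) *: y)) ->
  A `<=` B -> convex_hull A `<=` B.
Proof. by move=> /(convex_setP B).2 cB; exact: smallest_sub. Qed.

Definition form : Type := 'cV[R]_n * R.
Definition slope (l : form) d : R := (d *m l.1) 0 0.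
Definition aff (l : form) x : R := slope l x + l.2.

Lemma slopeD l x y : slope l (x + y) = slope l x + slope l y.
Proof. by rewrite /slope mulmxDl mxE. Qed.
Lemma slopeZ l t x : slope l (t *: x) = t * slope l x.
Proof. by rewrite /slope -scalemxAl mxE. Qed.
Lemma affD l x d : aff l (x + d) = aff l x + slope l d.
Proof. by rewrite /aff slopeD addrAC. Qed.
Lemma aff_conv l x y t : aff l (t *: x + (1 - t) *: y) = t * aff l x + (1 - t) * aff l y.
Proof. by rewrite /aff slopeD !slopeZ; ring. Qed.

Lemma slope_tr l : l.1 != 0 -> slope l l.1^T != 0.
Proof.
move=> l0; rewrite /slope mxE; apply: contraNneq l0 => h.
apply/eqP/matrixP => i j; rewrite (ord1 j) [RHS]mxE.
have /psumr_eq0P : \sum_k l.1^T 0 k * l.1 k 0 = 0 by exact: h.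
move=> /(_ (fun k _ => _)) hh.
have := hh (ltac:(by move=> k; rewrite mxE -expr2 sqr_ge0)) i isT.
by rewrite mxE => /eqP; rewrite mulf_eq0 orbb => /eqP.
Qed.

Lemma aff_continuous l : continuous (aff l).
Proof.
have -> : aff l = fun x => (\sum_k x 0 k * l.1 k 0) + l.2.
  by apply/funext => x; rewrite /aff /slope mxE.
have cs : continuous (fun x : V => \sum_k x 0 k * l.1 k 0).
  apply: continuous_big => [|k _]; first exact: add_continuous.
  by move=> y; apply: (cvgM (@coord_continuous R 1 n 0 k y)); exact: cvg_cst.
by move=> x; apply: (cvgD (cs x)); exact: cvg_cst.
Qed.

Section Polyhedron.
Variables (J : finType) (L : J -> form).

Definition closed_cell : set V := [set x | forall j, 0 <= aff (L j) x].
Definition open_cell : set V := [set x | forall j, 0 < aff (L j) x].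

Lemma open_closed_cell : open_cell `<=` closed_cell.
Proof. by move=> x h j; exact: ltW. Qed.

Lemma closed_closed_cell : closed closed_cell.
Proof.
rewrite (_ : closed_cell = \bigcap_j (aff (L j) @^-1` [set r | 0 <= r])).
  apply: closed_bigI => j _; apply: preimage_closed; last exact: closed_ge.
  by move=> x _; exact: aff_continuous.
by apply/seteqP; split => x h j; [move=> _; exact: h | exact: h].
Qed.

Lemma open_open_cell : open open_cell.
Proof.
rewrite openE => x hx.
suff : forall j, nbhs x (aff (L j) @^-1` [set r | 0 < r]).
  exact: (@filter_forall V J (fun j y => 0 < aff (L j) y) (nbhs x) _).
by move=> j; apply: (aff_continuous (l := L j) (x := x)); exact: lt_nbhsr.
Qed.

(** At a point where a form vanishes, an arbitrarily small move against its
normal leaves the cell. *)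
Lemma interior_closed_cell : (forall j, (L j).1 != 0) -> closed_cell° = open_cell.
Proof.
move=> nz; apply/seteqP; split; last first.
  by rewrite -(open_subsetE _ open_open_cell); exact: open_closed_cell.
move=> x hx j; have hj : 0 <= aff (L j) x by exact: (interior_subset hx).
rewrite lt_neqAle hj andbT eq_sym; apply/negP => /eqP h0.
pose d : V := - slope (L j) (L j).1^T *: (L j).1^T.
have : \forall t \near 0^'+, closed_cell (x + t *: d).
  have ct : (fun t : R => x + t *: d) @ 0^'+ --> x.
    rewrite -[X in _ --> X]addr0 -(scale0r d); apply: cvg_at_right_filter.
    by apply: cvgD; [exact: cvg_cst | apply: cvgZr_tmp; exact: cvg_id].
  exact: (ct _ hx).
move=> near_t; near (0 : R)^'+ => t.
have ht : 0 < t by near: t; exact: nbhs_right_gt.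
have /(_ j) : closed_cell (x + t *: d) by near: t.
rewrite affD h0 add0r slopeZ slopeZ mulNr mulrN oppr_ge0 pmulr_rle0 // leNgt.
by rewrite -expr2 exprn_even_gt0 //= slope_tr.
Unshelve. all: by end_near. Qed.

End Polyhedron.
End Polyhedra.

Section Minkowski.
Variables (R : realType) (n : nat) (J : finType) (L : J -> form R n).
Local Notation V := 'rV[R]_n.
Implicit Types (x y d : V).
Local Notation P := (closed_cell L).

Definition active x : {set J} := [set j | aff (L j) x == 0].

Definition active_mx (A : {set J}) : 'M[R]_(n, #|J|) :=
  \matrix_(i, k) if enum_val k \in A then (L (enum_val k)).1 i 0 else 0.

Lemma mul_active_mx A d k :
  (d *m active_mx A) 0 k = if enum_val k \in A then slope (L (enum_val k)) d else 0.
Proof.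
rewrite mxE /slope mxE; case: ifP => h.
  by apply: eq_bigr => i _; rewrite mxE h.
by apply: big1 => i _; rewrite mxE h mulr0.
Qed.

Lemma active_mx_ker A d :
  d *m active_mx A = 0 <-> forall j, j \in A -> slope (L j) d = 0.
Proof.
split=> [h j jA|h].
  have := mul_active_mx A d (enum_rank j); rewrite h mxE enum_rankK jA => ->//.
apply/rowP => k; rewrite mul_active_mx mxE; case: ifP => // kA; exact: h.
Qed.

(** The rows that vanish on the active normals are zero: no direction keeps all
active constraints active. *)
Definition corner x := row_free (active_mx (active x)).

Lemma not_corner x : ~~ corner x ->
  exists2 d, d != 0 & forall j, j \in active x -> slope (L j) d = 0.
Proof.
rewrite /corner -kermx_eq0 => nz; exists (nz_row (kermx (active_mx (active x)))).
  by rewrite nz_row_eq0.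
by apply/active_mx_ker; apply/sub_kermxP; exact: nz_row_sub.
Qed.

Hypothesis bounded : exists M, forall x, P x -> forall j, `|x 0 j| <= M.

Lemma exit_slope x d : P x -> d != 0 -> exists j, slope (L j) d < 0.
Proof.
move=> Px d0; apply: contrapT => /forallNP h.
have {}h j : 0 <= slope (L j) d by rewrite leNgt; apply/negP; exact: h.
have [M bM] := bounded.
have [k dk] : exists k, d 0 k != 0.
  apply: contrapT => /forallNP hk; move/eqP: d0; apply; apply/rowP => k.
  by rewrite mxE; apply/eqP/negP => /negP /hk.
have M0 : 0 <= M by apply: le_trans (bM x Px k); rewrite normr_ge0.
pose t := (M + M + 1) / `|d 0 k|.
have t0 : 0 <= t by rewrite divr_ge0 // ?normr_ge0 // !addr_ge0.
have : P (x + t *: d) 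
  by move=> j; rewrite affD slopeZ; apply: addr_ge0; [exact: Px | apply: mulr_ge0].
move=> /bM /(_ k); rewrite !mxE => h2.
have : `|t * d 0 k| = M + M + 1.
  by rewrite normrM (ger0_norm t0) /t divfK ?normr_eq0.
have h1 := bM x Px k; move: h1 h2; rewrite !ler_norml => /andP[? ?] /andP[? ?] h3.
have : `|t * d 0 k| <= M + M by rewrite ler_norml; apply/andP; split; lra.
by rewrite h3; lra.
Qed.

(** Following a direction along which the active constraints stay active, a
bounded polyhedron is left only after a further constraint has become active. *)
Lemma slide x d : P x -> d != 0 -> (forall j, j \in active x -> slope (L j) d = 0) ->
  exists s : R, [/\ 0 < s, P (x + s *: d) & active x \proper active (x + s *: d)].
Proof.
move=> Px d0 act; have [j0 hj0] := exit_slope Px d0.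
pose r j := aff (L j) x / - slope (L j) d.
case: (@arg_minP _ _ _ j0 (fun j => slope (L j) d < 0) r hj0) => j hj rmin.
have pos_aff i : slope (L i) d < 0 -> 0 < aff (L i) x.
  move=> hi; rewrite lt_neqAle Px andbT eq_sym; apply: contraTneq hi => hi.
  by rewrite act ?ltxx // inE hi.
have E : r j * slope (L j) d = - aff (L j) x.
  by rewrite /r invrN mulrN mulNr divfK // lt_eqF.
exists (r j); split.
- by rewrite /r divr_gt0 ?oppr_gt0 ?pos_aff.
- move=> i; rewrite affD slopeZ.
  have r0 : 0 <= r j by rewrite /r divr_ge0 ?oppr_ge0 ?ltW ?pos_aff.
  have [hi|hi] := leP 0 (slope (L i) d); first by apply: addr_ge0; [exact: Px | apply: mulr_ge0].
  have := rmin i hi; rewrite {2}/r ler_pdivlMr ?oppr_gt0 // mulrN.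
  by rewrite lerNl -subr_ge0 opprK addrC.
- apply/properP; split.
    apply/fintype.subsetP => i hi; rewrite inE affD slopeZ act // mulr0 addr0.
    by move: hi; rewrite inE.
  exists j; first by rewrite inE affD slopeZ E subrr.
  by rewrite inE gt_eqF // pos_aff.
Qed.

Definition corners : set V := [set x | P x /\ corner x].

(** Minkowski's theorem, by induction on the number of inactive constraints: a
point that is no corner lies between the two points that [slide] reaches in
opposite directions. *)
Lemma closed_cell_hull : P = convex_hull corners.
Proof.
apply/seteqP; split; last first.
  apply: convex_hull_sub => [x y t Px Py /andP[t0 t1] j|x []//].
  by rewrite aff_conv; apply: addr_ge0; apply: mulr_ge0; rewrite ?subr_ge0.
move=> x; move: {2}(#|~: active x|) (leqnn #|~: active x|) => m.
elim: m x => [|m IH] x hm Px; have [cx|ncx] := boolP (corner x).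
- exact: sub_convex_hull.
- have [d d0 hd] := not_corner ncx; have [s [_ _ /properP[_ [j _]]]] := slide Px d0 hd.
  by move: hm; rewrite leqn0 cards_eq0 => /eqP/setP/(_ j); rewrite !inE => /negbFE ->.
- exact: sub_convex_hull.
- have [d d0 hd] := not_corner ncx.
  have [s [s0 Ps acts]] := slide Px d0 hd.
  have hdN : forall j, j \in active x -> slope (L j) (- d) = 0.
    by move=> j /hd h; rewrite -scaleN1r slopeZ h mulr0.
  have [r [r0 Pr actr]] := slide Px (ltac:(by rewrite oppr_eq0) : - d != 0) hdN.
  have less z : active x \proper active z -> (#|~: active z| <= m)%N.
    by move=> h; rewrite -ltnS; apply: leq_trans hm; rewrite proper_card // properC.
  have -> : x = (r / (r + s)) *: (x + s *: d) + (1 - r / (r + s)) *: (x + r *: - d).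
    have rs : r + s != 0 by rewrite gt_eqF ?addr_gt0.
    apply/rowP => k; rewrite !mxE; field; exact: rs.
  apply: convex_hull_convex; [exact: IH (less _ acts) Ps|exact: IH (less _ actr) Pr|].
  apply/andP; split; first by rewrite divr_ge0 ?addr_ge0 // ltW.
  by rewrite ler_pdivrMr ?addr_gt0 // mul1r lerDl ltW.
Qed.

(** A corner is determined by the set of its active constraints. *)
Lemma finite_corners : finite_set corners.
Proof.
pose g (A : {set J}) : V := xget 0 [set x | corners x /\ active x = A].
apply: (@sub_finite_set _ _ (g @` setT)); last by apply: finite_image; exact: finite_finset.
move=> x cx; exists (active x) => //.
have [[Py cy] ayx] : [set y | corners y /\ active y = active x] (g (active x)).
  by apply: xgetPex; exists x.
apply/eqP; rewrite -subr_eq0; apply/eqP.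
move: cx => [Px /row_free_inj cinj].
apply: cinj; rewrite mul0mx; apply/active_mx_ker => j jx.
rewrite -scaleN1r slopeD slopeZ mulN1r.
have : j \in active (g (active x)) by rewrite ayx.
by move: jx; rewrite !inE /aff => /eqP ? /eqP ?; lra.
Qed.

Lemma polytope_closed_cell : (forall j, (L j).1 != 0) -> open_cell L !=set0 -> polytope P.
Proof.
move=> nz ne; split; last by rewrite interior_closed_cell.
by exists corners; [exact: finite_corners | exact: closed_cell_hull].
Qed.

(** Off the corners, sliding in opposite directions exhibits the point inside a
segment. *)
Lemma vertex_corner x : vertex P x -> corner x.
Proof.
move=> [Px ext]; apply: contraT => /not_corner[d d0 hd].
have [s [s0 Ps _]] := slide Px d0 hd.
have hdN : forall j, j \in active x -> slope (L j) (- d) = 0.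
  by move=> j /hd h; rewrite -scaleN1r slopeZ h mulr0.
have [r [r0 Pr _]] := slide Px (ltac:(by rewrite oppr_eq0) : - d != 0) hdN.
have rs : r + s != 0 by rewrite gt_eqF ?addr_gt0.
have [] := ext (x + s *: d) (x + r *: - d) (r / (r + s)) Ps Pr.
- by rewrite divr_gt0 ?addr_gt0 //= ltr_pdivrMr ?addr_gt0 // mul1r ltrDl.
- by apply/rowP => k; rewrite !mxE; field; exact: rs.
move=> /eqP; rewrite -subr_eq0 addrAC subrr add0r scaler_eq0 (negbTE d0) orbF.
by rewrite gt_eqF.
Qed.

End Minkowski.

(** * Golden vertices *)

Section GoldenVertices.
Variable R : realType.
Local Notation golden := (@golden R).

Lemma golden_gval g : golden (gval R g).
Proof. by exists (int_of_Z g.1), (int_of_Z g.2). Qed.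

Lemma goldenP x : golden x <-> exists g, x = gval R g.
Proof.
split=> [[a [b ->]]|[g ->]]; last exact: golden_gval.
by exists (Z_of_int a, Z_of_int b); rewrite /gval /zval /= !Z_of_intK.
Qed.

Lemma goldenD x y : golden x -> golden y -> golden (x + y).
Proof. by move=> /goldenP[g ->] /goldenP[h ->]; rewrite -gvalD; exact: golden_gval. Qed.
Lemma goldenM x y : golden x -> golden y -> golden (x * y).
Proof. by move=> /goldenP[g ->] /goldenP[h ->]; rewrite -gvalM; exact: golden_gval. Qed.
Lemma goldenN x : golden x -> golden (- x).
Proof. by move=> /goldenP[g ->]; rewrite -gvalN; exact: golden_gval. Qed.
Lemma goldenB x y : golden x -> golden y -> golden (x - y).
Proof. by move=> hx /goldenN; exact: goldenD. Qed.
Lemma golden_int (m : int) : golden m%:~R.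
Proof. by exists m, 0; rewrite mul0r addr0. Qed.
Lemma golden_nat (m : nat) : golden m%:R.
Proof. exact: (golden_int m). Qed.
Lemma golden1 : golden 1. Proof. exact: (golden_nat 1). Qed.
Lemma golden0 : golden 0. Proof. exact: (golden_nat 0). Qed.
Lemma golden_phi : golden (phi R).
Proof. by exists 0, 1; rewrite mul1r add0r. Qed.

Lemma golden_sign k : golden ((-1) ^+ k).
Proof.
elim: k => [|k IH]; first by rewrite expr0; exact: golden1.
by rewrite exprS mulN1r; exact: goldenN.
Qed.

Lemma golden_sum (I : Type) (r : seq I) (P : pred I) (F : I -> R) :
  (forall i, golden (F i)) -> golden (\sum_(i <- r | P i) F i).
Proof. by move=> h; apply: big_ind => //; [exact: golden0|exact: goldenD]. Qed.

Lemma golden_det n (A : 'M[R]_n) : (forall i j, golden (A i j)) -> golden (\det A).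
Proof.
move=> h; apply: golden_sum => s; apply: goldenM; first exact: golden_sign.
by apply: big_ind => //; [exact: golden1|exact: goldenM].
Qed.

(** Cramer's rule: a corner solves a square system of active constraints with
golden coefficients, and such a matrix has a golden inverse as soon as its
determinant does. *)
Lemma golden_closed_cell n (J : finType) (L : J -> form R n) :
  (exists M, forall x, closed_cell L x -> forall j, `|x 0 j| <= M) ->
  (forall j i, golden ((L j).1 i 0)) -> (forall j, golden (L j).2) ->
  (forall f : 'I_n -> J, let d := \det (\matrix_(i, k) (L (f k)).1 i 0) in
     d = 0 \/ golden d^-1) ->
  golden_polytope (closed_cell L).
Proof.
move=> bd g1 g2 minors v /(vertex_corner bd); rewrite /corner /row_free -mxrank_tr => full.
move=> j0; set A := active L v in full.
have {}full : row_full (active_mx L A)^T by [].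
pose f k := fullrankfun full k; pose B := rowsub f (active_mx L A)^T.
have uB : B \in unitmx by exact: fullrowsub_unit.
have fA k : enum_val (f k) \in A.
  apply: contraT => kA; have : row k B = 0.
    apply/rowP => i; rewrite !mxE (negbTE kA) //.
  rewrite rowE => /(congr1 (mulmx^~ (invmx B))); rewrite mulmxK // mul0mx.
  by move=> /matrixP /(_ 0 k); rewrite !mxE !eqxx => /eqP; rewrite oner_eq0.
pose M : 'M[R]_n := \matrix_(i, k) (L (enum_val (f k))).1 i 0.
have BM : B^T = M by apply/matrixP => i k; rewrite !mxE fA.
have uM : M \in unitmx by rewrite -BM unitmx_tr.
have vM : v *m M = \row_k - (L (enum_val (f k))).2.
  apply/rowP => k; rewrite !mxE; have := fA k; rewrite inE /aff /slope mxE => /eqP h.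
  by apply/eqP; rewrite -subr_eq0 opprK -[X in _ == X]h; apply/eqP; congr (_ + _);
    apply: eq_bigr => i _; rewrite mxE.
have -> : v = (\row_k - (L (enum_val (f k))).2) *m invmx M by rewrite -vM mulmxK.
rewrite mxE; apply: golden_sum => i; rewrite mxE; apply: goldenM; first exact: goldenN.
rewrite /invmx uM mxE; apply: goldenM.
  have := minors (fun k => enum_val (f k)); rewrite -/M => -[d0|//].
  by move: uM; rewrite unitmxE d0 unitr0.
rewrite mxE /cofactor; apply: goldenM; first exact: golden_sign.
by apply: golden_det => a b; rewrite !mxE.
Qed.

End GoldenVertices.

Ltac golden_tac := repeat first
  [ assumption | exact: golden_gval | exact: golden_int | exact: golden_phi | exact: golden1 | exact: golden0
  | exact: golden_nat | apply: goldenD | apply: goldenM | apply: goldenN ].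

(** * Polytope exchanges of a torus *)

Section TorusBasics.
Variables (R : realType) (n : nat).
Local Notation V := 'rV[R]_n.

Definition lattice (k : 'rV[int]_n) : V := 2 *: map_mx intr k.

Lemma torus_piP (u v : V) : torus_pi u = torus_pi v <-> exists k, v = u + lattice k.
Proof.
split=> [h|[k ->]].
  by have /eqquotP/asboolP := h.
by apply/eqquotP/asboolP; exists k.
Qed.

Lemma torus_pi_lattice (u : V) k : torus_pi (u + lattice k) = torus_pi u.
Proof. by apply/esym/torus_piP; exists k. Qed.

Lemma torus_piK (p : torus R n) : torus_pi (repr p) = p.
Proof. exact: reprK. Qed.

Lemma latticeE k j : lattice k 0 j = 2 * (k 0 j)%:~R.
Proof. by rewrite !mxE. Qed.

Lemma ballP (x y : V) (e : R) : ball x e y <-> `|x - y| < e.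
Proof. by rewrite -ball_normE. Qed.

Lemma coord_le_norm (x : V) j : `|x 0 j| <= `|x|.
Proof.
have := mx_normrE x => /(congr1 (fun r => `|x 0 j| <= r)) E.
by rewrite [`|x|]/Num.norm /= E; apply/bigmax_geP; right; exists (0, j).
Qed.

Lemma cvg_translate (c y : V) : (fun z : V => z + c) @ y --> y + c.
Proof. exact: (cvgD cvg_id (cvg_cst c)). Qed.

Section Partition.
Variables (k : nat) (X : 'I_k -> set V).
Hypothesis X_polytope : forall i, polytope (X i).
Hypothesis X_closed : forall i, closed (X i).
Hypothesis X_dense : forall i, X i `<=` closure (X i)°.
Hypothesis X_bounded : exists M : R, forall i x, X i x -> forall j, `|x 0 j| <= M.
Hypothesis X_inj : forall i j x y,
  (X i)° x -> (X j)° y -> torus_pi x = torus_pi y -> i = j /\ x = y.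
Hypothesis X_cover : forall (x : V) (e : R), 0 < e -> exists i y z,
  [/\ X i z, `|x - y| < e & torus_pi y = torus_pi z].

(** A point of X j in the open image of another cell could be moved into the
interior of X j. *)
Lemma partition_disjoint i j : i != j ->
  torus_pi @` (X i)° `&` torus_pi @` X j = set0.
Proof.
move=> ij; apply/seteqP; split=> // _ [[x Xx <-]] [y Xy /esym /torus_piP[l yE]].
have : nbhs y [set y' | (X i)° (y' - lattice l)].
  have : (fun y' : V => y' - lattice l) @ y --> y - lattice l.
    exact: cvg_translate.
  apply; rewrite yE addrK; apply: open_nbhs_nbhs; split => //; exact: open_interior.
move=> /(X_dense Xy) [y' [Xy' Xi]].
have [e _] : i = j /\ y' - lattice l = y'.
  by apply: X_inj => //; rewrite -[in RHS](subrK (lattice l) y') torus_pi_lattice.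
by move: ij; rewrite e eqxx.
Qed.

(** A point that no translate of a cell contains keeps a positive distance from
the finitely many translates that come near it, while the translates together
are dense. *)
Lemma partition_cover : \bigcup_i (torus_pi @` X i) = [set: torus R n].
Proof.
apply/seteqP; split=> // p _; rewrite -(torus_piK p); set x := repr p.
apply: contrapT => notin.
have [M bM] := X_bounded.
have [N hN] : exists N : nat, M + `|x| + 1 <= N%:R.
  by exists (Num.truncn (M + `|x| + 1)).+1; rewrite ltW // truncnS_gt.
pose shift_of (c : {ffun 'I_n -> 'I_(N + N).+1}) : 'rV[int]_n := \row_j ((c j)%:Z - N%:Z).
have far (ic : 'I_k * {ffun 'I_n -> 'I_(N + N).+1}) :
    nbhs x [set y | ~ X ic.1 (y + lattice (shift_of ic.2))].
  have cts : (fun y : V => y + lattice (shift_of ic.2)) @ x --> x + lattice (shift_of ic.2).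
    exact: cvg_translate.
  apply: (cts (~` X ic.1)); apply: open_nbhs_nbhs; split; first exact: closed_openC.
  move=> h; apply: notin; exists ic.1 => //; exists (x + lattice (shift_of ic.2)) => //.
  exact: torus_pi_lattice.
have : nbhs x [set y | forall ic : 'I_k * {ffun 'I_n -> 'I_(N + N).+1},
    ~ X ic.1 (y + lattice (shift_of ic.2))] by exact: (filter_forall _ far).
move=> /nbhs_ballP[e /= e0 he].
have e1 : 0 < Num.min e 1 by rewrite lt_min e0 ltr01.
have [i [y [z [Xz xy /torus_piP[l zE]]]]] := X_cover x e1.
move: xy; rewrite lt_min => /andP[xye xy1].
have bl j : leq (absz (l 0 j)) N.
  have h1 := bM i z Xz j.
  have h2 : `|y 0 j| <= `|x| + 1.
    have -> : y = x - (x - y) by rewrite subKr.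
    rewrite !mxE; apply: le_trans (ler_normB _ _) _.
    apply: lerD; first exact: coord_le_norm.
    by have := coord_le_norm (x - y) j; rewrite !mxE => /le_trans; apply; exact: ltW.
  have : `|2 * (l 0 j)%:~R| <= N%:R :> R.
    have -> : 2 * (l 0 j)%:~R = z 0 j - y 0 j by rewrite zE !mxE; ring.
    by apply: le_trans (ler_normB _ _) _; lra.
  rewrite normrM ger0_norm // -intr_norm => h3.
  have h4 : `|l 0 j|%:~R <= N%:R :> R.
    have : 0 <= `|l 0 j|%:~R :> R by rewrite ler0z.
    lra.
  by move: h4; rewrite -[N%:R]/(N%:Z%:~R) ler_int -abszE lez_nat.
pose c : {ffun 'I_n -> 'I_(N + N).+1} := [ffun j => inord (absz (l 0 j + N%:Z))].
have cE : shift_of c = l.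
  apply/rowP => j; rewrite !mxE ffunE inordK; have := bl j; lia.
have /(_ (i, c)) := he y (ltac:(exact/ballP)).
by rewrite /= cE -zE.
Qed.

Lemma partition_intro : polytope_partition X.
Proof.
split => //; [|exact: partition_disjoint|exact: partition_cover].
by move=> i x y; rewrite !inE => hx hy e; have [_] := X_inj hx hy e.
Qed.

End Partition.
End TorusBasics.

Section CellDense.
Variables (R : realType) (n : nat) (J : finType) (L : J -> form R n).

(** Every point of a closed cell is joined to an interior point by a segment
whose other points are interior. *)
Lemma closed_cell_dense : open_cell L !=set0 -> closed_cell L `<=` closure (open_cell L).
Proof.
move=> [c hc] x hx B nB.
have ct : (fun s : R => s *: c + (1 - s) *: x) @ 0^'+ --> 0 *: c + (1 - 0) *: x.
  apply: cvg_at_right_filter.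
  apply: cvgD; first by apply: cvgZr_tmp; exact: cvg_id.
  by apply: cvgZr_tmp; apply: cvgB; [exact: cvg_cst | exact: cvg_id].
rewrite scale0r add0r subr0 scale1r in ct.
have near_s := ct _ nB; near (0 : R)^'+ => s.
have s0 : 0 < s by near: s; exact: nbhs_right_gt.
have s1 : s < 1 by near: s; exact: nbhs_right_lt.
exists (s *: c + (1 - s) *: x); split; last by near: s.
move=> j; rewrite aff_conv; apply: ltr_wpDr; last by apply: mulr_gt0 => //; exact: hc.
by apply: mulr_ge0; [rewrite subr_ge0 ltW | exact: hx].
Unshelve. all: by end_near. Qed.

End CellDense.

Section Translate.
Variables (R : realType) (n : nat) (J : finType) (L : J -> form R n) (t : 'rV[R]_n).

Definition translate_forms (j : J) : form R n := ((L j).1, (L j).2 - slope (L j) t).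

Lemma aff_translate j x : aff (translate_forms j) x = aff (L j) (x - t).
Proof. by rewrite affD -scaleN1r slopeZ mulN1r /aff /= addrA. Qed.

Lemma translate_closed_cell :
  closed_cell translate_forms = [set u + t | u in closed_cell L].
Proof.
apply/seteqP; split=> x.
  by move=> h; exists (x - t); [move=> j; rewrite -aff_translate; exact: h|exact: subrK].
by move=> [u hu <-] j; rewrite aff_translate addrK; exact: hu.
Qed.

Lemma translate_open_cell :
  open_cell translate_forms = [set u + t | u in open_cell L].
Proof.
apply/seteqP; split=> x.
  by move=> h; exists (x - t); [move=> j; rewrite -aff_translate; exact: h|exact: subrK].
by move=> [u hu <-] j; rewrite aff_translate addrK; exact: hu.
Qed.

End Translate.

Lemma golden_translate (R : realType) n (P : set 'rV[R]_n) (t : 'rV[R]_n) :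
  golden_vector t -> golden_polytope P -> golden_polytope [set u + t | u in P].
Proof.
move=> gt gP v [[u Pu <-] ext] j; rewrite mxE; apply: goldenD; last exact: gt.
apply: gP; split=> // x y s Px Py s01 uE.
have [] := ext (x + t) (y + t) s; [by exists x|by exists y|by []| |].
  by rewrite uE; apply/rowP => k; rewrite !mxE; ring.
by move=> /addIr -> /addIr ->.
Qed.

(** Cells that are open, pairwise disjoint modulo the lattice and dense, before
and after the translations, form a golden exchange. Cells with empty interior
may occur in the family; they are discarded. *)
Section CellExchange.
Variables (R : realType) (n : nat) (I J : finType).
Local Notation V := 'rV[R]_n.
Variables (L : I -> J -> form R n) (t : I -> V).
Variable f : pfun_graph (torus R n) (torus R n).

Hypothesis normal_neq0 : forall i j, (L i j).1 != 0.
Hypothesis cell_bounded : exists M : R, forall i x, closed_cell (L i) x ->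
  forall k, `|x 0 k| <= M /\ `|(x + t i) 0 k| <= M.
Hypothesis cell_golden : forall i, golden_polytope (closed_cell (L i)).
Hypothesis trans_golden : forall i, golden_vector (t i).
Hypothesis dom_inj : forall i j x y, open_cell (L i) x -> open_cell (L j) y ->
  torus_pi x = torus_pi y -> i = j /\ x = y.
Hypothesis cod_inj : forall i j x y, open_cell (L i) x -> open_cell (L j) y ->
  torus_pi (x + t i) = torus_pi (y + t j) -> i = j /\ x = y.
Hypothesis dom_cover : forall (x : V) (e : R), 0 < e -> exists i y z,
  [/\ open_cell (L i) z, `|x - y| < e & torus_pi y = torus_pi z].
Hypothesis cod_cover : forall (x : V) (e : R), 0 < e -> exists i y z,
  [/\ open_cell (L i) z, `|x - y| < e & torus_pi y = torus_pi (z + t i)].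
Hypothesis f_graph : forall p q, f p q <->
  exists i, exists2 u, open_cell (L i) u & p = torus_pi u /\ q = torus_pi (u + t i).

(* The cells that remain, and their renumbering *)
Let kept : finType := {i : I | `[< open_cell (L i) !=set0 >]}.
Let cell_index (c : 'I_#|kept|) : I := val (enum_val c).

Let index_of i x : open_cell (L i) x -> exists c, cell_index c = i.
Proof.
move=> hx; have hi : `[< open_cell (L i) !=set0 >] by apply/asboolP; exists x.
by exists (enum_rank (Sub i hi : kept)); rewrite /cell_index enum_rankK.
Qed.

Let cell_index_inj : injective cell_index.
Proof. by move=> c d /val_inj /enum_val_inj. Qed.

Let cell_ne c : open_cell (L (cell_index c)) !=set0.
Proof. exact/asboolP/(valP (enum_val c)). Qed.

Lemma cell_exchange : golden_polytope_exchange f.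
Proof.
have [M bM] := cell_bounded.
have bound i : exists M, forall x, closed_cell (L i) x -> forall k, `|x 0 k| <= M.
  by exists M => x /bM h k; have [] := h k.
have intE c : (closed_cell (L (cell_index c)))° = open_cell (L (cell_index c)).
  exact: interior_closed_cell.
pose T i := translate_forms (L i) (t i).
have Tnz i j : (T i j).1 != 0 by exact: normal_neq0.
have intT c : (closed_cell (T (cell_index c)))° = open_cell (T (cell_index c)).
  exact: interior_closed_cell.
have Tne c : open_cell (T (cell_index c)) !=set0.
  by have [x hx] := cell_ne c; exists (x + t (cell_index c)); rewrite translate_open_cell; exists x.
have Tbound i : exists M, forall x, closed_cell (T i) x -> forall k, `|x 0 k| <= M.
  by exists M => x; rewrite translate_closed_cell => -[u /bM h <-] k; have [] := h k.
exists #|kept|, (fun c => closed_cell (L (cell_index c))),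
  (fun c => closed_cell (T (cell_index c))), (fun c => t (cell_index c)).
split; last first.
  move=> c; split=> //; rewrite translate_closed_cell; exact: golden_translate.
split.
- apply: partition_intro => [c|c|c|||x e e0].
  + exact: polytope_closed_cell.
  + exact: closed_closed_cell.
  + by rewrite intE; exact: closed_cell_dense.
  + by exists M => c x /bM h k; have [] := h k.
  + move=> c d x y; rewrite !intE => hx hy e.
    by have [/cell_index_inj -> ->] := dom_inj hx hy e.
  + have [i [y [z [hz xy yz]]]] := dom_cover x e0.
    have [c ci] := index_of hz; exists c, y, z; split=> //.
    by rewrite ci; exact: open_closed_cell.
- apply: partition_intro => [c|c|c|||x e e0].
  + exact: polytope_closed_cell.
  + exact: closed_closed_cell.
  + by rewrite intT; exact: closed_cell_dense.
  + by exists M => c x; rewrite translate_closed_cell => -[u /bM h <-] k; have [] := h k.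
  + move=> c d x y; rewrite !intT !translate_open_cell => -[u hu <-] [v hv <-] e.
    have [ecd ->] := cod_inj hu hv e.
    by rewrite ecd; move/cell_index_inj: ecd => ->.
  + have [i [y [z [hz xy yz]]]] := cod_cover x e0.
    have [c ci] := index_of hz; exists c, y, (z + t i); split=> //.
    by rewrite ci translate_closed_cell; exists z => //; exact: open_closed_cell.
- by move=> c; exact: translate_closed_cell.
- move=> p q; rewrite f_graph; split=> -[i [u hu [-> ->]]].
    by have [c ci] := index_of hu; exists c, u; rewrite ?intE ci.
  by exists (cell_index i), u => //; rewrite -intE.
Qed.

End CellExchange.

(** * Half a turn on the cube *)

Section HalfTurn.
Variable R : realType.
Local Notation f := (phi R).
Local Notation golden := (@golden R).

(** The coordinates (U, V, S). For the point (x, y) of the strip they are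
x / phi, (x - y - 1) / 2 and (x + y - 1) / 2 modulo 2. *)
Definition triple : Type := R * R * R.
(** The integers (a, e, g, k, l): a, e and g are the multiples of the second, third
and fourth pinwheel vectors, up to a common shift; k and l return the end point
to the cube. The other two multiples act trivially on the torus. *)
Definition code : Type := int * int * int * int * int.

Definition half_map (m : code) (x : triple) : triple :=
  let: (a, e, g, k, l) := m in
  (x.1.1 - 2 * (f - 1) * (a%:~R + g%:~R) - 4 * (2 - f) * e%:~R - 2 * k%:~R,
   f * x.1.1 - x.2 - 1 - 2 * a%:~R - 2 * (f - 1) * e%:~R - 2 * l%:~R,
   f * x.1.1 - x.1.2 - 1 - 2 * (f - 1) * e%:~R - 2 * g%:~R).
(** Half the forms that define the second and the third strip, centred so that the
strips are the windows |r| <= phi + 1. The first and the fourth strip become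
conditions of the cube, on V before and on S after the half turn. *)
Definition coord2 (m : code) (x : triple) : R :=
  let: (a, e, g, k, l) := m in (f + 1) * x.1.1 + x.1.2 - 2 * (f + 1) * a%:~R + (f + 1).
Definition coord3 (m : code) (x : triple) : R :=
  let: (a, e, g, k, l) := m in
  (2 * f + 1) * x.1.1 - x.1.2 - 1 - 2 * f * a%:~R - 2 * (f + 1) * e%:~R + (f + 1).

Definition within (w r : R) : bool := - w < r < w.
Definition cube (x : triple) : bool := [&& within 1 x.1.1, within 1 x.1.2 & within 1 x.2].

Definition half_turn (m : code) (x x' : triple) : Prop :=
  [/\ cube x, within (f + 1) (coord2 m x), within (f + 1) (coord3 m x),
      x' = half_map m x & cube x'].

(** Reflection in the horizontal axis exchanges V and S and reverses outer
billiards. On codes it acts so that [rev m] undoes [m]. *)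
Definition swap (x : triple) : triple := (x.1.1, x.2, x.1.2).
Definition rev (m : code) : code :=
  let: (a, e, g, k, l) := m in (- (g + k), - (e + k), - (a + k), k, l).

(** The windows of the reversed half turn are those of the original one in the
opposite order. Hence injectivity and surjectivity of half turns come for free
from uniqueness and existence. *)
Lemma half_turn_rev m x x' : half_turn m x x' -> half_turn (rev m) (swap x') (swap x).
Proof.
case: m => [[[[a e] g] k] l] [cx c2 c3 -> cx'].
have ff : f * f = f + 1 := phi_sqr R.
case: x cx c2 c3 cx' => [[u v] s]; rewrite /half_turn /swap /cube /=.
move=> /and3P[cu cv cs] c2 c3 /and3P[cu' cv' cs'].
have fu := congr1 ( *%R^~ u) ff; have fa := congr1 ( *%R^~ a%:~R) ff.
have fg := congr1 ( *%R^~ g%:~R) ff; have fe := congr1 ( *%R^~ e%:~R) ff.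
have fk := congr1 ( *%R^~ k%:~R) ff; rewrite /= !mulrDl !mul1r in fu fa fg fe fk.
split.
- by apply/and3P.
- move: c3; rewrite /within /= !(intrN, intrD).
  set A := (X in _ < X < _); set B := (X in _ -> _ < X < _).
  by have -> : A = B by rewrite /A /B; lra.
- move: c2; rewrite /within /= !(intrN, intrD).
  set A := (X in _ < X < _); set B := (X in _ -> _ < X < _).
  by have -> : A = B by rewrite /A /B; lra.
- by rewrite !(intrN, intrD); congr (_, _, _); lra.
- by apply/and3P.
Qed.

Lemma rev_inj : injective rev.
Proof.
move=> [[[[a e] g] k] l] [[[[a' e'] g'] k'] l'] [] h1 h2 h3 hk hl.
by congr (_, _, _, _, _); lia.
Qed.

Lemma swap_inj : injective swap.
Proof. by move=> [[u v] s] [[u' v'] s'] [-> -> ->]. Qed.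

Lemma within_le w r : within w r -> - w <= r <= w.
Proof. by case/andP=> h1 h2; rewrite !ltW. Qed.

(** A window of length 2w meets a progression of step 2w at most once, up to
its end points. *)
Lemma window_uniq (w q q' : R) (i j : int) : - w <= q <= w -> within w q' ->
  q - q' = 2 * w * (j%:~R - i%:~R) -> i = j.
Proof.
move=> /andP[h1 h2] /andP[h3 h4] e.
have w0 : 0 < w by clear e; lra.
have lt1 (a b : int) : 2 * w * (a%:~R - b%:~R) < 2 * w -> a <= b.
  by rewrite gtr_pMr ?mulr_gt0 // ltrBlDl -intrD1 ltr_int ltzD1.
apply/eqP; rewrite eq_le; apply/andP; split; apply: lt1.
  have -> : 2 * w * (i%:~R - j%:~R) = q' - q by rewrite -[q' - q]opprB e; ring.
  by clear e; lra.
by rewrite -e; clear e; lra.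
Qed.

(** The five integers are determined one after the other, each by a window of the
length of its period. *)
Lemma half_turn_uniq m m' x x1 x2 : half_turn m x x1 -> half_turn m' x x2 -> m = m' /\ x1 = x2.
Proof.
move=> h1 h2; suff e : m = m' by split=> //; move: h1 h2; rewrite e => -[_ _ _ -> _] [_ _ _ ->].
case: m h1 => [[[[a e] g] k] l] [_ a2 a3 -> /and3P[a4 a5 a6]].
case: m' h2 => [[[[a' e'] g'] k'] l'] [_ b2 b3 -> /and3P[b4 b5 b6]].
have ea : a = a' by apply: window_uniq (within_le a2) b2 _; rewrite /=; ring.
subst a'; have ee : e = e' by apply: window_uniq (within_le a3) b3 _; rewrite /=; ring.
subst e'; have eg : g = g' by apply: window_uniq (within_le a6) b6 _; rewrite /=; ring.
subst g'; have ek : k = k' by apply: window_uniq (within_le a4) b4 _; rewrite /=; ring.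
subst k'; have el : l = l' by apply: window_uniq (within_le a5) b5 _; rewrite /=; ring.
by subst l'.
Qed.

Lemma half_turn_inj m m' x1 x2 x : half_turn m x1 x -> half_turn m' x2 x -> m = m' /\ x1 = x2.
Proof.
move=> /half_turn_rev h1 /half_turn_rev h2.
by have [/rev_inj -> /swap_inj ->] := half_turn_uniq h1 h2.
Qed.

End HalfTurn.

(** * Generic points *)

(** The linear parts in (U, V, S) of all forms in the windows of one or two half
turns: the family is closed under pullback by half turns. *)
Definition normal_table : seq (gnum * gnum * gnum) :=
  [:: (gint 1, gint 0, gint 0); (gint 0, gint 1, gint 0); (gint 0, gint 0, gint 1);
      ((0, 1)%ZZ, gint (-1), gint 0); ((0, 1)%ZZ, gint 0, gint (-1));
      ((1, 1)%ZZ, gint 1, gint 0); ((1, 1)%ZZ, gint 0, gint 1);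
      ((1, 2)%ZZ, gint (-1), gint 0); ((1, 2)%ZZ, gint 0, gint (-1))].
Definition normal (r : nat) : gnum * gnum * gnum :=
  nth (gint 1, gint 0, gint 0) normal_table r.

(** The index of the linear part of normal r composed with a half turn; it does
not depend on the code. *)
Definition pullback (r : nat) : nat := nth 0%N [:: 0; 4; 3; 2; 1; 8; 7; 6; 5]%N r.
Definition swap_normal (r : nat) : nat := nth 0%N [:: 0; 2; 1; 4; 3; 6; 5; 8; 7]%N r.

Section Generic.
Variable R : realType.
Local Notation f := (phi R).
Local Notation golden := (@golden R).
Local Notation triple := (triple R).

Definition nval (r : nat) (x : triple) : R :=
  gval R (normal r).1.1 * x.1.1 + gval R (normal r).1.2 * x.1.2 + gval R (normal r).2 * x.2.

(** Windows have golden end points, so a generic point avoids the boundary of every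
window of every code at once; and as the constants in half turns are golden,
genericity survives them. *)
Definition generic (x : triple) : Prop := forall r, (r < 9)%N -> ~ golden (nval r x).

Lemma zval0 : zval R 0 = 0. Proof. by []. Qed.
Lemma zval1 : zval R 1 = 1. Proof. by []. Qed.
Lemma zval2 : zval R 2 = 2. Proof. by []. Qed.
Lemma zvalN1 : zval R (-1) = -1. Proof. by []. Qed.
Definition zvalE := (zval0, zval1, zval2, zvalN1).

(* One goal for each of the nine normals *)
Ltac normal_cases r r9 := move: r r9 => [|[|[|[|[|[|[|[|[|r]]]]]]]]] //= _.

Lemma golden_addr y c : golden (y + c) -> golden c -> golden y.
Proof. by move=> gy gc; rewrite -(addrK c y); exact: goldenB. Qed.

Lemma nvalD r x y : nval r (x.1.1 + y.1.1, x.1.2 + y.1.2, x.2 + y.2) = nval r x + nval r y.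
Proof. by rewrite /nval /=; ring. Qed.

Lemma generic_shift x (a b c : R) : golden a -> golden b -> golden c ->
  generic x -> generic (x.1.1 + a, x.1.2 + b, x.2 + c).
Proof.
move=> ga gb gc gx r r9; rewrite (nvalD r x (a, b, c)) => /golden_addr h.
apply: (gx r r9); apply: h; rewrite /nval /=.
by golden_tac.
Qed.

Lemma generic_swap x : generic x -> generic (swap x).
Proof.
move=> gx r r9; have : nval r (swap x) = nval (swap_normal r) x.
  by normal_cases r r9; rewrite /nval /=; ring.
move=> ->; apply: gx; normal_cases r r9.
Qed.

Lemma nval_half_map m r x : (r < 9)%N ->
  nval r (half_map m x) = nval (pullback r) x + nval r (half_map m (0, 0, 0)).
Proof.
case: m x => [[[[a e] g] k] l] [[u v] s] r9.
have ff := congr1 ( *%R^~ u) (phi_sqr R); rewrite /= !mulrDl mul1r in ff.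
normal_cases r r9; rewrite /nval /gval /= !zvalE; lra.
Qed.

Lemma golden_half_map0 m r : golden (nval r (half_map m (0, 0, 0))).
Proof.
case: m => [[[[a e] g] k] l]; rewrite /nval /=.
by golden_tac.
Qed.

Lemma generic_half_map m x : generic x -> generic (half_map m x).
Proof.
move=> gx r r9; rewrite nval_half_map // => /golden_addr/(_ (golden_half_map0 m r)).
by apply: gx; normal_cases r r9.
Qed.

(** The progression of q has a term in the closed window; at an end of the window
q would be golden. *)
Lemma window_exists (w q : R) : 0 < w -> golden w -> ~ golden q ->
  exists i : int, within w (q - 2 * w * i%:~R).
Proof.
move=> w0 gw gq; set i := Num.floor ((q + w) / (2 * w)); exists i.
have h2 : 0 < 2 * w by rewrite mulr_gt0.
have /andP[l u] : i%:~R <= (q + w) / (2 * w) < (i + 1)%:~R.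
  by rewrite floor_le_tmp floorD1_gt.
rewrite ler_pdivlMr // in l; rewrite ltr_pdivrMr // intrD in u.
apply/andP; split; last by lra.
rewrite lt_neqAle; apply/andP; split; last by lra.
apply/negP => /eqP e; apply: gq.
have -> : q = 2 * w * i%:~R - w by lra.
by golden_tac.
Qed.

Lemma half_turn_exists x : cube x -> generic x ->
  exists m x', half_turn m x x' /\ generic x'.
Proof.
move=> cx gx; have f0 := phi_gt0 R.
have g1 : golden (f + 1) by golden_tac.
have w0 : 0 < f + 1 by lra.
have n2 : ~ golden (coord2 (0, 0, 0, 0, 0) x).
  move=> h; apply: (gx 5%N) => //; move: h; rewrite /nval /gval /= !zvalE => h.
  set y := (X in golden X); have -> : y = coord2 (0, 0, 0, 0, 0) x - (f + 1).
    by rewrite /y /coord2 /=; ring.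
  exact: goldenB.
have [a ha] := window_exists w0 g1 n2.
have n3 : ~ golden (coord3 (a, 0, 0, 0, 0) x).
  move=> h; apply: (gx 7%N) => //; rewrite /nval /gval /= !zvalE.
  set y := (X in golden X).
  have -> : y = coord3 (a, 0, 0, 0, 0) x - (f + 1 - 1 - 2 * f * a%:~R).
    by rewrite /y /coord3 /=; ring.
  by golden_tac.
have [e he] := window_exists w0 g1 n3.
have ngen m r : (r < 9)%N -> ~ golden (nval r (half_map m x)).
  by move=> r9; exact: generic_half_map.
have [g hg] := window_exists ltr01 (@golden1 R) (ngen (a, e, 0, 0, 0) 2%N isT).
have [k hk] := window_exists ltr01 (@golden1 R) (ngen (a, e, g, 0, 0) 0%N isT).
have [l hl] := window_exists ltr01 (@golden1 R) (ngen (a, e, g, k, 0) 1%N isT).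
exists (a, e, g, k, l), (half_map (a, e, g, k, l) x); split; last exact: generic_half_map.
split=> //.
- by move: ha; congr (within _ _); rewrite /coord2 /=; ring.
- by move: he; congr (within _ _); rewrite /coord3 /=; ring.
- apply/and3P; split.
  + by move: hk; congr (within _ _); rewrite /nval /gval /= !zvalE; ring.
  + by move: hl; congr (within _ _); rewrite /nval /gval /= !zvalE; ring.
  + by move: hg; congr (within _ _); rewrite /nval /gval /= !zvalE; ring.
Qed.

(** Each entry of a code is bounded by the windows that it occurs in, together
with the bounds on the entries before it. The value 20 is generous. *)
Definition code_bounded (B : nat) (m : code) : bool :=
  let: (a, e, g, k, l) := m in
  [&& `|a| <= B%:Z, `|e| <= B%:Z, `|g| <= B%:Z, `|k| <= B%:Z & `|l| <= B%:Z].

Lemma half_turn_bounded m (x x' : triple) : half_turn m x x' -> code_bounded 20 m.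
Proof.
case: m => [[[[a e] g] k] l] [/and3P[/andP[u1 u2] /andP[v1 v2] /andP[s1 s2]] /andP[c2 c2'] /andP[c3 c3'] ->].
rewrite /= in c2 c2' c3 c3' => /and3P[/= /andP[p1 p2] /andP[q1 q2] /andP[r1 r2]].
have /andP[fl fu] := phi_bounds R; have f0 := phi_gt0 R.
case: x u1 u2 v1 v2 s1 s2 c2 c2' c3 c3' p1 p2 q1 q2 r1 r2 => [[u v] s] /=; intros.
have bnd (z : int) : -20 <= (z%:~R : R) <= 20 -> `|z| <= 20%:Z.
  rewrite -(ler_int R) intr_norm ler_norml.
  by move=> h; rewrite (_ : (20%:Z)%:~R = 20 :> R).
have fu1 : 0 < f * (u + 1) by rewrite mulr_gt0 //; lra.
have fu2 : 0 < f * (1 - u) by rewrite mulr_gt0 //; lra.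
have lo (c : R) (z : int) : (z%:~R < c -> f * (c - z%:~R) > 0 -> False) -> c <= z%:~R.
  by move=> h; rewrite leNgt; apply/negP => hz; apply: (h hz); rewrite mulr_gt0 ?subr_gt0.
have up (c : R) (z : int) : (c < z%:~R -> f * (z%:~R - c) > 0 -> False) -> z%:~R <= c.
  by move=> h; rewrite leNgt; apply/negP => hz; apply: (h hz); rewrite mulr_gt0 ?subr_gt0.
have a1 : -3 <= (a%:~R : R) by apply: lo => h h'; clear - c2 c2' u1 u2 v1 v2 fl fu fu1 fu2 h h'; lra.
have a2 : (a%:~R : R) <= 3 by apply: up => h h'; clear - c2 c2' u1 u2 v1 v2 fl fu fu1 fu2 h h'; lra.
have fa1 : 0 <= f * (a%:~R + 3) by rewrite mulr_ge0 //; lra.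
have fa2 : 0 <= f * (3 - a%:~R) by rewrite mulr_ge0 //; lra.
have e1 : -5 <= (e%:~R : R) by apply: lo => h h'; clear - c3 c3' u1 u2 v1 v2 fl fu fu1 fu2 fa1 fa2 a1 a2 h h'; lra.
have e2 : (e%:~R : R) <= 5 by apply: up => h h'; clear - c3 c3' u1 u2 v1 v2 fl fu fu1 fu2 fa1 fa2 a1 a2 h h'; lra.
have t0 : 0 <= f - 1 by lra.
have te1 : 0 <= (f - 1) * (e%:~R + 5) by rewrite mulr_ge0 //; lra.
have te2 : 0 <= (f - 1) * (5 - e%:~R) by rewrite mulr_ge0 //; lra.
have g1 : -7 <= (g%:~R : R) by clear - r1 r2 v1 v2 fl fu fu1 fu2 te1 te2; lra.
have g2 : (g%:~R : R) <= 7 by clear - r1 r2 v1 v2 fl fu fu1 fu2 te1 te2; lra.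
have l1 : -20 <= (l%:~R : R) by clear - q1 q2 s1 s2 fl fu fu1 fu2 te1 te2 a1 a2; lra.
have l2 : (l%:~R : R) <= 20 by clear - q1 q2 s1 s2 fl fu fu1 fu2 te1 te2 a1 a2; lra.
have t1 : 0 <= (f - 1) * (a%:~R + g%:~R + 10) by rewrite mulr_ge0 //; lra.
have t2 : 0 <= (f - 1) * (10 - (a%:~R + g%:~R)) by rewrite mulr_ge0 //; lra.
have s0 : 0 <= 2 - f by lra.
have se1 : 0 <= (2 - f) * (e%:~R + 5) by rewrite mulr_ge0 //; lra.
have se2 : 0 <= (2 - f) * (5 - e%:~R) by rewrite mulr_ge0 //; lra.
have k1 : -20 <= (k%:~R : R) by clear - p1 p2 u1 u2 fl fu t1 t2 se1 se2; lra.
have k2 : (k%:~R : R) <= 20 by clear - p1 p2 u1 u2 fl fu t1 t2 se1 se2; lra.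
rewrite /= !bnd //; apply/andP; split=> //; clear - a1 a2 e1 e2 g1 g2; lra.
Qed.

End Generic.

Section Density.
Variable R : realType.
Local Notation f := (phi R).

(** Since V and S grow alike, the height S - V is constant along this line. *)
Definition along (x : triple R) (s : R) : triple R := (x.1.1 + 10 * s, x.1.2 + s, x.2 + s).

Lemma interval_uncountable (e : R) : 0 < e -> ~ countable `]0, e[%classic.
Proof.
move=> e0 /countable_lebesgue_measure0.
rewrite lebesgue_measure_itv /= lte_fin e0 -EFinB subr0 => /eqP.
by rewrite eqe gt_eqF.
Qed.

Lemma nval_direction r : (r < 9)%N -> nval r (10, 1, 1) != 0 :> R.
Proof.
have /andP[fl fu] := phi_bounds R.
case: r => [|[|[|[|[|[|[|[|[|r]]]]]]]]] //= _; rewrite /nval /gval /= !zvalE;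
  by rewrite gt_eqF //; lra.
Qed.

(** A line in a direction that is parallel to no wall meets each wall once, and
there are countably many walls. *)
Lemma generic_dense (x : triple R) (e : R) : 0 < e ->
  exists s, 0 < s < e /\ generic (along x s).
Proof.
move=> e0; apply: contrapT => nogen.
pose bad (c : Z * Z * nat) : R := (gval R c.1 - nval c.2 x) / nval c.2 (10, 1, 1).
apply: (interval_uncountable e0); apply: (@sub_countable _ _ _ (range bad)); last first.
  apply: (@sub_countable _ _ _ [set: Z * Z * nat]); last exact: countableP.
  exact: card_image_le.
apply: subset_card_le => s /=; rewrite in_itv /= => s0e.
have : ~ generic (along x s) by move=> h; apply: nogen; exists s.
move=> /existsNP[r /not_implyP[r9 /contrapT /goldenP[g gE]]].
exists (g, r) => //; rewrite /bad /= -gE.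
have -> : nval r (along x s) = nval r x + s * nval r (10, 1, 1).
  by rewrite /nval /along /=; ring.
by rewrite addrAC subrr add0r mulfK // nval_direction.
Qed.

End Density.

(** * Minors of the wall normals *)

Definition signed_normal (c : nat * bool) : gnum * gnum * gnum :=
  if c.2 then opl (normal c.1) else normal c.1.
(** The coordinates (u, v, w) of the torus have w = S - V, so the coefficient of S
counts for v as well. The entries 0 and 1 form the normal in a horizontal
slice. *)
Definition entry (c : nat * bool) (i : nat) : gnum :=
  let l := signed_normal c in
  nth (gint 0) [:: l.1.1; gadd l.1.2 l.2; l.2] i.
(** The product of a + b phi and its conjugate, whose value 1 or -1 marks the
units. *)
Definition gnorm (g : gnum) : Z := (g.1 * g.1 + g.1 * g.2 - g.2 * g.2)%ZZ.
Definition zero_or_unit (g : gnum) : bool :=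
  (g == gint 0) || (gnorm g == 1%ZZ) || (gnorm g == (-1)%ZZ).
Definition gsub g h := gadd g (gopp h).
Definition minor2 (a b : nat * bool) : gnum :=
  gsub (gmul (entry a 0) (entry b 1)) (gmul (entry b 0) (entry a 1)).
Definition minor3 (a b c : nat * bool) : gnum :=
  gadd (gsub
    (gmul (entry a 0) (gsub (gmul (entry b 1) (entry c 2)) (gmul (entry c 1) (entry b 2))))
    (gmul (entry b 0) (gsub (gmul (entry a 1) (entry c 2)) (gmul (entry c 1) (entry a 2)))))
    (gmul (entry c 0) (gsub (gmul (entry a 1) (entry b 2)) (gmul (entry b 1) (entry a 2)))).
Definition signed : seq (nat * bool) := [seq (r, b) | r <- iota 0 9, b <- [:: false; true]].

Lemma minors2_unit :
  all (fun a => all (fun b => zero_or_unit (minor2 a b)) signed) signed.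
Proof. by vm_cast_no_check (erefl true). Qed.

Lemma minors3_unit :
  all (fun a => all (fun b => all (fun c => zero_or_unit (minor3 a b c)) signed) signed) signed.
Proof. by vm_cast_no_check (erefl true). Qed.

Section UnitMinors.
Variable R : realType.

Lemma zero_or_unitP g : zero_or_unit g -> gval R g = 0 \/ golden (gval R g)^-1.
Proof.
case/orP=> [/orP[/eqP ->|/eqP h]|/eqP h]; first by left; rewrite gval0.
  right; have e : gval R g * gval R ((g.1 + g.2)%ZZ, (- g.2)%ZZ) = 1.
    rewrite -gvalM -[RHS](gval_int R 1); congr gval; rewrite /gmul /=.
    by move: h; rewrite /gnorm => h; congr (_, _); lia.
  have n0 : gval R g != 0 by apply: contra_eq_neq e => ->; rewrite mul0r eq_sym oner_eq0.
  have -> : (gval R g)^-1 = gval R ((g.1 + g.2)%ZZ, (- g.2)%ZZ).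
    by apply: (mulfI n0); rewrite divff.
  exact: golden_gval.
right; have e : gval R g * gval R ((- (g.1 + g.2))%ZZ, g.2) = 1.
  rewrite -gvalM -[RHS](gval_int R 1); congr gval; rewrite /gmul /=.
  by move: h; rewrite /gnorm => h; congr (_, _); lia.
have n0 : gval R g != 0 by apply: contra_eq_neq e => ->; rewrite mul0r eq_sym oner_eq0.
have -> : (gval R g)^-1 = gval R ((- (g.1 + g.2))%ZZ, g.2).
  by apply: (mulfI n0); rewrite divff.
exact: golden_gval.
Qed.

Lemma signedP r b : (r < 9)%N -> (r, b) \in signed.
Proof. by move=> r9; apply/allpairsP; exists (r, b); rewrite mem_iota; case: b. Qed.

Lemma det2E (M : 'M[R]_2) : \det M = M 0 0 * M 1 1 - M 0 1 * M 1 0.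
Proof.
rewrite (expand_det_row _ 0) !big_ord_recl big_ord0 addr0 /cofactor !det_mx11 !mxE /=.
rewrite expr0 mul1r expr1 mulN1r mulrN.
have e1 : lift 0 0 = 1 :> 'I_2 by apply: val_inj.
have e2 : lift 1 0 = 0 :> 'I_2 by apply: val_inj.
by rewrite !(e1, e2).
Qed.

Lemma det3E (M : 'M[R]_3) : \det M =
  M 0 0 * (M 1 1 * M 2 2 - M 1 2 * M 2 1) - M 0 1 * (M 1 0 * M 2 2 - M 1 2 * M 2 0)
  + M 0 2 * (M 1 0 * M 2 1 - M 1 1 * M 2 0).
Proof.
rewrite (expand_det_row _ 0) !big_ord_recl big_ord0 addr0 /cofactor !det2E !mxE /=.
have e1 : lift 0 0 = 1 :> 'I_3 by apply: val_inj.
have e2 : lift 0 (lift 0 0) = 2 :> 'I_3 by apply: val_inj.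
have e3 : lift 0 1 = 2 :> 'I_3 by apply: val_inj.
have e4 : lift 1 0 = 0 :> 'I_3 by apply: val_inj.
have e5 : lift 1 1 = 2 :> 'I_3 by apply: val_inj.
have e6 : lift 2 0 = 0 :> 'I_3 by apply: val_inj.
have e7 : lift 2 1 = 1 :> 'I_3 by apply: val_inj.
rewrite ?(e1, e2, e3, e4, e5, e6, e7) /=.
by change (M 0 ord0) with (M 0 0); rewrite /bump /= !addn0; ring.
Qed.

Definition normal_col (n : nat) (c : nat * bool) : 'cV[R]_n := \col_i gval R (entry c i).

Lemma minors_normal2 (c : 'I_2 -> nat * bool) : (forall k, c k \in signed) ->
  let d := \det (\matrix_(i, k) normal_col 2 (c k) i 0) in d = 0 \/ golden d^-1.
Proof.
move=> cs /=; have /allP/(_ _ (cs 0))/allP/(_ _ (cs 1))/zero_or_unitP := minors2_unit.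
by rewrite det2E !mxE /minor2 /gsub gvalD gvalN !gvalM.
Qed.

Lemma minors_normal3 (c : 'I_3 -> nat * bool) : (forall k, c k \in signed) ->
  let d := \det (\matrix_(i, k) normal_col 3 (c k) i 0) in d = 0 \/ golden d^-1.
Proof.
move=> cs /=.
have /allP/(_ _ (cs 0))/allP/(_ _ (cs 1))/allP/(_ _ (cs 2))/zero_or_unitP := minors3_unit.
by rewrite det3E !mxE /minor3 /gsub !(gvalD, gvalN, gvalM).
Qed.

Lemma horizontal_free :
  all (fun c => [|| gpos (entry c 0), gpos (gopp (entry c 0)), gpos (entry c 1)
                  | gpos (gopp (entry c 1))]) signed.
Proof. by vm_cast_no_check (erefl true). Qed.

Lemma normal_col_neq0 n c : (1 < n)%N -> c \in signed -> normal_col n c != 0.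
Proof.
move=> n1 cs; have nz i : (i < n)%N -> gpos (entry c i) || gpos (gopp (entry c i)) ->
    normal_col n c != 0.
  move=> ni h; apply/eqP => /colP/(_ (Ordinal ni)); rewrite !mxE /= => e.
  by case/orP: h => /(@gpos_gt0 R); rewrite ?gvalN e ?oppr0 ltxx.
have /allP/(_ _ cs)/or4P[] := horizontal_free => h;
  [apply: (nz 0%N)|apply: (nz 0%N)|apply: (nz 1%N)|apply: (nz 1%N)];
  rewrite ?h ?orbT //; exact: ltnW.
Qed.

End UnitMinors.

(** * The cells of two half turns *)

Section Walls.
Variable R : realType.
Local Notation f := (phi R).
Local Notation golden := (@golden R).
Local Notation triple := (triple R).
Implicit Types (x y : triple) (c : code * code).

Definition origin : triple := (0, 0, 0).
Definition turn c x : triple := half_map c.2 (half_map c.1 x).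
Definition two_turns c x : Prop :=
  exists x', half_turn c.1 x x' /\ half_turn c.2 x' (turn c x).

(** The entry (r, q, w) stands for the condition |nval r x + q| < w. The conditions
of the two half turns are pulled back to the starting point x; those of the cube
in the middle are shared, which leaves 13. *)
Definition walls c : seq (nat * R * R) :=
  let o' := half_map c.1 origin in let o'' := turn c origin in
  [:: (0%N, 0, 1); (1%N, 0, 1); (2%N, 0, 1);
      (5%N, coord2 c.1 origin, f + 1); (7%N, coord3 c.1 origin, f + 1);
      (0%N, nval 0 o', 1); (4%N, nval 1 o', 1); (3%N, nval 2 o', 1);
      (8%N, coord2 c.2 o', f + 1); (6%N, coord3 c.2 o', f + 1);
      (0%N, nval 0 o'', 1); (1%N, nval 1 o'', 1); (2%N, nval 2 o'', 1)].
Definition wall c (j : nat) : nat * R * R := nth (0%N, 0, 1) (walls c) j.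
Definition wval c j x : R := nval (wall c j).1.1 x + (wall c j).1.2.

Lemma nvalE0 x : nval 0 x = x.1.1.
Proof. by rewrite /nval /gval /= !zvalE; ring. Qed.
Lemma nvalE1 x : nval 1 x = x.1.2.
Proof. by rewrite /nval /gval /= !zvalE; ring. Qed.
Lemma nvalE2 x : nval 2 x = x.2.
Proof. by rewrite /nval /gval /= !zvalE; ring. Qed.

Lemma coord2_nval m x : coord2 m x = nval 5 x + coord2 m origin.
Proof. by case: m => [[[[a e] g] k] l]; rewrite /nval /gval /= !zvalE; ring. Qed.
Lemma coord3_nval m x : coord3 m x = nval 7 x + coord3 m origin.
Proof. by case: m => [[[[a e] g] k] l]; rewrite /nval /gval /= !zvalE; ring. Qed.

Lemma nval_turn c r x : (r < 9)%N -> (pullback r < 9)%N ->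
  nval r (turn c x) = nval (pullback (pullback r)) x + nval r (turn c origin).
Proof.
move=> r9 pr9; rewrite /turn (nval_half_map c.2 (half_map c.1 x) r9).
rewrite (nval_half_map c.1 x pr9) (nval_half_map c.2 (half_map c.1 origin) r9).
by rewrite -addrA.
Qed.

(** The linear part of a half turn is an involution. Hence two half turns are a
translation. *)
Lemma turn_translation c x : turn c x =
  (x.1.1 + (turn c origin).1.1, x.1.2 + (turn c origin).1.2, x.2 + (turn c origin).2).
Proof.
have := @nval_turn c 2 x isT isT; have := @nval_turn c 1 x isT isT.
have := @nval_turn c 0 x isT isT; rewrite !nvalE0 !nvalE1 !nvalE2.
by case: (turn c x) => [[u v] s] /= -> -> ->.
Qed.

Lemma wval_walls c x : [seq wval c j x | j <- iota 0 13] =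
  [:: x.1.1; x.1.2; x.2; coord2 c.1 x; coord3 c.1 x;
      (half_map c.1 x).1.1; (half_map c.1 x).1.2; (half_map c.1 x).2;
      coord2 c.2 (half_map c.1 x); coord3 c.2 (half_map c.1 x);
      (turn c x).1.1; (turn c x).1.2; (turn c x).2].
Proof.
have c2 : nval 8 x + coord2 c.2 (half_map c.1 origin) = coord2 c.2 (half_map c.1 x).
  rewrite (coord2_nval _ (half_map c.1 x)) (coord2_nval _ (half_map c.1 origin)).
  by rewrite (@nval_half_map R c.1 5 x isT); exact: addrA.
have c3 : nval 6 x + coord3 c.2 (half_map c.1 origin) = coord3 c.2 (half_map c.1 x).
  rewrite (coord3_nval _ (half_map c.1 x)) (coord3_nval _ (half_map c.1 origin)).
  by rewrite (@nval_half_map R c.1 7 x isT); exact: addrA.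
have h r := @nval_half_map R c.1 r x.
have t r := @nval_turn c r x.
rewrite /= /wval /wall /= !addr0 c2 c3 -coord2_nval -coord3_nval.
rewrite -(h 0%N isT) -(h 1%N isT) -(h 2%N isT) -(t 0%N isT isT) -(t 1%N isT isT) -(t 2%N isT isT).
by rewrite !nvalE0 !nvalE1 !nvalE2.
Qed.

Lemma two_turnsP c x : two_turns c x <->
  forall j, (j < 13)%N -> within (wall c j).2 (wval c j x).
Proof.
have E j : (j < 13)%N -> wval c j x = nth 0 [seq wval c j x | j <- iota 0 13] j.
  by move=> j13; rewrite (nth_map 0%N) ?size_iota // nth_iota.
split.
  move=> [_ [[/and3P[? ? ?] ? ? -> _] [/and3P[? ? ?] ? ? _ /and3P[? ? ?]]]] j j13.
  by rewrite E // wval_walls; move: j j13; do 13 case=> //.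
move=> h; exists (half_map c.1 x).
have {}h j (j13 : (j < 13)%N) := h j j13.
have {}h j : (j < 13)%N -> within (wall c j).2 (nth 0 [seq wval c j x | j <- iota 0 13] j).
  by move=> j13; rewrite -E //; exact: h.
rewrite wval_walls in h.
split; split=> //; rewrite ?/cube.
- by rewrite (h 0%N) ?(h 1%N) ?(h 2%N).
- exact: (h 3%N).
- exact: (h 4%N).
- by rewrite (h 5%N) ?(h 6%N) ?(h 7%N).
- by rewrite (h 5%N) ?(h 6%N) ?(h 7%N).
- exact: (h 8%N).
- exact: (h 9%N).
- by rewrite (h 10%N) ?(h 11%N) ?(h 12%N).
Qed.

Lemma golden_half_map m x : golden x.1.1 -> golden x.1.2 -> golden x.2 ->
  [/\ golden (half_map m x).1.1, golden (half_map m x).1.2, golden (half_map m x).2,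
      golden (coord2 m x) & golden (coord3 m x)].
Proof. by case: m => [[[[a e] g] k] l] h1 h2 h3; split; rewrite /=; golden_tac. Qed.

Lemma golden_turn c : [/\ golden (turn c origin).1.1, golden (turn c origin).1.2 & golden (turn c origin).2].
Proof.
have g0 := golden0 R.
have [h1 h2 h3 _ _] := golden_half_map c.1 (x := origin) g0 g0 g0.
by have [] := golden_half_map c.2 h1 h2 h3.
Qed.

Lemma golden_wall c j : golden (wall c j).1.2 /\ golden (wall c j).2.
Proof.
have g0 := golden0 R; have g1 := golden1 R.
have gf : golden (f + 1) by golden_tac.
have [h1 h2 h3 h4 h5] := golden_half_map c.1 (x := origin) g0 g0 g0.
have [_ _ _ h6 h7] := golden_half_map c.2 h1 h2 h3.
have [h8 h9 h10] := golden_turn c.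
by rewrite /wall; move: j; do 13 (case; first by rewrite /= ?nvalE0 ?nvalE1 ?nvalE2); case.
Qed.

Lemma wall_normal c j : ((wall c j).1.1 < 9)%N.
Proof. by rewrite /wall; move: j; do 13 case=> //; case. Qed.

(** A condition |l| < w is the pair of inequalities 0 < w + l and 0 < w - l, so
normals come with both signs. *)
Definition snval (s : nat * bool) x : R := if s.2 then - nval s.1 x else nval s.1 x.

Lemma within_pos (w r : R) : (forall b : bool, 0 < w + (if b then - r else r)) <-> within w r.
Proof.
split=> [h|/andP[h1 h2] [|]]; [|lra|lra].
by have := h true; have := h false; rewrite /within => h1 h2; apply/andP; split; lra.
Qed.

Section Cells.
(* lin is the linear part of an affine chart with origin o. Space and the horizontal
slices are the cases n = 3 and n = 2. *)
Variables (n : nat) (lin : 'rV[R]_n -> triple).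
Hypothesis linE : forall s p, (p *m normal_col R n s) 0 0 = snval s (lin p).
Variable (o : triple).

Definition chart (p : 'rV[R]_n) : triple :=
  ((lin p).1.1 + o.1.1, (lin p).1.2 + o.1.2, (lin p).2 + o.2).

Definition cell_form c (jb : 'I_13 * bool) : form R n :=
  (normal_col R n ((wall c jb.1).1.1, jb.2),
   (wall c jb.1).2 + snval ((wall c jb.1).1.1, jb.2) o
   + (if jb.2 then - (wall c jb.1).1.2 else (wall c jb.1).1.2)).

Lemma aff_cell_form c j b p : aff (cell_form c (j, b)) p =
  (wall c j).2 + (if b then - wval c j (chart p) else wval c j (chart p)).
Proof.
rewrite /aff /slope /= linE /snval /= /wval.
have -> : nval (wall c j).1.1 (chart p) = nval (wall c j).1.1 (lin p) + nval (wall c j).1.1 o.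
  exact: nvalD.
by case: b; ring.
Qed.

Lemma open_cellP c p : open_cell (cell_form c) p <-> two_turns c (chart p).
Proof.
rewrite two_turnsP; split=> [h j j13|h [j b]].
  by apply/within_pos => b; have := h (Ordinal j13, b); rewrite aff_cell_form.
by rewrite aff_cell_form; apply: (within_pos _ _).2; exact: h.
Qed.

Lemma closed_cell_bound c p j : (j < 13)%N -> closed_cell (cell_form c) p ->
  `|wval c j (chart p)| <= (wall c j).2.
Proof.
move=> j13 h; have := h (Ordinal j13, true); have := h (Ordinal j13, false).
by rewrite !aff_cell_form /= => h1 h2; rewrite ler_norml; apply/andP; split; lra.
Qed.

Lemma cell_form_neq0 c jb : (1 < n)%N -> (cell_form c jb).1 != 0.
Proof. by case: jb => j b n1; apply: normal_col_neq0 => //; exact/signedP/wall_normal. Qed.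

Lemma golden_cell_form c jb : golden o.1.1 -> golden o.1.2 -> golden o.2 ->
  (forall i, golden ((cell_form c jb).1 i 0)) /\ golden (cell_form c jb).2.
Proof.
case: jb => j b o1 o2 o3; split=> [i|]; first by rewrite mxE; exact: golden_gval.
rewrite /=; have [g1 g2] := golden_wall c j.
apply: goldenD; last by case: b => //; exact: goldenN.
apply: goldenD => //; rewrite /snval /nval /=.
by case: b; golden_tac.
Qed.

End Cells.
End Walls.

Section TwoTurns.
Variable R : realType.
Local Notation triple := (triple R).
Implicit Types (x y : triple) (c : code * code).

Lemma two_turns_uniq c c' x : two_turns c x -> two_turns c' x -> c = c'.
Proof.
move: c c' => [m1 m2] [m1' m2'] [y [h1 h2]] [y' [h1' h2']].
have [e ey] := half_turn_uniq h1 h1'; rewrite /= in e ey; subst m1' y'.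
by have [e _] := half_turn_uniq h2 h2'; rewrite /= in e; rewrite e.
Qed.

Lemma two_turns_inj c c' x x' : two_turns c x -> two_turns c' x' ->
  turn c x = turn c' x' -> c = c' /\ x = x'.
Proof.
move: c c' => [m1 m2] [m1' m2'] [y [h1 h2]] [y' [h1' h2']] e; rewrite -e in h2'.
have [e2 ey] := half_turn_inj h2 h2'; rewrite /= in e2 ey; subst m2' y'.
by have [e1 ->] := half_turn_inj h1 h1'; rewrite /= in e1; rewrite e1.
Qed.

Lemma two_turns_exists x : cube x -> generic x -> exists c, two_turns c x.
Proof.
move=> cx gx; have [m1 [x1 [h1 g1]]] := half_turn_exists cx gx.
have c1 : cube x1 by case: h1.
have [m2 [x2 [h2 g2]]] := half_turn_exists c1 g1.
exists (m1, m2), x1; split=> //=; rewrite /turn /=.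
have e1 : x1 = half_map m1 x by case: h1.
by have e2 : x2 = half_map m2 x1 by [case: h2]; rewrite -e1 -e2.
Qed.

Lemma swapK x : swap (swap x) = x.
Proof. by case: x => [[u v] s]. Qed.

Lemma cube_swap x : cube (swap x) = cube x.
Proof. by rewrite /cube /swap /=; congr (_ && _); rewrite andbC. Qed.

(** Reverse the point, find two half turns, and reverse them. *)
Lemma two_turns_onto y : cube y -> generic y -> exists c x, two_turns c x /\ turn c x = y.
Proof.
move=> cy gy.
have cy' : cube (swap y) by rewrite cube_swap.
have [c [x' [h1 h2]]] := two_turns_exists cy' (generic_swap gy).
move: (half_turn_rev h1) (half_turn_rev h2); rewrite swapK => r1 r2.
exists (rev c.2, rev c.1), (swap (turn c (swap y))).
have e2 : swap x' = half_map (rev c.2) (swap (turn c (swap y))) by case: r2.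
have e1 : y = half_map (rev c.1) (swap x') by case: r1.
have e : turn (rev c.2, rev c.1) (swap (turn c (swap y))) = y.
  by rewrite [LHS]/turn /= -e2 -e1.
by split=> //; exists (swap x'); rewrite e.
Qed.

Definition lshift x (i j l : int) : triple :=
  (x.1.1 + 2 * i%:~R, x.1.2 + 2 * j%:~R, x.2 + 2 * l%:~R).

(** A generic point has no coordinate that is an odd integer. *)
Lemma cube_reduce x : generic x -> exists i j l, cube (lshift x i j l) /\ generic (lshift x i j l).
Proof.
move=> gx; have n r (r9 : (r < 9)%N) := gx r r9.
have := n 0%N isT; have := n 1%N isT; have := n 2%N isT; rewrite nvalE0 nvalE1 nvalE2.
have w (z : R) : ~ golden z -> exists i : int, within 1 (z + 2 * i%:~R) :> bool.
  move=> nz; have [i hi] := window_exists (@ltr01 R) (golden1 R) nz.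
  by exists (- i); move: hi; congr (within _ _); rewrite intrN; ring.
move=> /w[l hl] /w[j hj] /w[i hi]; exists i, j, l; split; first by apply/and3P.
have g2 (z : int) : golden (2 * z%:~R : R).
  by apply: goldenM; [exact: golden_nat | exact: golden_int].
exact: generic_shift.
Qed.

Lemma within_lattice (z : R) (i : int) : within 1 z -> within 1 (z + 2 * i%:~R) -> i = 0.
Proof.
move=> h1 h2; apply: (window_uniq (within_le h1) h2).
by rewrite mulr1 opprD addrA subrr add0r; ring.
Qed.

Lemma cube_lattice x i j l : cube x -> cube (lshift x i j l) -> [/\ i = 0, j = 0 & l = 0].
Proof.
move=> /and3P[h1 h2 h3] /and3P[h4 h5 h6]; split.
- exact: within_lattice h1 h4.
- exact: within_lattice h2 h5.
- exact: within_lattice h3 h6.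
Qed.

Lemma two_turns_cube c x : two_turns c x -> cube x /\ cube (turn c x).
Proof. by move=> [x' [[cx _ _ _ _] [_ _ _ _ cy]]]. Qed.

(** The height is preserved modulo 2 by half turns, hence by their square. *)
Lemma half_map_height m x : exists z : int,
  (half_map m x).2 - (half_map m x).1.2 = x.2 - x.1.2 + 2 * z%:~R.
Proof.
case: m => [[[[a e] g] k] l]; exists (a + l - g); rewrite /= !(intrD, intrN); ring.
Qed.

Lemma turn_height c : exists z : int,
  (turn c (origin R)).2 - (turn c (origin R)).1.2 = 2 * z%:~R.
Proof.
have [z1 h1] := half_map_height c.1 (origin R).
have [z2 h2] := half_map_height c.2 (half_map c.1 (origin R)).
by exists (z1 + z2); rewrite /turn h2 h1 /= intrD; ring.
Qed.

End TwoTurns.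

(** Boundedness makes the pairs of codes that occur a finite family. *)
Definition code_box : finType := ('I_41 * 'I_41 * 'I_41 * 'I_41 * 'I_41)%type.
Definition unbox (i : 'I_41) : int := (i : nat)%:Z - 20.
Definition unbox_code (b : code_box) : code :=
  let: (a, e, g, k, l) := b in (unbox a, unbox e, unbox g, unbox k, unbox l).

Lemma unbox_inj : injective unbox.
Proof. by move=> i j /(can_inj (addrK _)) [] /val_inj. Qed.

Lemma unbox_code_inj : injective unbox_code.
Proof.
move=> [[[[a e] g] k] l] [[[[a' e'] g'] k'] l'].
by case; do 5 move/unbox_inj ->.
Qed.

Lemma unbox_surj (z : int) : `|z| <= 20%:Z -> exists i, unbox i = z.
Proof.
by move=> h; exists (inord (absz (z + 20))); rewrite /unbox inordK; lia.
Qed.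

Lemma unbox_code_surj m : code_bounded 20 m -> exists b, unbox_code b = m.
Proof.
case: m => [[[[a e] g] k] l] /and5P[].
move=> /unbox_surj[a' <-] /unbox_surj[e' <-] /unbox_surj[g' <-] /unbox_surj[k' <-] /unbox_surj[l' <-].
by exists (a', e', g', k', l').
Qed.

Definition turn_box : finType := (code_box * code_box)%type.
Definition unbox2 (b : turn_box) : code * code := (unbox_code b.1, unbox_code b.2).

Lemma unbox2_inj : injective unbox2.
Proof. by move=> [a b] [a' b'] [] /unbox_code_inj -> /unbox_code_inj ->. Qed.

Lemma two_turns_boxed (R : realType) c (x : triple R) : two_turns c x -> exists b, unbox2 b = c.
Proof.
case: c => [m1 m2] [x' [/half_turn_bounded/unbox_code_surj[b1 e1] /half_turn_bounded/unbox_code_surj[b2 e2]]].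
by exists (b1, b2); rewrite /unbox2 e1 e2.
Qed.

(** * The exchange of the three-dimensional torus *)

Section Exchange.
Variable R : realType.
Local Notation triple := (triple R).
Local Notation golden := (@golden R).
Implicit Types (c : code * code) (h : R).

Lemma vec2E (x y : R) : (vec2 x y 0 0 = x) * (vec2 x y 0 1 = y).
Proof. by rewrite !mxE. Qed.
Lemma vec3E (x y z : R) :
  (vec3 x y z 0 0 = x) * (vec3 x y z 0 1 = y) * (vec3 x y z 0 2 = z).
Proof. by rewrite !mxE. Qed.

Lemma ord2P (i : 'I_2) : i = 0 \/ i = 1.
Proof. by case: i => [[|[|i]]] //= hi; [left|right]; apply: val_inj. Qed.

Lemma ord3P (i : 'I_3) : [\/ i = 0, i = 1 | i = 2].
Proof.
by case: i => [[|[|[|i]]]] //= hi; [constructor 1|constructor 2|constructor 3]; apply: val_inj.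
Qed.

Lemma row2P (u v : 'rV[R]_2) : u 0 0 = v 0 0 -> u 0 1 = v 0 1 -> u = v.
Proof.
move=> h0 h1; apply/rowP => i; have [->|->] := ord2P i.
  exact: h0.
exact: h1.
Qed.

Lemma row3P (u v : 'rV[R]_3) : u 0 0 = v 0 0 -> u 0 1 = v 0 1 -> u 0 2 = v 0 2 -> u = v.
Proof.
move=> h0 h1 h2; apply/rowP => i.
have [->|->|->] := ord3P i.
- exact: h0.
- exact: h1.
- exact: h2.
Qed.

(** On the torus the third coordinate is the height S - V; in a slice the height
is constant, and V and S have the same linear part. *)
Definition lin3 (p : 'rV[R]_3) : triple := (p 0 0, p 0 1, p 0 1 + p 0 2).
Definition lin2 (p : 'rV[R]_2) : triple := (p 0 0, p 0 1, p 0 1).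

Lemma lin3E s p : (p *m normal_col R 3 s) 0 0 = snval s (lin3 p).
Proof.
rewrite mxE !big_ord_recl big_ord0 addr0 !mxE.
have -> : lift ord0 ord0 = 1 :> 'I_3 by apply: val_inj.
have -> : lift ord0 (lift ord0 ord0) = 2 :> 'I_3 by apply: val_inj.
rewrite /snval /nval /entry /signed_normal /lin3 /=.
by case: s => r [] /=; rewrite ?(gvalD, gvalN); ring.
Qed.

Lemma lin2E s p : (p *m normal_col R 2 s) 0 0 = snval s (lin2 p).
Proof.
rewrite mxE !big_ord_recl big_ord0 addr0 !mxE.
have -> : lift ord0 ord0 = 1 :> 'I_2 by apply: val_inj.
rewrite /snval /nval /entry /signed_normal /lin2 /=.
by case: s => r [] /=; rewrite ?(gvalD, gvalN); ring.
Qed.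

Definition base3 : triple := (-1, -1, -1).
Definition base2 h : triple := (-1, -1, h - 1).
Local Notation chart3 := (chart lin3 base3).
Local Notation chart2 h := (chart lin2 (base2 h)).

Lemma chart3E p : chart3 p = (p 0 0 - 1, p 0 1 - 1, p 0 1 + p 0 2 - 1).
Proof. by []. Qed.
Lemma chart2E h p : chart2 h p = (p 0 0 - 1, p 0 1 - 1, p 0 1 + (h - 1)).
Proof. by []. Qed.

Definition trans3 c : 'rV[R]_3 := let y := turn c (origin R) in
  vec3 y.1.1 y.1.2 (y.2 - y.1.2).
Definition trans2 c : 'rV[R]_2 := let y := turn c (origin R) in vec2 y.1.1 y.1.2.

(** Each pair of codes c gives a cell, on which two half turns are the translation
by [trans3 c]. *)
Definition Psihat : pfun_graph (torus R 3) (torus R 3) := fun p q =>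
  exists c u, two_turns c (chart3 u) /\ p = torus_pi u /\ q = torus_pi (u + trans3 c).

Lemma chart3_trans c u : chart3 (u + trans3 c) = turn c (chart3 u).
Proof.
rewrite turn_translation !chart3E !mxE /=; congr (_, _, _); ring.
Qed.

Lemma chart2_trans c h (z : int) u :
  (turn c (origin R)).2 - (turn c (origin R)).1.2 = 2 * z%:~R ->
  turn c (chart2 h u) = lshift (chart2 h (u + trans2 c)) 0 0 z.
Proof.
move=> ht; rewrite turn_translation /lshift !chart2E !mxE /=.
have -> : (turn c (origin R)).2 = 2 * z%:~R + (turn c (origin R)).1.2.
  by apply/eqP; rewrite -subr_eq ht.
by congr (_, _, _); ring.
Qed.

Lemma chart3_lattice u k :
  chart3 (u + lattice R k) = lshift (chart3 u) (k 0 0) (k 0 1) (k 0 1 + k 0 2).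
Proof.
rewrite /lshift !chart3E !mxE /= intrD; congr (_, _, _); ring.
Qed.

Lemma lattice0 n : lattice R (0 : 'rV[int]_n) = 0.
Proof. by rewrite /lattice map_mx0 scaler0. Qed.

Lemma chart3_torus u v : torus_pi u = torus_pi v -> cube (chart3 u) -> cube (chart3 v) -> u = v.
Proof.
move=> /torus_piP[k ->] cu; rewrite chart3_lattice => /(cube_lattice cu)[k0 k1 k2].
have -> : k = 0; last by rewrite lattice0 addr0.
apply/rowP => i; rewrite mxE.
have [->|->|->] := ord3P i.
- exact: k0.
- exact: k1.
- by move: k2; rewrite k1 add0r.
Qed.

Lemma closed_cell_coords n (lin : 'rV[R]_n -> triple)
  (linE : forall s p, (p *m normal_col R n s) 0 0 = snval s (lin p)) o c p :
  closed_cell (cell_form n o c) p ->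
  [/\ `|(chart lin o p).1.1| <= 1, `|(chart lin o p).1.2| <= 1, `|(chart lin o p).2| <= 1
    & [/\ `|(turn c (chart lin o p)).1.1| <= 1, `|(turn c (chart lin o p)).1.2| <= 1
    & `|(turn c (chart lin o p)).2| <= 1]].
Proof.
move=> hp; have b j (j13 : (j < 13)%N) := closed_cell_bound linE j13 hp.
have E j : (j < 13)%N -> wval c j (chart lin o p) = nth 0 [seq wval c j (chart lin o p) | j <- iota 0 13] j.
  by move=> j13; rewrite (nth_map 0%N) ?size_iota // nth_iota.
rewrite wval_walls in E.
by move: (b 0%N isT) (b 1%N isT) (b 2%N isT) (b 10%N isT) (b 11%N isT) (b 12%N isT); rewrite !E.
Qed.

(** Stated for a chart and a direction d that [along] sees, because the displaced
point has to stay in the slice when the chart is that of a slice. *)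
Lemma perturb n (lin : 'rV[R]_n -> triple) (d : 'rV[R]_n) o (u : 'rV[R]_n) (e : R) :
  (forall s, lin (u + s *: d) = along (lin u) s) -> 0 < e ->
  exists s, `|u - (u + s *: d)| < e /\ generic (chart lin o (u + s *: d)).
Proof.
move=> lind e0; have [s [/andP[s0 se] gs]] := generic_dense (chart lin o u)
  (divr_gt0 e0 (ltr_wpDl (normr_ge0 d) (@ltr01 R))).
exists s; split.
  rewrite opprD addrA subrr add0r normrN normrZ gtr0_norm //.
  move: se; rewrite ltr_pdivlMr ?ltr_wpDl //; apply: le_lt_trans.
  by rewrite ler_pM2l // lerDl.
have -> : chart lin o (u + s *: d) = along (chart lin o u) s; last by [].
by rewrite /chart lind /along /=; congr (_, _, _); rewrite addrAC.
Qed.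

(** Disjointness of the images reduces to [two_turns_inj], and density of the images
to [two_turns_onto]; the rest is the data of the cells. *)
Lemma exchange3 : golden_polytope_exchange Psihat.
Proof.
pose L (b : turn_box) := cell_form 3 base3 (unbox2 b).
pose t (b : turn_box) := trans3 (unbox2 b).
have opn b u : open_cell (L b) u <-> two_turns (unbox2 b) (chart3 u) by exact: open_cellP lin3E _ _ _.
have [gb0 gb1 gb2] : [/\ golden base3.1.1, golden base3.1.2 & golden base3.2].
  by split; apply: goldenN; exact: golden1.
have coords b u : closed_cell (L b) u -> forall k, `|u 0 k| <= 4 /\ `|(u + t b) 0 k| <= 4.
  move=> /(closed_cell_coords lin3E); rewrite -/chart3 -chart3_trans !chart3E !ler_norml.
  move=> [/andP[a1 a2] /andP[b1 b2] /andP[c1 c2] [/andP[d1 d2] /andP[e1 e2] /andP[f1 f2]]] k.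
  rewrite /= in a1 a2 b1 b2 c1 c2 d1 d2 e1 e2 f1 f2; rewrite !ler_norml.
  have [->|->|->] := ord3P k.
  - by split; apply/andP; split; rewrite -/(t b) in d1 d2 *; lra.
  - by split; apply/andP; split; lra.
  - by split; apply/andP; split; lra.
apply: (cell_exchange (L := L) (t := t)).
- by move=> b jb; exact: cell_form_neq0.
- by exists 4 => b u /coords.
- move=> b; apply: golden_closed_cell.
  + by exists 4 => u /coords h k; have [] := h k.
  + by move=> jb; have [] := golden_cell_form 3 (unbox2 b) jb gb0 gb1 gb2.
  + by move=> jb; have [] := golden_cell_form 3 (unbox2 b) jb gb0 gb1 gb2.
  + move=> f; apply: (@minors_normal3 R (fun k => ((wall R (unbox2 b) (f k).1).1.1, (f k).2))).
    by move=> k; apply: signedP; exact: wall_normal.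
- move=> b j; rewrite !mxE; have [g1 g2 g3] := golden_turn R (unbox2 b).
  have [->|->|->] := ord3P j.
  - exact: g1.
  - exact: g2.
  - exact: goldenB.
- move=> b b' u v /opn hu /opn hv e.
  have euv := chart3_torus e (two_turns_cube hu).1 (two_turns_cube hv).1.
  by split=> //; apply: unbox2_inj; rewrite -euv in hv; exact: two_turns_uniq hu hv.
- move=> b b' u v /opn hu /opn hv e; have := chart3_torus e.
  rewrite !chart3_trans => /(_ (two_turns_cube hu).2 (two_turns_cube hv).2) euv.
  have [eb _] : unbox2 b = unbox2 b' /\ chart3 u = chart3 v.
    by apply: two_turns_inj hu hv _; rewrite -!chart3_trans /t in euv *; rewrite euv.
  by move: euv; rewrite /t eb => /addIr ->; split=> //; exact: unbox2_inj.
- move=> u e e0.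
  have lind s : lin3 (u + s *: vec3 10 1 0) = along (lin3 u) s.
    by rewrite /lin3 /along !mxE /=; congr (_, _, _); ring.
  have [s [us gs]] := perturb base3 lind e0.
  have [i [j [l [cs gs']]]] := cube_reduce gs.
  pose k : 'rV[int]_3 := \row_m [:: i; j; l - j]`_m.
  have ck : lshift (chart3 (u + s *: vec3 10 1 0)) i j l =
      chart3 (u + s *: vec3 10 1 0 + lattice R k).
    by rewrite chart3_lattice !mxE /= subrKC.
  rewrite ck in cs gs'; have [c hc] := two_turns_exists cs gs'.
  have [b eb] := two_turns_boxed hc.
  exists b, (u + s *: vec3 10 1 0), (u + s *: vec3 10 1 0 + lattice R k); split=> //.
    by apply/opn; rewrite eb.
  by rewrite torus_pi_lattice.
- move=> u e e0.
  have lind s : lin3 (u + s *: vec3 10 1 0) = along (lin3 u) s.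
    by rewrite /lin3 /along !mxE /=; congr (_, _, _); ring.
  have [s [us gs]] := perturb base3 lind e0.
  have [i [j [l [cs gs']]]] := cube_reduce gs.
  pose k : 'rV[int]_3 := \row_m [:: i; j; l - j]`_m.
  have ck : lshift (chart3 (u + s *: vec3 10 1 0)) i j l =
      chart3 (u + s *: vec3 10 1 0 + lattice R k).
    by rewrite chart3_lattice !mxE /= subrKC.
  rewrite ck in cs gs'; have [c [x [hc ex]]] := two_turns_onto cs gs'.
  have [b eb] := two_turns_boxed hc; set y := u + s *: vec3 10 1 0 in ck cs gs' ex us *.
  pose v := y + lattice R k - trans3 c.
  have cv : chart3 v = x.
    have : turn c (chart3 v) = turn c x by rewrite -chart3_trans /v subrK ex.
    rewrite [in RHS]turn_translation [in LHS]turn_translation.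
    case: (chart3 v) x {hc ex} => [[a1 a2] a3] [[b1 b2] b3] [] /=.
    by move=> /addIr -> /addIr -> /addIr ->.
  exists b, y, v; split=> //; first by apply/opn; rewrite eb cv.
  by rewrite /t eb /v subrK torus_pi_lattice.
- move=> p q; split=> [[c [u [hu [-> ->]]]]|[b [u /opn hu [-> ->]]]].
    by have [b eb] := two_turns_boxed hu; exists b; exists u; [apply/opn; rewrite eb | rewrite /t eb].
  by exists (unbox2 b), u.
Qed.

(** * The horizontal slices *)

Lemma at_heightE h (u : 'rV[R]_2) : at_height h (torus_pi u) = torus_pi (vec3 (u 0 0) (u 0 1) h).
Proof.
have /torus_piP[k e] := esym (torus_piK (torus_pi u)).
rewrite /at_height e; apply/esym/torus_piP; exists (\row_m [:: k 0 0; k 0 1; 0]`_m).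
by apply: row3P; rewrite !mxE /=; ring.
Qed.

Lemma at_height_inj h (u v : 'rV[R]_2) : at_height h (torus_pi u) = at_height h (torus_pi v) ->
  torus_pi u = torus_pi v.
Proof.
rewrite !at_heightE => /torus_piP[k e]; apply/torus_piP; exists (\row_m [:: k 0 0; k 0 1]`_m).
by apply: row2P; [move/(congr1 (fun w : 'rV_3 => w 0 0)): e | move/(congr1 (fun w : 'rV_3 => w 0 1)): e];
  rewrite !mxE.
Qed.

Definition proj (w : 'rV[R]_3) : 'rV[R]_2 := vec2 (w 0 0) (w 0 1).

Lemma at_height_proj h (w : 'rV[R]_3) (z : int) : w 0 2 = h + 2 * z%:~R -> torus_pi w = at_height h (torus_pi (proj w)).
Proof.
move=> e; rewrite at_heightE; apply/esym/torus_piP; exists (\row_m [:: 0; 0; z]`_m).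
by apply: row3P; rewrite !mxE /= ?e; ring.
Qed.

Lemma at_height_height h (w : 'rV[R]_3) p : torus_pi w = at_height h p -> exists z : int, w 0 2 = h + 2 * z%:~R.
Proof.
rewrite -(torus_piK p) at_heightE => /esym/torus_piP[k ->]; exists (k 0 2).
by rewrite !mxE.
Qed.

Lemma trans3_height c (w : 'rV[R]_3) : exists z : int, (w + trans3 c) 0 2 = w 0 2 + 2 * z%:~R.
Proof. by have [z e] := turn_height R c; exists z; rewrite mxE vec3E e. Qed.

Lemma proj_trans3 c (w : 'rV[R]_3) : proj (w + trans3 c) = proj w + trans2 c.
Proof. by apply: row2P; rewrite !mxE. Qed.

Lemma chart3_proj h (w : 'rV[R]_3) : w 0 2 = h -> chart3 w = chart2 h (proj w).
Proof. by move=> e; rewrite chart3E chart2E !mxE /= e; congr (_, _, _); rewrite addrA. Qed.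

Lemma Psihat_horizontal h p q : Psihat p q -> horizontal_torus h p -> horizontal_torus h q.
Proof.
move=> [c [u [_ [-> ->]]]] [p' _ /esym /at_height_height[z hz]].
have [z' hz'] := trans3_height c u.
exists (torus_pi (proj (u + trans3 c))) => //; apply/esym.
by apply: (at_height_proj (z := z + z')); rewrite hz' hz intrD; ring.
Qed.

Lemma chart2_torus h h' (z : int) u v : h' = h + 2 * z%:~R -> torus_pi u = torus_pi v ->
  cube (chart2 h u) -> cube (chart2 h' v) -> u = v /\ z = 0.
Proof.
move=> -> /torus_piP[k ->] cu.
have -> : chart2 (h + 2 * z%:~R) (u + lattice R k) =
    lshift (chart2 h u) (k 0 0) (k 0 1) (k 0 1 + z).
  rewrite /lshift !chart2E !mxE /= intrD; congr (_, _, _); ring.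
move=> /(cube_lattice cu)[k0 k1 k2].
have z0 : z = 0 by move: k2; rewrite k1 add0r.
split=> //; have -> : k = 0; last by rewrite lattice0 addr0.
apply/rowP => i; rewrite mxE.
have [->|->] := ord2P i.
  exact: k0.
exact: k1.
Qed.

(** In the cube the height S - V ranges over (-2, 2), which contains at most two
lifts of the height of a horizontal torus. So the slice of a cell may have two
pieces, and the pieces are indexed by a pair of codes together with one of the two
levels. *)
Lemma slice_exchange h : golden h -> golden_polytope_exchange (restrict_to_height Psihat h).
Proof.
move=> gh; pose h0 := h - 2 * (Num.floor (h / 2))%:~R.
have h0_itv : 0 <= h0 < 2.
  have := floor_le_tmp (h / 2); have := floorD1_gt (h / 2); rewrite /h0 intrD.
  by rewrite ltr_pdivrMr // ler_pdivlMr // => *; apply/andP; split; lra.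
pose level (b : bool) : R := h0 - 2 * (b : nat)%:R.
have level_lift b : exists z : int, level b = h + 2 * z%:~R.
  exists (- Num.floor (h / 2) - (b : nat)%:Z).
  by rewrite /level /h0 intrB intrN; ring.
have levelE (z : int) x : x.2 - x.1.2 = h + 2 * z%:~R -> cube x ->
    exists b, h + 2 * z%:~R = level b.
  move=> e /and3P[_ /andP[v1 v2] /andP[s1 s2]].
  pose m := z + Num.floor (h / 2).
  have em : h + 2 * z%:~R = h0 + 2 * m%:~R by rewrite /h0 /m intrD; ring.
  have [m1 m2] : -2%:~R < m%:~R :> R /\ m%:~R < 1%:~R :> R.
    by case/andP: h0_itv => *; rewrite em in e; split; rewrite ?intrN; lra.
  rewrite em; have [->|->] : m = 0 \/ m = -1.
    move: m1 m2; rewrite -intrN !ltr_int; lia.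
    by exists false; rewrite /level mulr0 subr0 addr0.
  by exists true; rewrite /level intrN /=; ring.
have level_inj b b' : exists z : int, level b' = level b + 2 * z%:~R /\ (z = 0 -> b = b').
  exists ((b : nat)%:Z - (b' : nat)%:Z); split; first by rewrite /level intrB; ring.
  by case: b; case: b'.
pose L (i : turn_box * bool) := cell_form 2 (base2 (level i.2)) (unbox2 i.1).
pose t (i : turn_box * bool) := trans2 (unbox2 i.1).
have opn i u : open_cell (L i) u <-> two_turns (unbox2 i.1) (chart2 (level i.2) u).
  exact: open_cellP lin2E _ _ _.
have turnE i u : exists z : int, turn (unbox2 i.1) (chart2 (level i.2) u) =
    chart2 (level i.2 + 2 * z%:~R) (u + t i).
  have [z hz] := turn_height R (unbox2 i.1); exists z.
  rewrite (chart2_trans _ _ hz) /lshift !chart2E /=; congr (_, _, _); ring.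
have golden_level b : golden (level b).
  apply: goldenB; last by apply: goldenM; exact: golden_nat.
  by apply: goldenB => //; apply: goldenM; [exact: golden_nat | exact: golden_int].
have coords i u : closed_cell (L i) u -> forall k, `|u 0 k| <= 4 /\ `|(u + t i) 0 k| <= 4.
  move=> /(closed_cell_coords lin2E); have [z ->] := turnE i u; rewrite !chart2E !ler_norml.
  move=> [/andP[a1 a2] /andP[b1 b2] _ [/andP[d1 d2] /andP[e1 e2] _]] k.
  rewrite /= in a1 a2 b1 b2 d1 d2 e1 e2; rewrite !ler_norml.
  have [->|->] := ord2P k.
    by split; apply/andP; split; lra.
  by split; apply/andP; split; lra.
have gb i : [/\ golden (base2 (level i)).1.1, golden (base2 (level i)).1.2
    & golden (base2 (level i)).2].
  split; [exact/goldenN/golden1 | exact/goldenN/golden1 |].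
  by apply: goldenB => //; exact: golden1.
have lind s (u : 'rV[R]_2) : lin2 (u + s *: vec2 10 1) = along (lin2 u) s.
  by rewrite /lin2 /along !mxE /=; congr (_, _, _); ring.
(* a generic point of the slice has a lift in the cube, at one of the two levels *)
have lift u (e : R) : 0 < e -> exists y v b, [/\ `|u - y| < e, torus_pi y = torus_pi v,
    cube (chart2 (level b) v) & generic (chart2 (level b) v)].
  move=> e0; have [s [us gs]] := perturb (base2 h) (lind^~ u) e0.
  have [i [j [l [cs gs']]]] := cube_reduce gs.
  set y := u + s *: _ in us gs cs gs' *.
  pose k : 'rV[int]_2 := \row_m [:: i; j]`_m.
  have ck : lshift (chart2 h y) i j l = chart2 (h + 2 * (l - j)%:~R) (y + lattice R k).
    rewrite /lshift !chart2E !mxE /= intrB; congr (_, _, _); ring.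
  rewrite ck in cs gs'.
  have [b eb] : exists b, h + 2 * (l - j)%:~R = level b.
    by apply: levelE cs; rewrite chart2E /=; ring.
  rewrite eb in cs gs'; exists y, (y + lattice R k), b; split=> //.
  by rewrite torus_pi_lattice.
apply: (cell_exchange (L := L) (t := t)).
- by move=> i jb; exact: cell_form_neq0.
- by exists 4 => i u /coords.
- move=> i; have [g1 g2 g3] := gb i.2; apply: golden_closed_cell.
  + by exists 4 => u /coords hu k; have [] := hu k.
  + by move=> jb; have [] := golden_cell_form 2 (unbox2 i.1) jb g1 g2 g3.
  + by move=> jb; have [] := golden_cell_form 2 (unbox2 i.1) jb g1 g2 g3.
  + move=> f; apply: (@minors_normal2 R (fun k => ((wall R (unbox2 i.1) (f k).1).1.1, (f k).2))).
    by move=> k; apply: signedP; exact: wall_normal.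
- move=> i j; rewrite !mxE; have [g1 g2 _] := golden_turn R (unbox2 i.1).
  have [->|->] := ord2P j.
    exact: g1.
  exact: g2.
- move=> [b l] [b' l'] u v /opn /= hu /opn /= hv e.
  have [z [ez z0]] := level_inj l l'.
  have [euv zz] := chart2_torus ez e (two_turns_cube hu).1 (two_turns_cube hv).1.
  rewrite (z0 zz) -euv in hu hv *; split=> //.
  by congr (_, _); apply: unbox2_inj; exact: two_turns_uniq hu hv.
- move=> [b l] [b' l'] u v /opn /= hu /opn /= hv e.
  have [m em] := turnE (b, l) u; have [m' em'] := turnE (b', l') v; rewrite /= in em em'.
  have [z [ez z0]] := level_inj l l'.
  have ez' : level l' + 2 * m'%:~R = level l + 2 * m%:~R + 2 * (z + m' - m)%:~R.
    by rewrite ez !(intrD, intrN); ring.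
  have cu := (two_turns_cube hu).2; have cv := (two_turns_cube hv).2.
  rewrite em in cu; rewrite em' in cv.
  have [euv zz] := chart2_torus ez' e cu cv.
  have [eb ex] : unbox2 b = unbox2 b' /\ chart2 (level l) u = chart2 (level l') v.
    apply: two_turns_inj hu hv _; rewrite em em' -euv; congr (chart2 _ _).
    by rewrite ez' zz mulr0 addr0.
  have eu : u = v by move: euv; rewrite /t /= eb => /addIr.
  split=> //; congr (_, _); first exact: unbox2_inj.
  apply: z0; move: ex; rewrite eu ez !chart2E => -[] /addrI /eqP.
  by rewrite (inj_eq (addIr _)) eq_sym -subr_eq0 addrAC subrr add0r mulf_eq0 pnatr_eq0 /= intr_eq0 => /eqP.
- move=> u e e0; have [y [v [l [uy yv cv gv]]]] := lift u e e0.
  have [c hc] := two_turns_exists cv gv; have [b eb] := two_turns_boxed hc.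
  by exists (b, l), y, v; split=> //; apply/opn; rewrite /= eb.
- move=> u e e0; have [y [v [l [uy yv cv gv]]]] := lift u e e0.
  have [c [x [hc ex]]] := two_turns_onto cv gv; have [b eb] := two_turns_boxed hc.
  have [m hm] := turn_height R c.
  have hx : x = chart2 (level l - 2 * m%:~R) (v - trans2 c).
    have := chart2_trans (level l - 2 * m%:~R) (v - trans2 c) hm; rewrite subrK => e2.
    have : turn c x = turn c (chart2 (level l - 2 * m%:~R) (v - trans2 c)).
      rewrite ex e2 /lshift !chart2E /=; congr (_, _, _); ring.
    rewrite [in RHS]turn_translation [in LHS]turn_translation.
    case: (chart2 _ _) x {hc ex e2} => [[a1 a2] a3] [[b1 b2] b3] [] /=.
    by move=> /addIr -> /addIr -> /addIr ->.
  have [z hz] := level_lift l.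
  have [l' el'] : exists l', level l - 2 * m%:~R = level l'.
    have [l' el'] : exists l', h + 2 * (z - m)%:~R = level l'.
      apply: (@levelE _ x _ (two_turns_cube hc).1).
      by rewrite hx chart2E /= hz intrB; ring.
    by exists l'; rewrite -el' hz intrB; ring.
  exists (b, l'), y, (v - trans2 c); split=> //; first by apply/opn; rewrite /= eb -el' -hx.
  by rewrite /t /= eb subrK.
- move=> p q; split.
    move=> [c [w [hw [ep eq]]]].
    have [z hz] := at_height_height (esym ep); have [z' hz'] := trans3_height c w.
    have hw2 := hw; rewrite (chart3_proj (erefl (w 0 2))) in hw2.
    have [l el] : exists l, h + 2 * z%:~R = level l.
      by apply: levelE (two_turns_cube hw).1; rewrite chart3E /= -hz; ring.
    have [b eb] := two_turns_boxed hw.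
    exists (b, l), (proj w); first by apply/opn; rewrite /= eb -el -hz.
    split.
      rewrite -(torus_piK p) in ep *; apply: (@at_height_inj h); rewrite ep.
      exact: at_height_proj hz.
    rewrite -(torus_piK q) in eq *; apply: (@at_height_inj h); rewrite eq /t /= eb -proj_trans3.
    by apply: (@at_height_proj _ _ (z + z')); rewrite hz' hz intrD; ring.
  move=> [[b l] [u /opn /= hu [-> ->]]].
  pose w := vec3 (u 0 0) (u 0 1) (level l).
  have pw : proj w = u by apply: row2P; rewrite !mxE.
  have [z hz] := level_lift l; have [z' hz'] := trans3_height (unbox2 b) w.
  exists (unbox2 b), w; split; first by rewrite (@chart3_proj (level l)) ?pw // mxE.
  rewrite /t /= -pw -proj_trans3.
  rewrite -(@at_height_proj h w z); last by rewrite mxE.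
  rewrite -(@at_height_proj h _ (z + z')) //.
  by rewrite hz' mxE /= hz intrD; ring.
Qed.

Lemma fibered_Psihat : fibered Psihat.
Proof. by split; [exact: Psihat_horizontal | exact: slice_exchange]. Qed.

End Exchange.

(** * The embedding of the strip *)

(** The norm form a^2 + a b - b^2 represents zero trivially only: modulo 2 both
entries have to be even, and one descends. *)
Lemma golden_norm0 (a b : int) : a * a + a * b = b * b -> a = 0.
Proof.
move: {2}(absz a) (leqnn (absz a)) => n; elim: n a b => [|n IH] a b; first by lia.
move=> an e; have [//|a0] := eqVneq a 0.
have [q [r [hr ea]]] : exists q r : int, (r = 0 \/ r = 1) /\ a = 2 * q + r.
  by exists (a %/ 2)%Z, (a %% 2)%Z; lia.
have [s [t [ht eb]]] : exists s t : int, (t = 0 \/ t = 1) /\ b = 2 * s + t.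
  by exists (b %/ 2)%Z, (b %% 2)%Z; lia.
subst a b; have [er et] : r = 0 /\ t = 0.
  by case: hr ht e => -> [] -> e; split=> //; exfalso; lia.
subst r t; have q0 : q = 0 by apply: (IH q s); [lia | lia].
by rewrite q0.
Qed.

Section Embedding.
Variable R : realType.
Local Notation f := (phi R).

Lemma phi_irrational (a b : int) : f * a%:~R = b%:~R -> a = 0.
Proof.
move=> e; apply: (@golden_norm0 a b); apply/eqP; rewrite -(eqr_int R) !(intrD, intrM).
rewrite -e; have ff := congr1 (fun z => z * (a%:~R * a%:~R)) (phi_sqr R).
by apply/eqP; rewrite /= in ff; lra.
Qed.

Definition theta (p : 'rV[R]_2) : 'rV[R]_3 :=
  vec3 1 (1 / 2) 0 + vec3 (p 0 0 / f) ((p 0 0 - p 0 1) / 2) (p 0 1).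

(** If two points have lifts differing by 2 (k0, k1, k2), then phi k0 = 2 k1 + k2, so
k0 = 0 by irrationality and the heights differ by -4 k1, which the width of the
strip forbids unless k1 = 0. *)
Lemma Theta_inj : set_inj (@strip R) (@Theta R).
Proof.
move=> p q; rewrite !inE => /andP[p1 p2] /andP[q1 q2] /torus_piP[k].
move=> /rowP e; have e0 := e 0; have e1 := e 1; have e2 := e 2.
rewrite -!/(theta _) !mxE /= in e0 e1 e2.
have ex : q 0 0 - p 0 0 = 4 * (k 0 1)%:~R + 2 * (k 0 2)%:~R by lra.
have ey : q 0 1 = p 0 1 + 2 * (k 0 2)%:~R by lra.
have ef : f * (k 0 0)%:~R = (2 * k 0 1 + k 0 2)%:~R.
  rewrite intrD intrM; have f0 : f != 0 by rewrite gt_eqF ?phi_gt0.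
  have : (q 0 0 - p 0 0) / f = 2 * (k 0 0)%:~R by rewrite mulrBl; lra.
  move/(congr1 (fun z => z * f)); rewrite mulfVK // ex.
  by move=> ?; lra.
have k0 := phi_irrational ef; rewrite k0 mulr0 in ef.
have {}ef : 2 * k 0 1 + k 0 2 = 0 by apply/eqP; rewrite -(eqr_int R) -ef.
have ek : k 0 2 = - (2 * k 0 1) by lia.
have k1 : k 0 1 = 0.
  rewrite ek !(intrN, intrM) in ey.
  have : -1%:~R < (k 0 1)%:~R :> R by rewrite ?intrN; lra.
  have : (k 0 1)%:~R < 1%:~R :> R by lra.
  by rewrite -intrN !ltr_int; lia.
have k2 : k 0 2 = 0 by lia.
rewrite k1 k2 in ex ey; apply: row2P; last by lra.
by apply/esym/eqP; rewrite -subr_eq0 ex; apply/eqP; lra.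
Qed.

Lemma affine_continuous m n (i j : 'I_m) (a b c : 'rV[R]_n) :
  continuous (fun p : 'rV[R]_m => p 0 i *: a + (p 0 j *: b + c)).
Proof.
have h k (v : 'rV[R]_n) : continuous (fun p : 'rV[R]_m => p 0 k *: v).
  by move=> p; exact: (@cvgZr_tmp _ _ _ _ _ _ _ v (@coord_continuous R 1 m 0 k p)).
by move=> p; exact: (cvgD (h i a p) (cvgD (h j b p) (cvg_cst c))).
Qed.

Lemma theta_continuous : continuous theta.
Proof.
have -> : theta = fun p => p 0 0 *: vec3 f^-1 (1 / 2) 0 +
    (p 0 1 *: vec3 0 (- (1 / 2)) 1 + vec3 1 (1 / 2) 0).
  by apply/funext => p; apply: row3P; rewrite !mxE /=; ring.
exact: affine_continuous.
Qed.

(** A continuous left inverse of the lift: it turns open sets of the plane into open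
sets of space that meet the image of the lift in the right points. *)
Definition untheta (w : 'rV[R]_3) : 'rV[R]_2 := vec2 (f * (w 0 0 - 1)) (w 0 2).

Lemma thetaK p : untheta (theta p) = p.
Proof.
have f0 : f != 0 by rewrite gt_eqF ?phi_gt0.
by apply: row2P; rewrite /untheta vec2E !mxE /=; field.
Qed.

Lemma untheta_continuous : continuous untheta.
Proof.
have -> : untheta = fun w => w 0 0 *: vec2 f 0 + (w 0 2 *: vec2 0 1 + vec2 (- f) 0).
  by apply/funext => p; apply: row2P; rewrite !mxE /=; ring.
exact: affine_continuous.
Qed.

Lemma torus_pi_continuous n : continuous (@torus_pi R n).
Proof. exact: pi_continuous. Qed.

Lemma torus_pi_open n (W : set 'rV[R]_n) : open W -> open (torus_pi @` W).
Proof.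
move=> oW; have -> : open (torus_pi @` W) = open (torus_pi @^-1` (torus_pi @` W)) by [].
have -> : torus_pi @^-1` (torus_pi @` W) = \bigcup_k ((fun x => x + lattice R k) @^-1` W).
  apply/seteqP; split=> x /=.
    by move=> [w Ww /esym/torus_piP[k e]]; exists k => //=; rewrite -e.
  by move=> [k _ /= Wk]; exists (x + lattice R k) => //; exact: torus_pi_lattice.
apply: bigcup_open => k _; apply: open_comp => // x _; exact: cvg_translate.
Qed.

Lemma Theta_continuous : continuous (@Theta R).
Proof.
move=> p; apply: (@continuous_comp _ _ _ theta torus_pi).
  exact: theta_continuous.
exact: torus_pi_continuous.
Qed.

(** Two points in a ball of radius 1/2 that agree on the torus are equal. So on
the part of the strip that the lift sends into such a ball, Theta inherits a
continuous inverse from its lift. *)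
Lemma Theta_embedding : injective_embedding_on (@strip R) (@Theta R).
Proof.
have cT A : {within A, continuous (@Theta R)}.
  by apply: continuous_subspaceT; exact: Theta_continuous.
split; [exact: Theta_inj | exact: cT |] => p hp.
have h0 : (0 : R) < 1 / 2 by lra.
exists (theta @^-1` ball (theta p) (1 / 2)).
  by apply: theta_continuous; exact: nbhsx_ballx.
split; [|exact: cT|].
  move=> x y; rewrite !inE => -[sx _] [sy _]; apply: Theta_inj; exact/mem_set.
move=> U oU; exists (torus_pi @` (untheta @^-1` U `&` ball (theta p) (1 / 2))).
  apply: torus_pi_open; apply: openI; last exact: ball_open.
  by apply: open_comp => // x _; exact: untheta_continuous.
apply/seteqP; split=> x [[sx bx] hx]; split=> //.
  by exists (theta x) => //; split=> //=; rewrite thetaK.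
move: hx => /= [w [Uw bw] /esym/torus_piP[k e]].
suff k0 : k = 0 by move: Uw; rewrite /= e k0 lattice0 addr0 thetaK.
apply/rowP => j; rewrite [RHS]mxE.
move: bx bw => /ballP bx /ballP bw; rewrite e in bw.
have : `|lattice R k 0 j| < 1.
  apply: le_lt_trans (coord_le_norm _ _) _.
  have -> : lattice R k = (theta p - theta x) - (theta p - (theta x + lattice R k)).
    by rewrite opprB addrC addrA subrK addrAC subrr add0r.
  apply: le_lt_trans (ler_normB _ _) _; lra.
rewrite latticeE normrM ger0_norm // -intr_norm => h.
have : `|k 0 j|%:~R < 1%:~R :> R by lra.
by rewrite ltr_int; lia.
Qed.

End Embedding.

(** * Outer billiards on the kite *)

Section KiteGeometry.
Variable R : realType.
Local Notation f := (phi R).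
Local Notation plane := 'rV[R]_2.
Implicit Types (p q : plane) (v : vert).

Definition point (v : vert) : plane := vec2 (gval R (pos v).1) (gval R (pos v).2).

Lemma phi_exprN3 : f ^- 3 = 2 * f - 3.
Proof.
have f0 : f != 0 by rewrite gt_eqF ?phi_gt0.
have e3 : f ^+ 3 = 2 * f + 1 by rewrite !exprS expr0 mulr1 phi_sqr mulrDr mulr1 phi_sqr; ring.
have n0 : f ^+ 3 != 0 by rewrite expf_neq0.
apply: (mulfI n0); rewrite divff // e3.
by have ff := phi_sqr R; lra.
Qed.

Lemma zval3 : zval R (-3) = -3. Proof. by []. Qed.

Lemma pointE : (point W = vec2 (-1) 0) * (point N = vec2 0 1) *
  (point E = vec2 (f ^- 3) 0) * (point S = vec2 0 (-1)).
Proof.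
by split; [split; [split|]|]; rewrite /point /gval /= ?zval3 ?zvalE ?phi_exprN3 !mul0r !addr0 // addrC.
Qed.

Lemma kite_verticesP p : kite_vertices p <-> exists v, p = point v.
Proof.
rewrite /kite_vertices; split.
  by move=> [[[->|->]|->]|->]; [exists W|exists N|exists S|exists E]; rewrite pointE.
by move=> [[] ->]; rewrite pointE; [left;left;left|left;left;right|right|left;right].
Qed.

Definition insat (s : seq con) (p : plane) : bool := sat s (p 0 0) (p 0 1).

Lemma insat_conv s p q (t : R) : insat s p -> insat s q -> 0 <= t <= 1 ->
  insat s (t *: p + (1 - t) *: q).
Proof.
move=> /allP hp /allP hq /andP[t0 t1]; apply/allP => k kin.
move: (hp k kin) (hq k kin); rewrite /holds !mxE.
have -> : lhs k (t * p 0 0 + (1 - t) * q 0 0) (t * p 0 1 + (1 - t) * q 0 1) =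
    t * lhs k (p 0 0) (p 0 1) + (1 - t) * lhs k (q 0 0) (q 0 1) by rewrite /lhs; ring.
case: k.1; last by move=> *; rewrite addr_ge0 ?mulr_ge0 ?subr_ge0.
move=> h1 h2; have [->|tn] := eqVneq t 0; first by rewrite mul0r add0r subr0 mul1r.
have tp : 0 < t by rewrite lt_neqAle eq_sym tn.
by apply: ltr_wpDr; [rewrite mulr_ge0 ?subr_ge0 // ltW | rewrite mulr_gt0].
Qed.

(** Two nested convex combinations. *)
Lemma hull3 (A : set plane) (a b c : plane) (r s t : R) :
  convex_hull A a -> convex_hull A b -> convex_hull A c ->
  0 <= r -> 0 <= s -> 0 <= t -> r + s + t = 1 ->
  convex_hull A (r *: a + s *: b + t *: c).
Proof.
move=> ha hb hc r0 s0 t0 e; have [rs|rs] := eqVneq (r + s) 0.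
  have [-> ->] : r = 0 /\ s = 0 by split; lra.
  by have -> : t = 1 by [lra]; rewrite !scale0r !add0r scale1r.
have -> : r *: a + s *: b + t *: c =
    (r + s) *: ((r / (r + s)) *: a + (1 - r / (r + s)) *: b) + (1 - (r + s)) *: c.
  by apply/rowP => k; rewrite !mxE (_ : t = 1 - (r + s)); [field|lra].
have rs0 : 0 < r + s by rewrite lt_neqAle eq_sym rs addr_ge0.
apply: convex_hull_convex => //; last by apply/andP; split; lra.
apply: convex_hull_convex => //; apply/andP; split; first by rewrite divr_ge0 // ltW.
by rewrite ler_pdivrMr // mul1r; lra.
Qed.

Lemma kite_consP x y : sat kite_cons x y <->
  [/\ 0 <= x + y + 1, 0 <= x - y + 1, (2 * f + 1) * x - y - 1 <= 0
    & (2 * f + 1) * x + y - 1 <= 0].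
Proof.
rewrite /sat /kite_cons /= /holds /= andbT /lhs /gval /= !zvalE.
split=> [/and4P[]|[]] h1 h2 h3 h4; [split|apply/and4P; split]; lra.
Qed.

Lemma tri_upP x y : sat tri_up x y <->
  [/\ y <= 2, x - y + 1 <= 0 & 0 <= (2 * f + 1) * x + y - 1].
Proof.
rewrite /sat /tri_up /= /holds /= andbT /lhs /gval /= !zvalE.
split=> [/and3P[]|[]] h1 h2 h3; [split|apply/and3P; split]; lra.
Qed.

Lemma tri_lowP x y : sat tri_low x y <->
  [/\ -2 < y, x + y + 1 <= 0 & 0 <= (2 * f + 1) * x - y - 1].
Proof.
rewrite /sat /tri_low /= /holds /= andbT /lhs /gval /= !zvalE.
split=> [/and3P[]|[]] h1 h2 h3; [split|apply/and3P; split]; lra.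
Qed.

Lemma kiteP p : @kite R p <-> insat kite_cons p.
Proof.
have ff := phi_sqr R; have /andP[fl fu] := phi_bounds R; split.
  suff h : @kite R `<=` [set q | insat kite_cons q] by exact: h.
  apply: convex_hull_sub => [x y t|q /kite_verticesP[v ->]]; first exact: insat_conv.
  rewrite /=.
  rewrite /insat /point !vec2E; apply/kite_consP.
  by case: v; rewrite /gval /= ?zval3 !zvalE; split; lra.
rewrite /insat => /kite_consP[h1 h2 h3 h4].
set x := p 0 0 in h1 h2 h3 h4; set y := p 0 1 in h1 h2 h3 h4.
have hv v : convex_hull (@kite_vertices R) (point v).
  by apply: sub_convex_hull; apply/kite_verticesP; exists v.
have d0 : 2 * f - 2 != 0 by rewrite gt_eqF //; lra.
have dp : 0 < 2 * f - 2 by lra.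
(* Barycentric coordinates in the triangle WEN or WES; z is the weight of N or S *)
have main (z : R) v : point v = vec2 0 (if 0 <= y then 1 else -1) -> `|y| = z ->
    0 <= 1 - z + x -> x <= (2 * f - 3) * (1 - z) -> z <= 1 -> kite p.
  move=> ev ez k1 k2 k3.
  have -> : p = (((2 * f - 3) * (1 - z) - x) / (2 * f - 2)) *: point W +
      ((1 - z + x) / (2 * f - 2)) *: point E + z *: point v.
    rewrite ev !pointE phi_exprN3; apply: row2P; rewrite !mxE /= -/x -/y; first by field.
    rewrite !mulr0 !add0r; move: ez; case: (leP 0 y) => hy <- /=.
      by rewrite ger0_norm // mulr1.
    by rewrite ltr0_norm // mulrNN mulr1.
  apply: (hull3 (hv W) (hv E) (hv v)).
  - by apply: divr_ge0; [rewrite subr_ge0 | exact: ltW].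
  - by apply: divr_ge0 => //; exact: ltW.
  - by rewrite -ez normr_ge0.
  - by field.
have fx := congr1 (fun z => z * x) ff; rewrite /= in fx.
have fi1 : x <= (2 * f - 3) * (1 - y).
  have : 0 <= (2 * f - 3) * (1 - y - (2 * f + 1) * x) by rewrite mulr_ge0; lra.
  by lra.
have fi2 : x <= (2 * f - 3) * (1 + y).
  have : 0 <= (2 * f - 3) * (1 + y - (2 * f + 1) * x) by rewrite mulr_ge0; lra.
  by lra.
have fx1 : 0 <= f * (x - y + 1) by rewrite mulr_ge0 //; lra.
have fx2 : 0 <= f * (x + y + 1) by rewrite mulr_ge0 //; lra.
case: (leP 0 y) => hy.
  apply: (main y N); rewrite ?hy ?pointE ?ger0_norm //; nra.
apply: (main (- y) S); rewrite ?leNgt ?hy /= ?pointE ?ltr0_norm //; nra.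
Qed.

End KiteGeometry.

Section Triangles.
Variable R : realType.
Local Notation f := (phi R).
Local Notation plane := 'rV[R]_2.
Implicit Types (p q : plane).

(** The sign s = 1 gives the upper triangle and s = -1 the lower one; the weights are
barycentric coordinates. *)
Lemma triangle_hull (s x y : R) : `|s| = 1 ->
  y * s <= 2 -> x - y * s + 1 <= 0 -> 0 <= (2 * f + 1) * x + y * s - 1 ->
  convex_hull [set vec2 0 s; vec2 (- f ^- 3) (2 * s); vec2 1 (2 * s)] (vec2 x y).
Proof.
move=> s1 h1 h2 h3; have ff := phi_sqr R; have /andP[fl fu] := phi_bounds R.
have ss : s * s = 1 by have := real_normK (num_real s); rewrite s1; lra.
have d0 : 2 * f - 2 != 0 by rewrite gt_eqF //; lra.
have dp : 0 < 2 * f - 2 by lra.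
set z := y * s in h1 h2 h3; have ey : y = z * s by rewrite /z -mulrA ss mulr1.
have ff' := congr1 (fun t => t * x) ff; rewrite /= in ff'.
have fz := congr1 (fun t => t * z) ff; rewrite /= in fz.
have h4 : 0 <= x + (2 * f - 3) * (z - 1).
  have : 0 <= (2 * f - 3) * ((2 * f + 1) * x + z - 1) by rewrite mulr_ge0; lra.
  by lra.
have -> : vec2 x y = (2 - z) *: vec2 0 s +
    ((z - 1 - x) / (2 * f - 2)) *: vec2 (- f ^- 3) (2 * s) +
    ((x + (2 * f - 3) * (z - 1)) / (2 * f - 2)) *: vec2 1 (2 * s).
  rewrite phi_exprN3; apply: row2P; rewrite !mxE /= ?ey; first by field.
  by field.
apply: hull3.
- by apply: sub_convex_hull; left; left.
- by apply: sub_convex_hull; left; right.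
- by apply: sub_convex_hull; right.
- by lra.
- by apply: divr_ge0; [lra | exact: ltW].
- by apply: divr_ge0; [lra | exact: ltW].
- by field.
Qed.

Lemma trianglesP p : @triangles R p <-> insat tri_up p || insat tri_low p.
Proof.
have ff := phi_sqr R; have /andP[fl fu] := phi_bounds R; split.
  move=> [/andP[hs _] [h|h]]; apply/orP.
    left; move: p h {hs}.
    suff h : convex_hull [set vec2 0 1; vec2 (- f ^- 3) 2; vec2 1 2] `<=`
        [set q | insat tri_up q] by exact: h.
    apply: convex_hull_sub => [x y t|q]; first exact: insat_conv.
    by move=> [[|]|] ->; rewrite /= /insat !vec2E ?phi_exprN3; apply/tri_upP; split; lra.
  pose cl := [:: ge (yplus 2); ge (opl lineSW); ge lineES].
  have : insat cl p.
    move: p h {hs}.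
    suff h : convex_hull [set vec2 0 (-1); vec2 (- f ^- 3) (-2); vec2 1 (-2)] `<=`
        [set q | insat cl q] by exact: h.
    apply: convex_hull_sub => [x y t|q]; first exact: insat_conv.
    move=> [[|]|] ->; rewrite /= /insat !vec2E ?phi_exprN3 /sat /= /holds /= andbT /lhs /gval /= !zvalE;
      apply/and3P; split; lra.
  move=> /and4P[_ c1 c2 _]; right; apply/and4P; split=> //.
  by move: hs; rewrite /holds /= /lhs /gval /= !zvalE; lra.
case/orP => [/tri_upP[h1 h2 h3]|/tri_lowP[h1 h2 h3]].
  split; first by apply/andP; split; [nra|].
  left; have -> : p = vec2 (p 0 0) (p 0 1) by apply: row2P; rewrite vec2E.
  have := @triangle_hull 1 (p 0 0) (p 0 1); rewrite normr1 !mulr1; exact.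
split; first by apply/andP; split; [|nra].
right; have -> : p = vec2 (p 0 0) (p 0 1) by apply: row2P; rewrite vec2E.
have := @triangle_hull (-1) (p 0 0) (p 0 1); rewrite normrN normr1 !mulrN1; apply => //; lra.
Qed.

End Triangles.

Lemma has_verts (a : pred vert) : has a verts -> exists v, a v.
Proof. by case/or4P => [h|h|h|/orP[h|//]]; eexists; exact: h. Qed.

(** The form is nonnegative at p when the vertex k lies to the right of the ray from
p through v, or on its line. *)
Definition side (v k : vert) : gnum * gnum * gnum :=
  let: (v, k) := (pos v, pos k) in
  (gadd k.2 (gopp v.2), gadd v.1 (gopp k.1),
   gadd (gmul v.2 k.1) (gopp (gmul v.1 k.2))).
Definition tan_cons (v : vert) : seq con := [seq ge (side v k) | k <- verts].

(** If the kite lies to the right of the line from p through v, then p lies in the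
kite or in the open cone of v, or it has a second tangent vertex. *)
Lemma tangent_cones : all (fun v => covered
  (kite_cons :: cone v :: [seq tan_cons u | u <- verts & pos u != pos v]) tests (tan_cons v)) verts.
Proof. by vm_cast_no_check (erefl true). Qed.

Section Billiards.
Variable R : realType.
Local Notation f := (phi R).
Local Notation plane := 'rV[R]_2.
Implicit Types (p q : plane) (u v : vert).

Lemma point_inj u v : point R u = point R v -> pos u = pos v.
Proof.
have /andP[fl fu] := phi_bounds R => e.
move: (congr1 (fun p : plane => p 0 0) e) (congr1 (fun p : plane => p 0 1) e); clear e.
by case: u; case: v => //; rewrite !vec2E /gval /= ?zval3 !zvalE => h1 h2; exfalso; lra.
Qed.

Lemma tangentP p (w : plane) : @tangent_at R p w <-> exists2 v, w = point R v & insat (tan_cons v) p.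
Proof.
have side_right v k : holds (ge (side v k)) (p 0 0) (p 0 1) <->
    on_right p (2 *: point R v - p) (point R k).
  rewrite /holds /= /lhs /on_right !mxE /= /cx /cy /cc /= !(gvalD, gvalN, gvalM).
  by split=> h; lra.
split.
  move=> [/kite_verticesP[v ->] h]; exists v => //.
  have hk k : holds (ge (side v k)) (p 0 0) (p 0 1).
    by apply/side_right; apply: h; apply: sub_convex_hull; apply/kite_verticesP; exists k.
  by rewrite /insat /sat /tan_cons all_map /= !hk.
move=> [v ->]; rewrite /insat /sat /tan_cons all_map => /all_verts h; split; first by apply/kite_verticesP; exists v.
suff : @kite R `<=` [set k | on_right p (2 *: point R v - p) k] by [].
apply: convex_hull_sub => [x y t|q /kite_verticesP[k ->]]; last first.
  by apply/side_right; exact: h.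
rewrite /= /on_right => hx hy /andP[t0 t1]; rewrite ![(_ + _ : plane) _ _]mxE ![(_ *: _ : plane) _ _]mxE.
move: (ler_wpM2l t0 hx); have t1' : 0 <= 1 - t by lra.
move: (ler_wpM2l t1' hy); rewrite ![(_ + _ : plane) _ _]mxE ![(_ *: _ : plane) _ _]mxE.
by rewrite !mulr0; lra.
Qed.

(** Uniqueness of the tangent vertex excludes the boundary of the cones, by
[tangent_cones]. *)
Lemma billiardsP p q : @outer_billiards R p q ->
  exists2 v, insat (cone v) p & q = 2 *: point R v - p.
Proof.
move=> [/kiteP nk [w [/tangentP[v -> hv] uv] ->]]; exists v => //.
have := all_verts v tangent_cones; cbv beta => /coveredP/(_ hv).
rewrite /sat_any -cat1s -[cone v :: _]cat1s !has_cat !has_seq1 => /or3P[hk|//|]; first by case: nk.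
rewrite has_map has_count count_filter -has_count => /has_verts[u /andP[hu ne]]; exfalso.
have /uv/point_inj e : tangent_at p (point R u) by apply/tangentP; exists u.
by rewrite e eqxx in ne.
Qed.

Lemma psiP p q : @psi R p q -> ~~ insat kite_cons p /\
  exists X Y, insat (dom X Y) p /\
    q = vec2 (p 0 0 + gval R (jump X Y).1) (p 0 1 + gval R (jump X Y).2).
Proof.
move=> [r [hpr hrq]]; have [nk _] := hpr; split; first by apply/negP => /kiteP.
have [X hX eX] := billiardsP hpr; have [Y hY eY] := billiardsP hrq.
exists X, Y; split.
  rewrite /insat /dom sat_cat; apply/andP; split=> //.
  by rewrite sat_reflect; move: hY; rewrite /insat eX !mxE /=.
rewrite eY eX; apply: row2P; rewrite !mxE /= /jump /ptscale /ptadd /=.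
  by rewrite !(gvalM, gvalD, gval_int) /= zvalN1 zval2; ring.
by rewrite !(gvalM, gvalD, gval_int) /= zvalN1 zval2; ring.
Qed.

End Billiards.

(** * The two components of the strip *)

(** The upper and lower half of each side of the strip, closed up so as to contain
the base point of the side. *)
Definition halves (up : bool) : seq (seq con) :=
  let side (l : gnum * gnum * gnum) := gt (if up then l else opl l) in
  [:: [:: ge (yplus 0); ge (yminus 2); side lineWN; side lineNE];
      [:: gt (yplus 2); ge (yminus 0); side lineSW; side lineES]].

Definition sides (up : bool) : seq (seq con) := if up then right_cons else left_cons.

Lemma regions_disjoint : all (fun s => all (fun t => infeasible (s ++ t))
  (kite_cons :: above_cons ++ below_cons)) (right_cons ++ left_cons).
Proof. by vm_cast_no_check (erefl true). Qed.

Lemma halves_covered : all (fun up => all (covered (sides up) tests) (halves up)) [:: true; false].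
Proof. by vm_cast_no_check (erefl true). Qed.

Lemma sides_halves : all (fun up => all (fun t => has (all (implies t)) (halves up)) (sides up))
  [:: true; false].
Proof. by vm_cast_no_check (erefl true). Qed.

Section Components.
Variable R : realType.
Local Notation f := (phi R).
Local Notation plane := 'rV[R]_2.
Local Notation region := (@strip R `\` (@kite R `|` @triangles R)).
Implicit Types (p q : plane) (up : bool).

Definition on_side up (p : plane) : bool := sat_any (sides up) (p 0 0) (p 0 1).
Definition base up : plane := vec2 (if up then 2 else -2) 0.

Lemma on_side_out up p : on_side up p ->
  [&& ~~ insat kite_cons p, ~~ sat_any above_cons (p 0 0) (p 0 1) &
      ~~ sat_any below_cons (p 0 0) (p 0 1)].
Proof.
move=> /hasP[s sin hs].
have sin' : s \in right_cons ++ left_cons.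
  by rewrite mem_cat; apply/orP; case: up sin => h; [left|right]; exact: h.
have /allP/(_ s sin')/allP h := regions_disjoint.
have {}h t : t \in kite_cons :: above_cons ++ below_cons -> ~~ insat t p.
  move=> tin; apply/negP => ht; apply: (infeasibleP (x := p 0 0) (y := p 0 1) (h t tin)).
  by rewrite sat_cat hs.
have h1 t : t \in above_cons ++ below_cons -> ~~ insat t p.
  by move=> tin; apply: h; rewrite in_cons; apply/orP; right; exact: tin.
apply/and3P; split; first by apply: h; exact: mem_head.
  by apply/hasPn => t tin; apply: h1; rewrite mem_cat; apply/orP; left; exact: tin.
by apply/hasPn => t tin; apply: h1; rewrite mem_cat; apply/orP; right; exact: tin.
Qed.

Lemma aboveE p : sat_any above_cons (p 0 0) (p 0 1) = (2 < p 0 1) || insat tri_up p.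
Proof.
transitivity (holds (gt (yplus (-2))) (p 0 0) (p 0 1) && true || (insat tri_up p || false)) => //.
by rewrite andbT orbF /holds /lhs /gval /= !zvalE; congr (_ || _); apply/idP/idP; lra.
Qed.

Lemma belowE p : sat_any below_cons (p 0 0) (p 0 1) = (p 0 1 <= -2) || insat tri_low p.
Proof.
transitivity (holds (ge (yminus (-2))) (p 0 0) (p 0 1) && true || (insat tri_low p || false)) => //.
by rewrite andbT orbF /holds /lhs /gval /= !zvalE; congr (_ || _); apply/idP/idP; lra.
Qed.

Lemma regionP p : region p <-> exists up, on_side up p.
Proof.
split.
  move=> [/andP[s1 s2] nkt].
  have nk : ~~ insat kite_cons p by apply/negP => /kiteP h; apply: nkt; left.
  have nt : ~~ (insat tri_up p || insat tri_low p) by apply/negP => /trianglesP h; apply: nkt; right.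
  move: nt; rewrite negb_or => /andP[/negbTE n1 /negbTE n2].
  case/or4P: (classify nk) => h; [by exists true|by exists false|exfalso|exfalso].
    by move: h; rewrite aboveE n1 orbF ltNge s2.
  by move: h; rewrite belowE n2 orbF leNgt s1.
move=> [up /on_side_out]; rewrite aboveE belowE !negb_or -leNgt -ltNge.
move=> /and3P[n1 /andP[n2 n3] /andP[n4 n5]]; split.
  by apply/andP.
move=> [/kiteP h|/trianglesP/orP[h|h]]; first by rewrite h in n1.
  by rewrite h in n3.
by rewrite h in n5.
Qed.

(** Vanishes on the two rays from the western vertex along the sides of the kite,
which the kite and the triangles cover within the strip. *)
Definition gauge p : R := p 0 0 + 1 - `|p 0 1|.

Lemma gauge_continuous : continuous gauge.
Proof.
move=> p; have h0 := @coord_continuous R 1 2 0 0 p; have h1 := @coord_continuous R 1 2 0 1 p.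
exact: (cvgB (V := R) (cvgD (V := R) h0 (cvg_cst (1 : R))) (cvg_norm h1)).
Qed.

Lemma gauge_side up p : on_side up p -> if up then 0 < gauge p else gauge p < 0.
Proof.
case: up; rewrite /on_side /sat_any /= /holds /lhs /gval /= !orbF !andbT !zvalE /gauge;
  case/orP => /and4P[h1 h2 h3 h4].
- by rewrite ger0_norm; lra.
- by rewrite ler0_norm; lra.
- by rewrite ger0_norm; lra.
- by rewrite ler0_norm; lra.
Qed.

Lemma base_side up : all (fun s => insat s (base up)) (halves up).
Proof.
have /andP[fl fu] := phi_bounds R.
by case: up; rewrite /base /halves /= /insat !vec2E /sat /= /holds /lhs /gval /= !zvalE;
  rewrite !andbT; apply/andP; split; apply/and4P; split; lra.
Qed.

Lemma halves_side up s p : s \in halves up -> insat s p -> on_side up p.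
Proof.
move=> sin hs; have /andP[h1 /andP[h2 _]] := halves_covered.
have h : all (covered (sides up) tests) (halves up) by case: (up).
by have /allP/(_ s sin) hc := h; exact: (coveredP hc hs).
Qed.

(** The gauge cannot vanish on the complement of the kite and the triangles, so
it separates the two sides; and each side is star-shaped about its base point. *)
Lemma componentP up p : connected_component region (base up) p <-> on_side up p.
Proof.
have baseside : on_side up (base up).
  have /andP[h _] := base_side up; apply: halves_side h; exact: mem_head.
split.
  move=> hp; have hr : region p by exact: (connected_component_sub hp).
  have /regionP[up' hup'] := hr.
  have [<- //|ne] := eqVneq up' up; exfalso.
  pose C := connected_component region (base up).
  have Cb : C (base up) by apply: connected_component_refl; apply/regionP; exists up.
  have : connected (gauge @` C).
    apply: connected_continuous_connected; first exact: component_connected.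
    by apply: continuous_subspaceT; exact: gauge_continuous.
  move/connected_intervalP => itv.
  have [q Cq q0] : (gauge @` C) 0.
    have gp : (gauge @` C) (gauge p) by exists p.
    have gb : (gauge @` C) (gauge (base up)) by exists (base up).
    have := gauge_side hup'; have := gauge_side baseside.
    move: gp gb itv; move: (gauge @` C) => G; clear C Cb hp hup' baseside.
    case: up up' ne => [] [] // _ gp gb itv h1 h2.
      by apply: (itv _ _ gp gb); rewrite !ltW.
    by apply: (itv _ _ gb gp); rewrite !ltW.
  have /regionP[uq huq] : region q by exact: (connected_component_sub Cq).
  by have := gauge_side huq; rewrite q0 ltxx; case: (uq).
move=> hp.
have [s sin hs] : exists2 s, s \in halves up & insat s p.
  have /andP[h1 /andP[h2 _]] := sides_halves; case/hasP: hp => t tin ht.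
  have : all (fun t => has (all (implies t)) (halves up)) (sides up) by case: (up).
  move=> /allP/(_ t tin)/hasP[s sin /allP hs]; exists s => //.
  by apply/allP => k /hs hk; exact: impliesP hk ht.
pose seg (t : R) : plane := t *: p + (1 - t) *: base up.
have segc : continuous seg.
  move=> t; apply: cvgD; first by apply: cvgZr_tmp; exact: cvg_id.
  by apply: cvgZr_tmp; apply: cvgB; [exact: cvg_cst|exact: cvg_id].
have : connected (seg @` `[0, 1]).
  apply: connected_continuous_connected; first exact: segment_connected.
  exact: continuous_subspaceT.
suff : (seg @` `[0, 1]) (base up) /\ seg @` `[0, 1] `<=` region.
  move=> [h1 h2] h3; apply: (connected_component_max h1 h2 h3).
  by exists 1; rewrite /= ?in_itv /= ?lexx ?ler01 // /seg scale1r subrr scale0r addr0.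
split.
  by exists 0; rewrite /= ?in_itv /= ?lexx ?ler01 // /seg scale0r add0r subr0 scale1r.
move=> _ [t /= tin <-]; apply/regionP; exists up.
apply: (halves_side sin); apply: insat_conv hs _ _; last by move: tin; rewrite in_itv.
by move/allP: (base_side up); exact.
Qed.

End Components.

(** * The return map *)

Section Return.
Variable R : realType.
Local Notation plane := 'rV[R]_2.
Local Notation region := (@strip R `\` (@kite R `|` @triangles R)).
Implicit Types (p q w z : plane) (up : bool).

Definition half_return p z : Prop := Pin 5 (p 0 0) (p 0 1) (z 0 0) (z 0 1).

(** An orbit before its arrival on the other side: still at its start, or in the
course of the half turn. *)
Definition crossing up p w : Prop :=
  (on_side up w /\ w = p) \/ enroute up (p 0 0) (p 0 1) (w 0 0) (w 0 1).

Lemma crossing_step up p w w' : crossing up p w -> @psi R w w' -> ~~ insat kite_cons w' ->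
  (on_side (~~ up) w' /\ half_return p w') \/ enroute up (p 0 0) (p 0 1) (w' 0 0) (w' 0 1).
Proof.
move=> src /psiP[_ [X [Y [hd ew]]]] nk.
have e0 : w' 0 0 = w 0 0 + gval R (jump X Y).1 by rewrite ew vec2E.
have e1 : w' 0 1 = w 0 1 + gval R (jump X Y).2 by rewrite ew vec2E.
rewrite /half_return /on_side /sides if_neg; move: nk; rewrite /insat e0 e1 => nk.
apply: orbit_step hd nk; case: src => [[hw <-]|h]; last by right; exact: h.
by left; split; [exact: hw | exact: Pin_start].
Qed.

Lemma side_exclusive up p : on_side up p -> ~ on_side (~~ up) p.
Proof.
by move=> /gauge_side h1 /gauge_side h2; case: up h1 h2 => /= h1 h2; have := lt_trans h1 h2; rewrite ltxx.
Qed.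

Lemma enroute_outside up up' p w : on_side up' w -> ~ enroute up (p 0 0) (p 0 1) (w 0 0) (w 0 1).
Proof. by move=> /on_side_out/and3P[_ h1 h2] [h _]; case: up h => h; rewrite h in h1 h2. Qed.

(** An orbit cannot return to its side before it has visited the other side, and
once it is there the roles of the sides are exchanged. *)
Lemma first_return_crosses up p q : first_return (@psi R) (on_side up) p q ->
  exists2 z, half_return p z & half_return z q.
Proof.
move=> [n [u [[hp u0] step out hq un]]].
pose state w := crossing up p w \/
  exists z, [/\ on_side (~~ up) z, half_return p z & crossing (~~ up) z w].
have st i : (i <= n)%N -> state (u i).
  elim: i => [|i IH] hi; first by rewrite u0; left; left.
  have nk : ~~ insat kite_cons (u i.+1) by have /psiP[] := step _ hi.
  have hs := step i (ltnW hi); case: (IH (ltnW hi)) => [src|[z [z1 z2 src]]].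
    case: (crossing_step src hs nk) => [[h1 h2]|h]; last by left; right.
    by right; exists (u i.+1); split => //; left.
  case: (crossing_step src hs nk); rewrite ?negbK.
    by move=> [h1 _]; exfalso; apply: (out i.+1 _ h1); rewrite /= hi.
  by move=> h; right; exists z; split => //; right.
have nk : ~~ insat kite_cons q by have /and3P[] := on_side_out hq.
have := step n (leqnn n); rewrite un => hs.
case: (st n (leqnn n)) => [src|[z [z1 z2 src]]]; case: (crossing_step src hs nk).
- by move=> [h _]; case: (side_exclusive hq h).
- by move=> h; case: (enroute_outside hq h).
- by move=> [_ h]; exists z.
- by move=> h; case: (enroute_outside hq h).
Qed.

Lemma component_side up :
  connected_component region (base R up) = [set p | on_side up p].
Proof. by apply/seteqP; split => p /=; move/componentP. Qed.

(** The points that Psi fixes by definition are fixed by the pinwheel as well. *)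
Lemma PsiP p q : @Psi R p q -> exists2 z, half_return p z & half_return z q.
Proof.
case=> [[hp ->]| |]; last 2 first.
- have -> : @strip_minus R = on_side false by exact: (component_side false).
  exact: first_return_crosses.
- have -> : @strip_plus R = on_side true by exact: (component_side true).
  exact: first_return_crosses.
have h : half_return p p.
  apply: Pin_identity; apply/or3P; case: hp => [/kiteP h|/trianglesP/orP[h|h]].
  - by constructor 1; exact: h.
  - by constructor 2; exact: h.
  - by constructor 3; exact: h.
by exists p.
Qed.

End Return.

(** * The semi-conjugacy *)
Section StripChain.
Variable R : realType.
Local Notation f := (phi R).

(** The strips in the normalization of the windows of [half_turn]. *)
Lemma Pin5P (x y zx zy : R) : Pin 5 x y zx zy -> exists n1 n2 n3 n4 n5 : int,
  let y1 := y + 4 * n1%:~R in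
  let x2 := x - 2 * n2%:~R in let y2 := y1 + 2 * n2%:~R in
  let x3 := x2 + (4 - 4 * f) * n3%:~R in
  let x4 := x3 - 2 * n4%:~R in let y4 := y2 - 2 * n4%:~R in
  [/\ -1 <= (x - y1 - 1) / 2 <= 1,
      - (f + 1) <= ((2 * f + 1) * x2 - y2 - 1) / 2 + (f + 1) <= f + 1,
      - (f + 1) <= ((2 * f + 1) * x3 + y2 - 1) / 2 + (f + 1) <= f + 1,
      -1 <= (x4 + y4 - 1) / 2 <= 1 & zx = x4 /\ zy = y4 + 4 * n5%:~R].
Proof.
have z4 : zval R 4 = 4 by []. have z3 : zval R 3 = 3 by []. have zm2 : zval R (-2) = -2 by [].
have zm4 : zval R (-4) = -4 by [].
have tE : (gval R (gint 0) = 0) * (gval R (gint 4) = 4) * (gval R (gint (-2)) = -2) *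
    (gval R (gint 2) = 2) * (gval R (4, -4)%ZZ = 4 - 4 * f).
  by rewrite !gval_int zval0 z4 zm2 zval2 /gval /= z4 zm4 mulNr.
move=> [x4 [y4 [m5 [[x3 [y3 [m4 [[x2 [y2 [m3 [[x1 [y1 [m2
  [[x0 [y0 [m1 [[-> ->] _ ex1 ey1]]]] s1 ex2 ey2]]]] s2 ex3 ey3]]]] s3 ex4 ey4]]]] s4 ezx ezy]]]].
move: ex1 ey1 ex2 ey2 ex3 ey3 ex4 ey4 ezx ezy; rewrite /trans /= !tE /zval.
move=> ex1 ey1 ex2 ey2 ex3 ey3 ex4 ey4 ezx ezy; exists (int_of_Z m1), (int_of_Z m2), (int_of_Z m3), (int_of_Z m4), (int_of_Z m5) => /=.
have ex1' : x1 = x by rewrite ex1 mulr0 addr0.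
have ey1' : y1 = y + 4 * (int_of_Z m1)%:~R by rewrite ey1; ring.
have ex2' : x2 = x - 2 * (int_of_Z m2)%:~R by rewrite ex2 ex1'; ring.
have ey2' : y2 = y + 4 * (int_of_Z m1)%:~R + 2 * (int_of_Z m2)%:~R by rewrite ey2 ey1'; ring.
rewrite -ey1' -ex1' in ex2' ey2' *.
have ex3' : x3 = x2 + (4 - 4 * f) * (int_of_Z m3)%:~R by rewrite ex3; ring.
have ey3' : y3 = y2 by rewrite ey3 mulr0 addr0.
have ex4' : x4 = x3 - 2 * (int_of_Z m4)%:~R by rewrite ex4; ring.
have ey4' : y4 = y2 - 2 * (int_of_Z m4)%:~R by rewrite ey4 ey3'; ring.
rewrite -ex2' -ey2' -ex3' -ex4' -ey4'; move: s1 s2 s3 s4; rewrite ey3'.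
rewrite /sat /= /holds /= /lhs /gval /= !andbT !zvalE z3 z4 zm2.
clear - ezx ezy; move=> /andP[a1 a2] /andP[b1 b2] /andP[c1 c2] /andP[d1 d2].
split; try (apply/andP; split; lra).
by split; [rewrite ezx | rewrite ezy]; ring.
Qed.

(** The integers k0, k1, k2 measure the position of the lift (U, V, S) relative to the
plane. They and the code determine the multiples n1, n2, n3, n4 of the pinwheel, one
window at a time, because each strip is the closure of a window; n5 only affects
the lift of the end point. *)
Lemma strip_chain (x y zx zy U V S : R) m X' : Pin 5 x y zx zy -> half_turn m (U, V, S) X' ->
  forall k0 k1 k2 : int, x = f * (U - 2 * k0%:~R) -> (x - y - 1) / 2 = V - 2 * k1%:~R ->
    y = S - V - 2 * k2%:~R ->
  exists j0 j1 j2 : int, [/\ zx = f * (X'.1.1 + 2 * j0%:~R),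
    (zx - zy - 1) / 2 = X'.1.2 + 2 * j1%:~R & zy = X'.2 - X'.1.2 + 2 * j2%:~R].
Proof.
case: m => [[[[a e] g] k] l].
move=> /Pin5P[n1 [n2 [n3 [n4 [n5 [s1 s2 s3 s4 [ezx ezy]]]]]]].
move=> [/and3P[_ c1 _] c2 c3 eX /and3P[_ _ c4]] k0 k1 k2 ex ev ey.
have ff := phi_sqr R.
have fu := congr1 (fun t => t * U) ff; have fk := congr1 (fun t => t * k0%:~R) ff.
have f2 := congr1 (fun t => t * n2%:~R) ff; have f3 := congr1 (fun t => t * n3%:~R) ff.
have fx := congr1 (fun t => f * t) ex; have f4 := congr1 (fun t => t * n4%:~R) ff; rewrite /= in fu fk f2 f3 f4 fx.
have e1 : - n1 = k1.
  apply/esym; apply: window_uniq s1 c1 _; rewrite /= intrN; lra.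
have e2 : n2 + k0 = a.
  apply: window_uniq s2 c2 _; rewrite /= -e1 intrN intrD in ev *; lra.
have e3 : n3 + k0 = e.
  apply: window_uniq s3 c3 _; rewrite /= -e2 -e1 !intrD intrN in ev *; lra.
have e4 : n4 + k0 = g.
  by move: c4; rewrite eX /= => c4; apply: window_uniq s4 c4 _; rewrite /= -e3 -e1 !intrD intrN in ev *; lra.
exists (k0 + k), (2 * k1 + k2 + l - n5), (- (k2 + l + 2 * k1 - 2 * n5)).
rewrite eX /= -e2 -e3 -e4 -e1 !(intrN, intrD, intrM) ezx ezy in ev *.
clear - ex ev ey ff fu fk f2 f3 f4 fx; split; lra.
Qed.
End StripChain.

Section SemiConjugacy.
Variable R : realType.
Local Notation f := (phi R).
Local Notation chart3 := (chart (@lin3 R) (base3 R)).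

Lemma half_return_turn p z m u X : half_return p z -> Theta p = torus_pi u ->
  half_turn m (chart3 u) X -> exists2 u', Theta z = torus_pi u' & chart3 u' = X.
Proof.
move=> hr /torus_piP[k /rowP ek] ht.
have f0 : f != 0 by rewrite gt_eqF ?phi_gt0.
have e0 := ek 0; have e1 := ek 1; have e2 := ek 2; rewrite !mxE /= in e0 e1 e2.
rewrite chart3E in ht.
have [j0 [j1 [j2 [h0 h1 h2]]]] := strip_chain hr ht (k0 := k 0 0) (k1 := k 0 1) (k2 := k 0 2)
  ltac:(by rewrite e0; field) ltac:(by rewrite e1; field) ltac:(by rewrite e2; ring).
exists (vec3 (X.1.1 + 1) (X.1.2 + 1) (X.2 - X.1.2)).
  apply/esym/torus_piP; exists (\row_j [:: j0; j1; j2]`_j).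
  apply: row3P; rewrite !mxE /=; first by rewrite h0; field.
    by lra.
  by rewrite h2; ring.
by rewrite chart3E !mxE /=; case: X {ht h0 h1 h2} => [[X1 X2] X3] /=; congr (_, _, _); ring.
Qed.

(** Both maps are two half turns, and the half turns correspond. *)
Lemma Theta_semi_conjugacy :
  semi_conjugacy (@strip R) (@Theta R) (@Psi R) (@Psihat R).
Proof.
move=> p q r _ /PsiP[z h1 h2] [c [u [[X [t1 t2]] [eu ->]]]].
have [u1 e1 c1] := half_return_turn h1 eu t1.
rewrite -c1 in t2; have [u2 -> c2] := half_return_turn h2 e1 t2.
rewrite -chart3_trans !chart3E in c2; congr torus_pi.
by case: c2 => c20 c21 c22; apply: row3P; lra.
Qed.

End SemiConjugacy.

Theorem theorem5p1 (R : realType) :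
  exists Psihat : pfun_graph (torus R 3) (torus R 3),
    [/\ golden_polytope_exchange Psihat,
        fibered Psihat,
        injective_embedding_on (@strip R) (@Theta R) &
        semi_conjugacy (@strip R) (@Theta R) (@Psi R) Psihat].
Proof.
exists (@Psihat R); split.
- exact: exchange3.
- exact: fibered_Psihat.
- exact: Theta_embedding.
- exact: Theta_semi_conjugacy.
Qed.
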